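(* Let $f\in\mathcal{S}^{*}$. Then $B(0,\tfrac14)\subset f(\mathbb{B})$. The estimate is precise (the radius $\tfrac14$ cannot be replaced by a larger constant valid for all $f\in\mathcal{S}^*$).
   Context: $\mathbb{H}$ denotes the quaternions, $B(q_0,r)=\{q\in\mathbb{H}:|q-q_0|<r\}$, $\mathbb{B}=B(0,1)$, $\mathbb{S}=\{q\in\mathbb{H}:q^2=-1\}$; for $I\in\mathbb{S}$, $\mathbb{C}_I=\mathbb{R}\oplus I\mathbb{R}$ and $\mathbb{B}_I=\mathbb{B}\cap\mathbb{C}_I$. A function $f:\mathbb{B}\to\mathbb{H}$ is (left) slice regular if for every $I\in\mathbb{S}$ the restriction $f_I=f|_{\mathbb{B}_I}$ has continuous partial derivatives and $\frac12\left(\frac{\partial}{\partial x}+I\frac{\partial}{\partial y}\right)f_I(x+yI)=0$ on $\mathbb{B}_I$; equivalently $f(q)=\sum_{n\ge0}q^na_n$ on $\mathbb{B}$ with $a_n\in\mathbb{H}$. Its slice derivative is $f'(x+yI)=\frac12\left(\frac{\partial}{\partial x}-I\frac{\partial}{\partial y}\right)f_I(x+yI)$, i.e. $f'(q)=\sum_{n\ge1}q^{n-1}na_n$. $\mathcal{S}$ is the set of slice regular $f:\mathbb{B}\to\mathbb{H}$ whose zero set is $\mathcal{Z}_f=\{0\}$ and with $f'(0)=1$. The class of slice starlike functions $\mathcal{S}^{*}$ is the set of $f\in\mathcal{S}$ such that $\mathrm{Re}\big(f(q)^{-1}qf'(q)\big)>0$ for $q\in\mathbb{B}$ (pointwise products;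 at $q=0$ the expression is understood as its limit value $1$). *)

(* Defs.v *)
From Stdlib Require Import Reals Lra Psatz.
From Coquelicot Require Import Coquelicot.
Open Scope R_scope.

(** * Quaternions *)

(* [(a, b, c, d)] is [a + b i + c j + d k].  The additive, topological and
   real normed structures are those of the product R * R * R * R. *)
Definition quat : Type := (R * R * R * R)%type.

Definition prod4_NormedModule : NormedModule R_AbsRing :=
  prod_NormedModule R_AbsRing
    (prod_NormedModule R_AbsRing
      (prod_NormedModule R_AbsRing R_NormedModule R_NormedModule)
      R_NormedModule)
    R_NormedModule.

Canonical quat_UniformSpace : UniformSpace :=
  UniformSpace.Pack quat (UniformSpace.class prod4_NormedModule) quat.
Canonical quat_AbelianGroup : AbelianGroup :=
  AbelianGroup.Pack quat (AbelianGroup.class prod4_NormedModule) quat.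
Canonical quat_ModuleSpace : ModuleSpace R_Ring :=
  ModuleSpace.Pack R_Ring quat (ModuleSpace.class R_Ring prod4_NormedModule) quat.
Canonical quat_NormedModuleAux : NormedModuleAux R_AbsRing :=
  NormedModuleAux.Pack R_AbsRing quat
    (NormedModuleAux.class R_AbsRing prod4_NormedModule) quat.
Canonical quat_NormedModule : NormedModule R_AbsRing :=
  NormedModule.Pack R_AbsRing quat
    (NormedModule.class R_AbsRing prod4_NormedModule) quat.

Definition qmult (p q : quat) : quat :=
  let '(a, b, c, d) := p in
  let '(a', b', c', d') := q in
  (a * a' - b * b' - c * c' - d * d',
   a * b' + b * a' + c * d' - d * c',
   a * c' - b * d' + c * a' + d * b',
   a * d' + b * c' - c * b' + d * a').

Definition qone : quat := (1, 0, 0, 0).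

Lemma quat_eq (a b c d a' b' c' d' : R) :
  a = a' -> b = b' -> c = c' -> d = d' ->
  ((a, b, c, d) : quat) = (a', b', c', d').
Proof. now intros -> -> -> ->. Qed.

Ltac quat_simpl :=
  repeat (progress (unfold minus, plus, opp, scal, zero, one, mult; simpl)).
Ltac quat_ring :=
  repeat match goal with
         | q : quat |- _ => destruct q as [[[? ?] ?] ?]
         end;
  apply quat_eq; quat_simpl; ring.

Lemma qmult_assoc (p q r : quat) : qmult p (qmult q r) = qmult (qmult p q) r.
Proof. quat_ring. Qed.
Lemma qmult_one_r (p : quat) : qmult p qone = p.
Proof. quat_ring. Qed.
Lemma qmult_one_l (p : quat) : qmult qone p = p.
Proof. quat_ring. Qed.
Lemma qmult_plus_l (p q r : quat) :
  qmult (plus p q) r = plus (qmult p r) (qmult q r).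
Proof. quat_ring. Qed.
Lemma qmult_plus_r (p q r : quat) :
  qmult p (plus q r) = plus (qmult p q) (qmult p r).
Proof. quat_ring. Qed.

Definition quat_Ring_mixin : Ring.mixin_of quat_AbelianGroup :=
  Ring.Mixin quat_AbelianGroup qmult qone
    qmult_assoc qmult_one_r qmult_one_l qmult_plus_l qmult_plus_r.

Canonical quat_Ring : Ring :=
  Ring.Pack quat (Ring.Class quat _ quat_Ring_mixin) quat.

Definition qreal (x : R) : quat := (x, 0, 0, 0).
Definition qi : quat := (0, 1, 0, 0).
Definition qRe (q : quat) : R := let '(a, b, c, d) := q in a.
Definition qIm (q : quat) : quat := let '(a, b, c, d) := q in (0, b, c, d).
Definition qconj (q : quat) : quat := let '(a, b, c, d) := q in (a, - b, - c, - d).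
Definition qnorm (q : quat) : R :=
  let '(a, b, c, d) := q in sqrt (a ^ 2 + b ^ 2 + c ^ 2 + d ^ 2).

Declare Scope quat_scope.
Delimit Scope quat_scope with quat.
Bind Scope quat_scope with quat.
Notation "0" := (@zero quat_AbelianGroup) : quat_scope.
Notation "1" := (@one quat_Ring) : quat_scope.
Notation "p + q" := (@plus quat_AbelianGroup p q) : quat_scope.
Notation "- p" := (@opp quat_AbelianGroup p) : quat_scope.
Notation "p - q" := (@minus quat_AbelianGroup p q) : quat_scope.
Notation "p * q" := (@mult quat_Ring p q) : quat_scope.
Notation "a *: p" := (@scal R_Ring quat_ModuleSpace a%R p)
  (at level 40, left associativity) : quat_scope.

(* [qinv 0] is [0]. *)
Definition qinv (q : quat) : quat := ((/ (qnorm q) ^ 2)%R *: qconj q)%quat.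

Notation "/ p" := (qinv p) : quat_scope.

Lemma qnorm_norm (q : quat) : qnorm q = norm q.
Proof.
destruct q as [[[a b] c] d].
change (sqrt (a ^ 2 + b ^ 2 + c ^ 2 + d ^ 2) =
  sqrt (sqrt (sqrt (Rabs a ^ 2 + Rabs b ^ 2) ^ 2 + Rabs c ^ 2) ^ 2 + Rabs d ^ 2)).
rewrite <- !Rsqr_pow2, <- !Rsqr_abs.
rewrite (Rsqr_sqrt (Rsqr a + Rsqr b)) by (unfold Rsqr; nra).
rewrite Rsqr_sqrt by (unfold Rsqr; nra).
reflexivity.
Qed.

Lemma qnorm_sqr (a b c d : R) :
  qnorm (a, b, c, d) ^ 2 = a ^ 2 + b ^ 2 + c ^ 2 + d ^ 2.
Proof. unfold qnorm; rewrite pow2_sqrt; nra. Qed.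

Lemma qmult_inv_r (q : quat) : q <> 0%quat -> (q * / q = 1)%quat.
Proof.
destruct q as [[[a b] c] d]; intros Hq; unfold qinv.
rewrite qnorm_sqr.
assert (a ^ 2 + b ^ 2 + c ^ 2 + d ^ 2 <> 0).
{ intros E; apply Hq; apply (quat_eq a b c d 0 0 0 0); nra. }
apply quat_eq; quat_simpl; field; simpl in *; lra.
Qed.

Lemma qmult_inv_l (q : quat) : q <> 0%quat -> (/ q * q = 1)%quat.
Proof.
destruct q as [[[a b] c] d]; intros Hq; unfold qinv.
rewrite qnorm_sqr.
assert (a ^ 2 + b ^ 2 + c ^ 2 + d ^ 2 <> 0).
{ intros E; apply Hq; apply (quat_eq a b c d 0 0 0 0); nra. }
apply quat_eq; quat_simpl; field; simpl in *; lra.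
Qed.

Definition qball (q0 : quat) (r : R) (q : quat) : Prop := qnorm (q - q0)%quat < r.

Definition imag_sphere (I : quat) : Prop := (I * I = - (1))%quat.

(** * Slice regular functions *)

(* Functions on the unit ball are represented by total functions
   [quat -> quat] of which only the values on [qball 0 1] are used; since the
   ball is open, derivatives at its points do not see the values outside. *)

Definition slice_point (I : quat) (x y : R) : quat := (qreal x + y *: I)%quat.

Definition qDerive (g : R -> quat) (t : R) : quat :=
  (Derive (fun s => fst (fst (fst (g s)))) t,
   Derive (fun s => snd (fst (fst (g s)))) t,
   Derive (fun s => snd (fst (g s))) t,
   Derive (fun s => snd (g s)) t).

Definition slice_dx (f : quat -> quat) (I : quat) (x y : R) : quat :=
  qDerive (fun t => f (slice_point I t y)) x.
Definition slice_dy (f : quat -> quat) (I : quat) (x y : R) : quat :=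
  qDerive (fun t => f (slice_point I x t)) y.

Definition slice_regular (f : quat -> quat) : Prop :=
  forall I : quat, imag_sphere I ->
  forall x y : R, qball 0 1 (slice_point I x y) ->
    ex_derive (fun t : R => f (slice_point I t y)) x /\
    ex_derive (fun t : R => f (slice_point I x t)) y /\
    continuous (fun z : R * R => slice_dx f I (fst z) (snd z)) (x, y) /\
    continuous (fun z : R * R => slice_dy f I (fst z) (snd z)) (x, y) /\
    ((1 / 2) *: (slice_dx f I x y + I * slice_dy f I x y) = 0)%quat.

(* An I in the sphere with q = Re q + |Im q| I; the choice of [qi] at real q
   is immaterial, see [slice_derive_correct]. *)
Definition imag_dir (q : quat) : quat :=
  if Req_EM_T (qnorm (qIm q)) 0 then qi else ((/ qnorm (qIm q))%R *: qIm q)%quat.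

Definition slice_derive (f : quat -> quat) (q : quat) : quat :=
  let I := imag_dir q in
  let x := qRe q in
  let y := qnorm (qIm q) in
  ((1 / 2) *: (slice_dx f I x y - I * slice_dy f I x y))%quat.

Lemma imag_sphereP (a b c d : R) :
  imag_sphere (a, b, c, d) <-> a = 0 /\ b ^ 2 + c ^ 2 + d ^ 2 = 1.
Proof.
unfold imag_sphere; split.
- intros E; injection E; unfold opp; simpl; intros E4 E3 E2 E1.
  assert (a = 0); [|subst; nra].
  destruct (Req_dec a 0) as [|Ha]; trivial.
  assert (b = 0) by (apply (Rmult_eq_reg_l a); trivial; lra).
  assert (c = 0) by (apply (Rmult_eq_reg_l a); trivial; lra).
  assert (d = 0) by (apply (Rmult_eq_reg_l a); trivial; lra).
  subst; nra.
- intros [-> E]; apply quat_eq; unfold opp; simpl; lra.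
Qed.

Lemma is_derive_fst {U V : NormedModule R_AbsRing} (g : R -> U * V) t l :
  is_derive g t l -> is_derive (fun s => fst (g s)) t (fst l).
Proof.
intros H.
apply (filterdiff_comp g fst (fun y => scal y l) fst H).
apply filterdiff_linear, is_linear_fst.
Qed.

Lemma is_derive_snd {U V : NormedModule R_AbsRing} (g : R -> U * V) t l :
  is_derive g t l -> is_derive (fun s => snd (g s)) t (snd l).
Proof.
intros H.
apply (filterdiff_comp g snd (fun y => scal y l) snd H).
apply filterdiff_linear, is_linear_snd.
Qed.

Lemma qDerive_correct (g : R -> quat) (t : R) (l : quat) :
  is_derive g t l -> qDerive g t = l.
Proof.
destruct l as [[[a b] c] d]; intros H.
apply quat_eq; apply is_derive_unique.
- exact (is_derive_fst _ _ _ (is_derive_fst _ _ _ (is_derive_fst _ _ _ H))).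
- exact (is_derive_snd _ _ _ (is_derive_fst _ _ _ (is_derive_fst _ _ _ H))).
- exact (is_derive_snd _ _ _ (is_derive_fst _ _ _ H)).
- exact (is_derive_snd _ _ _ H).
Qed.

Lemma qDerive_ext (g h : R -> quat) (t : R) :
  (forall s, g s = h s) -> qDerive g t = qDerive h t.
Proof.
intros E; apply quat_eq; apply Derive_ext; intros s; now rewrite E.
Qed.

Lemma qDerive_comp_opp (g : R -> quat) (t : R) :
  ex_derive g t -> qDerive (fun s => g (- s)) (- t) = opp (qDerive g t).
Proof.
intros [l Hl]; rewrite (qDerive_correct _ _ _ Hl).
apply qDerive_correct.
change (is_derive (fun s : R => g (- s)) (- t) (opp l : quat_NormedModule)).
assert (E : (opp l : quat_NormedModule) = scal (-1) l) by quat_ring; rewrite E.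
apply (is_derive_comp (V := quat_NormedModule) g (fun s : R => - s) (- t) l (-1)).
- now rewrite Ropp_involutive.
- auto_derive; trivial.
Qed.

Local Ltac qr := unfold slice_point, qreal, qi; apply quat_eq; quat_simpl; ring.

Lemma slice_derive_correct (f : quat -> quat) (I : quat) (x y : R) :
  slice_regular f -> imag_sphere I -> qball 0 1 (slice_point I x y) ->
  slice_derive f (slice_point I x y) =
  ((1 / 2) *: (slice_dx f I x y - I * slice_dy f I x y))%quat.
Proof.
intros Hf HI Hq.
assert (Hreal : forall J, imag_sphere J -> qball 0 1 (slice_point J x 0) ->
  ((1 / 2) *: (slice_dx f J x (0%R) - J * slice_dy f J x (0%R)))%quat = slice_dx f J x 0).
{ intros J HJ HqJ; destruct (Hf J HJ x 0 HqJ) as (_ & _ & _ & _ & CR).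
  replace (((1 / 2) *: (slice_dx f J x (0%R) - J * slice_dy f J x (0%R)))%quat)
    with (@minus quat_AbelianGroup (slice_dx f J x 0)
            (((1 / 2) *: (slice_dx f J x (0%R) + J * slice_dy f J x (0%R)))%quat)).
  - rewrite CR; apply (minus_zero_r (G := quat_AbelianGroup)).
  - generalize (slice_dx f J x 0) as u; generalize (J * slice_dy f J x 0)%quat as v.
    clear; intros v u; destruct u as [[[? ?] ?] ?], v as [[[? ?] ?] ?].
    apply quat_eq; quat_simpl; field. }
destruct I as [[[a b] c] d].
destruct (proj1 (imag_sphereP a b c d) HI) as [-> HI1].
set (I := (0, b, c, d) : quat) in *.
assert (Epoint : slice_point I x y = (x, y * b, y * c, y * d)) by qr.
assert (Enorm : qnorm (qIm (slice_point I x y)) = Rabs y).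
{ rewrite Epoint; simpl.
  rewrite <- sqrt_Rsqr_abs; f_equal; unfold Rsqr.
  transitivity (y * y * (b ^ 2 + c ^ 2 + d ^ 2)); [ring | rewrite HI1; ring]. }
assert (Ere : qRe (slice_point I x y) = x) by now rewrite Epoint.
unfold slice_derive; rewrite Ere; unfold imag_dir; rewrite !Enorm.
destruct (Req_EM_T (Rabs y) 0) as [E|E].
- assert (y = 0) by (destruct (Req_dec y 0); trivial; now apply Rabs_no_R0 in E).
  subst y; rewrite Rabs_R0.
  assert (Eq : slice_point qi x 0 = slice_point I x 0) by qr.
  rewrite !Hreal; trivial.
  + unfold slice_dx; apply qDerive_ext; intros s; f_equal; qr.
  + apply imag_sphereP; lra.
  + now rewrite Eq.
- destruct (Rle_dec 0 y) as [Hy|Hy].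
  + rewrite Rabs_pos_eq in * by trivial.
    replace (scal (/ y) (qIm (slice_point I x y))) with I; trivial.
    rewrite Epoint; apply quat_eq; quat_simpl;
      field; trivial.
  + rewrite Rabs_left in * by lra.
    replace (scal (/ - y) (qIm (slice_point I x y))) with (opp I).
    2:{ rewrite Epoint; apply quat_eq; quat_simpl; field; lra. }
    assert (Ex : slice_dx f (opp I) x (- y) = slice_dx f I x y).
    { unfold slice_dx; apply qDerive_ext; intros s; f_equal; qr. }
    assert (Ey : slice_dy f (opp I) x (- y) = opp (slice_dy f I x y)).
    { unfold slice_dy; rewrite <- qDerive_comp_opp.
      - apply qDerive_ext; intros s; f_equal; qr.
      - exact (proj1 (proj2 (Hf I HI x y Hq))). }
    rewrite Ex, Ey; f_equal; f_equal.
    generalize (slice_dy f I x y) as v; clear; intros v.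
    destruct v as [[[? ?] ?] ?]; unfold I; qr.
Qed.

(** * Slice starlike functions *)

Definition class_S (f : quat -> quat) : Prop :=
  slice_regular f /\
  (forall q : quat, qball 0 1 q -> (f q = 0 <-> q = 0)%quat) /\
  slice_derive f 0 = 1%quat.

(* At q = 0 the quotient is read as its limit 1, whose real part is positive,
   so the condition only bears on q <> 0. *)
Definition slice_starlike (f : quat -> quat) : Prop :=
  class_S f /\
  forall q : quat, qball 0 1 q -> q <> 0%quat ->
    0 < qRe (/ f q * q * slice_derive f q)%quat.

Definition ball_image (f : quat -> quat) (w : quat) : Prop :=
  exists q : quat, qball 0 1 q /\ f q = w.

(* Main.v *)
Require Import Defs.
From Stdlib Require Import Reals Lra Psatz Classical.
From Coquelicot Require Import Coquelicot.
Open Scope R_scope.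

(** On a slice C_i write f = F + G j with F, G holomorphic, and F^(z) for the
    conjugate of F(conj z).  Cauchy's formula gives the Poisson formula, hence
    Harnack's inequality and the maximum principle, and an identity theorem on
    the real axis, hence the representation formula of f on a sphere x + yS by
    its values at x + yi and x - yi.

    Growth.  For p = f^{-*} * (q f'), the value p(q) is f(T)^{-1} T f'(T) for some
    point T of the sphere of q, and every point of the sphere is such a T (for q in
    another slice).  So Re p > 0, Harnack's inequality bounds Re p below by
    (1 - |q|) / (1 + |q|), and the same bound holds for Re (f^{-1} q f').
    Integrating along rays, |f(q)| >= |q| / (1 + |q|)^2.

    Covering.  The symmetrization N = F F^ + G G^ satisfies |N| = max |f| min |f|
    on each sphere, so the maximum principle for (F / N, G / N) on the slice where
    |f| is maximal is a minimum principle for |f|.  Applied to f - w' with w'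
    moving from 0 to w in small steps, it shows that each w' is attained, as
    |f - w'| cannot be small inside without vanishing while it stays large near
    the boundary.

    Sharpness.  The Koebe function q (1 - q)^{-2} omits -1/4. *)

(** * Continuity and complex derivatives *)

(** The obstacle is that pointwise products and quotients do not preserve slice regularity, so
    Harnack's inequality cannot be applied directly to Re (f^{-1} q f'). The regular quotient
    repairs this: with p = A + B j on C_i, the component A is holomorphic up to a removable
    singularity at 0, and Re p = Re A. The price is that p sees f at a rotated point T. This is
    harmless: T keeps the modulus of q, on which alone Harnack's bound depends, and the starlike
    class is stable under conjugation of source and target by a common quaternion.

    The starlikeness condition controls growth because |f|^2 Re (f^{-1} q f') is half of r d/dr
    |f|^2 along a ray. The bound (1 - r) / (1 + r) equals r d/dr log (r / (1 + r)^2), and r / (1 +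
    r)^2 tends to 1/4 as r tends to 1: this is the origin of the constant. *)

Lemma continuous_C {U : UniformSpace} (f : U -> C) (x : U) :
  continuous (fun u => fst (f u)) x -> continuous (fun u => snd (f u)) x ->
  continuous f x.
Proof.
intros H1 H2.
apply continuous_ext with (fun u => (fst (f u), snd (f u))).
- intros u; now destruct (f u).
- apply (continuous_comp_2 (fun u => fst (f u)) (fun u => snd (f u))
    (fun a b => (a, b)) x H1 H2).
  apply continuous_ext with (fun z => z); [now intros [a b] | apply continuous_id].
Qed.

Lemma continuous_Re {U : UniformSpace} (f : U -> C) (x : U) :
  continuous f x -> continuous (fun u => fst (f u)) x.
Proof.
intros H; apply (continuous_comp f fst); trivial.
destruct (f x); apply continuous_fst.
Qed.

Lemma continuous_Im {U : UniformSpace} (f : U -> C) (x : U) :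
  continuous f x -> continuous (fun u => snd (f u)) x.
Proof.
intros H; apply (continuous_comp f snd); trivial.
destruct (f x); apply continuous_snd.
Qed.

Lemma continuous_Cplus {U : UniformSpace} (f g : U -> C) (x : U) :
  continuous f x -> continuous g x -> continuous (fun u => (f u + g u)%C) x.
Proof.
intros Hf Hg; apply continuous_C; simpl;
  apply (continuous_plus (V := R_NormedModule));
  auto using continuous_Re, continuous_Im.
Qed.

Lemma continuous_Copp {U : UniformSpace} (f : U -> C) (x : U) :
  continuous f x -> continuous (fun u => (- f u)%C) x.
Proof.
intros Hf; apply continuous_C; simpl;
  apply (continuous_opp (V := R_NormedModule));
  auto using continuous_Re, continuous_Im.
Qed.

Lemma continuous_Cminus {U : UniformSpace} (f g : U -> C) (x : U) :
  continuous f x -> continuous g x -> continuous (fun u => (f u - g u)%C) x.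
Proof.
intros Hf Hg; apply continuous_Cplus; trivial; now apply continuous_Copp.
Qed.

Lemma continuous_Cmult {U : UniformSpace} (f g : U -> C) (x : U) :
  continuous f x -> continuous g x -> continuous (fun u => (f u * g u)%C) x.
Proof.
intros Hf Hg; apply continuous_C; simpl.
- apply (continuous_minus (V := R_NormedModule));
  apply (continuous_mult (K := R_AbsRing)); auto using continuous_Re, continuous_Im.
- apply (continuous_plus (V := R_NormedModule));
  apply (continuous_mult (K := R_AbsRing)); auto using continuous_Re, continuous_Im.
Qed.

Lemma continuous_Cconj {U : UniformSpace} (f : U -> C) (x : U) :
  continuous f x -> continuous (fun u => Cconj (f u)) x.
Proof.
intros Hf; apply continuous_C; simpl;
  [|apply (continuous_opp (V := R_NormedModule))];
  auto using continuous_Re, continuous_Im.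
Qed.

Lemma continuous_RtoC {U : UniformSpace} (f : U -> R) (x : U) :
  continuous f x -> continuous (fun u => RtoC (f u)) x.
Proof.
intros Hf; apply continuous_C; simpl; trivial; apply continuous_const.
Qed.

Lemma continuous_Rinv_fun {U : UniformSpace} (f : U -> R) (x : U) :
  continuous f x -> f x <> 0 -> continuous (fun u => / f u) x.
Proof.
intros Hf H; apply (continuous_comp f Rinv); trivial; now apply continuous_Rinv.
Qed.

Lemma continuous_normsq {U : UniformSpace} (f : U -> C) (x : U) :
  continuous f x -> continuous (fun u => fst (f u) ^ 2 + snd (f u) ^ 2) x.
Proof.
intros Hf.
apply (continuous_ext (fun u => fst (f u) * fst (f u) + snd (f u) * snd (f u))).
{ intros u; change (fst (f u) * fst (f u) + snd (f u) * snd (f u) =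
    fst (f u) ^ 2 + snd (f u) ^ 2); ring. }
apply (continuous_plus (V := R_NormedModule));
apply (continuous_mult (K := R_AbsRing)); auto using continuous_Re, continuous_Im.
Qed.

Lemma Cnormsq_neq (z : C) : z <> 0%C -> fst z ^ 2 + snd z ^ 2 <> 0.
Proof.
destruct z as [a b]; simpl; intros H E; apply H.
assert (a = 0) by nra; assert (b = 0) by nra; now subst.
Qed.

Lemma continuous_Cinv {U : UniformSpace} (f : U -> C) (x : U) :
  continuous f x -> f x <> 0%C -> continuous (fun u => (/ f u)%C) x.
Proof.
intros Hf H; apply Cnormsq_neq in H.
assert (Hn : continuous (fun u => / (fst (f u) ^ 2 + snd (f u) ^ 2)) x).
{ apply (continuous_Rinv_fun (fun u => fst (f u) ^ 2 + snd (f u) ^ 2)); trivial.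
  now apply continuous_normsq. }
apply continuous_C; simpl; unfold Rdiv;
  apply (continuous_mult (K := R_AbsRing)); trivial;
  [|apply (continuous_opp (V := R_NormedModule))];
  auto using continuous_Re, continuous_Im.
Qed.

(** Equalities produced by the topological lemmas live in the carrier of a canonical structure;
    [ring] and [field] need them typed as equalities in [C]. *)
Ltac Ceq :=
  repeat match goal with w : UniformSpace.sort C_UniformSpace |- _ => change C in w end;
  match goal with |- @eq _ ?a ?b => change (@eq C a b) end.
Ltac Req := match goal with |- @eq _ ?a ?b => change (@eq R a b) end.
Ltac Rring := Req; ring.
Ltac Cring := Ceq; ring.
Ltac Cfield := Ceq; field.

(* Carathéodory's form of the complex derivative: products, quotients and
   compositions reduce to continuity. *)
Definition cderiv (f : C -> C) (z l : C) : Prop :=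
  exists phi : C -> C, continuous phi z /\ phi z = l /\
    locally z (fun w => f w = (f z + phi w * (w - z))%C).

Lemma cderiv_continuous f z l : cderiv f z l -> continuous f z.
Proof.
intros (phi & Hc & _ & Hl).
apply (continuous_ext_loc _ (fun w => (f z + phi w * (w - z))%C)).
- revert Hl; apply filter_imp; auto.
- apply continuous_Cplus; [apply continuous_const|].
  apply continuous_Cmult; trivial.
  apply continuous_Cminus; [apply continuous_id | apply continuous_const].
Qed.

Lemma cderiv_const c z : cderiv (fun _ => c) z 0%C.
Proof.
exists (fun _ => 0%C); split; [apply continuous_const | split; trivial].
apply filter_forall; intros w; Cring.
Qed.

Lemma cderiv_id z : cderiv (fun w => w) z 1%C.
Proof.
exists (fun _ => 1%C); split; [apply continuous_const | split; trivial].
apply filter_forall; intros w; Cring.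
Qed.

Lemma cderiv_plus f g z l m :
  cderiv f z l -> cderiv g z m -> cderiv (fun w => f w + g w)%C z (l + m)%C.
Proof.
intros (p & Hp & <- & Hlp) (q & Hq & <- & Hlq).
exists (fun w => p w + q w)%C; split; [|split; trivial].
- now apply continuous_Cplus.
- generalize (filter_and _ _ Hlp Hlq); apply filter_imp.
  intros w [E1 E2]; rewrite E1, E2; Cring.
Qed.

Lemma cderiv_mult f g z l m :
  cderiv f z l -> cderiv g z m ->
  cderiv (fun w => f w * g w)%C z (l * g z + f z * m)%C.
Proof.
intros Hf Hg; pose proof (cderiv_continuous _ _ _ Hg) as Hgc.
destruct Hf as (p & Hp & <- & Hlp), Hg as (q & Hq & <- & Hlq).
exists (fun w => p w * g w + f z * q w)%C; split; [|split; trivial].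
- apply continuous_Cplus; apply continuous_Cmult; trivial; apply continuous_const.
- generalize (filter_and _ _ Hlp Hlq); apply filter_imp.
  intros w [E1 E2]; rewrite E1.
  replace (f z * g z)%C with (f z * (g w - q w * (w - z)))%C
    by (rewrite E2; ring).
  Cring.
Qed.

Lemma cderiv_opp f z l : cderiv f z l -> cderiv (fun w => - f w)%C z (- l)%C.
Proof.
intros (p & Hp & <- & Hlp).
exists (fun w => - p w)%C; split; [now apply continuous_Copp | split; trivial].
revert Hlp; apply filter_imp; intros w ->; Cring.
Qed.


Lemma continuous_neq0 {U : UniformSpace} (f : U -> C) (x : U) :
  continuous f x -> f x <> 0%C -> locally x (fun u => f u <> 0%C).
Proof.
intros Hc Hn; apply Cnormsq_neq in Hn.
generalize (continuous_normsq f x Hc _ (open_neq 0 _ Hn)); unfold filtermap.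
apply filter_imp; intros u Hu E; apply Hu; rewrite E; simpl; ring.
Qed.

Lemma cderiv_inv f z l :
  cderiv f z l -> f z <> 0%C -> cderiv (fun w => / f w)%C z (- l / (f z * f z))%C.
Proof.
intros Hf H0; pose proof (cderiv_continuous _ _ _ Hf) as Hc.
destruct Hf as (p & Hp & <- & Hlp).
exists (fun w => - p w * / (f w * f z))%C; split; [|split; trivial].
- apply continuous_Cmult; [now apply continuous_Copp|].
  apply continuous_Cinv; [|now apply Cmult_neq_0].
  apply continuous_Cmult; trivial; apply continuous_const.
- generalize (filter_and _ _ Hlp (continuous_neq0 _ _ Hc H0)); apply filter_imp.
  intros w [E1 E2].
  replace (- p w * / (f w * f z) * (w - z))%C
    with (- (p w * (w - z)) * / (f w * f z))%C by (field; auto).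
  replace (p w * (w - z))%C with (f w - f z)%C by (rewrite E1 at 1; ring).
  Cfield; auto.
Qed.

Lemma cderiv_ext_loc f g z l :
  locally z (fun w => f w = g w) -> cderiv f z l -> cderiv g z l.
Proof.
intros He (p & Hp & <- & Hlp); exists p; split; [|split]; trivial.
generalize (filter_and _ _ He Hlp); apply filter_imp.
intros w [<- E]; now rewrite <- (locally_singleton _ _ He).
Qed.

(** Neighbourhoods in [C] come from the product structure, hence from boxes. This lemma and its
    converse below allow discs to be used instead. *)
Lemma locally_Cmod (z : C) (P : C -> Prop) (eps : R) :
  0 < eps -> (forall w, Cmod (w - z) < eps -> P w) -> locally z P.
Proof.
intros He HP.
apply filter_imp with (2 := locally_ball_norm (V := C_NormedModule) z (mkposreal eps He)).
intros w Hw; apply HP; exact Hw.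
Qed.

Lemma locally_Cmod_inv (z : C) (P : C -> Prop) :
  locally z P -> exists eps : R, 0 < eps /\ forall w, Cmod (w - z) < eps -> P w.
Proof.
intros H.
destruct (locally_norm_le_locally (V := C_NormedModule) z P H) as [eps Heps].
exists eps; split; [apply cond_pos | exact Heps].
Qed.

Lemma locally_disc (R0 : R) (z : C) : Cmod z < R0 -> locally z (fun w => Cmod w < R0).
Proof.
intros Hz; apply locally_Cmod with (R0 - Cmod z); [lra|].
intros w Hw; replace w with (z + (w - z))%C by ring.
generalize (Cmod_triangle z (w - z)); lra.
Qed.

Lemma is_derive_slope (psi k : R -> R) (t k' : R) :
  continuous psi t -> is_derive k t k' ->
  is_derive (fun s => psi s * (k s - k t)) t (psi t * k').
Proof.
intros Hp Hk.
apply is_derive_Reals in Hk; apply is_derive_Reals.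
intros eps Heps.
pose (M := Rabs (psi t) + 1 + Rabs k').
assert (HM : 0 < M) by (unfold M; generalize (Rabs_pos (psi t)) (Rabs_pos k'); lra).
(* With this [e] the three error terms below add up to at most [e * M], hence to at most half of
   [eps]. *)
set (e := Rmin 1 (eps / (2 * M))).
assert (He : 0 < e).
{ apply Rmin_glb_lt; [lra|]. apply Rdiv_lt_0_compat; lra. }
destruct (Hk e He) as [d1 Hd1].
assert (Hl : locally t (fun s => Rabs (psi s - psi t) < e)).
{ apply (Hp (fun y => Rabs (y - psi t) < e)).
  now exists (mkposreal e He). }
destruct Hl as [d2 Hd2].
assert (Hd : 0 < Rmin d1 d2) by (apply Rmin_glb_lt; apply cond_pos).
exists (mkposreal _ Hd); simpl; intros h Hh0 Hh.
specialize (Hd1 h Hh0 (Rlt_le_trans _ _ _ Hh (Rmin_l _ _))).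
assert (H2 : Rabs (psi (t + h) - psi t) < e).
{ apply Hd2; change (Rabs (t + h - t) < d2).
  replace (t + h - t) with h by ring.
  exact (Rlt_le_trans _ _ _ Hh (Rmin_r _ _)). }
set (q := (k (t + h) - k t) / h) in *.
replace ((psi (t + h) * (k (t + h) - k t) - psi t * (k t - k t)) / h - psi t * k')
  with ((psi (t + h) - psi t) * (q - k') + (psi (t + h) - psi t) * k'
        + psi t * (q - k')) by (unfold q; field; trivial).
assert (e <= 1) by apply Rmin_l.
assert (e * (2 * M) <= eps).
{ apply Rle_trans with (eps / (2 * M) * (2 * M)).
  - apply Rmult_le_compat_r; [lra | apply Rmin_r].
  - right; field; lra. }
eapply Rle_lt_trans; [apply Rabs_triang|].
eapply Rle_lt_trans; [apply Rplus_le_compat_r, Rabs_triang|].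
rewrite !Rabs_mult.
generalize (Rabs_pos (psi t)) (Rabs_pos k') (Rabs_pos (psi (t + h) - psi t))
  (Rabs_pos (q - k')).
set (A := Rabs (psi (t + h) - psi t)) in *; set (B := Rabs (q - k')) in *.
set (P := Rabs (psi t)) in *; set (K := Rabs k') in *; intros.
unfold M in *.
assert (A * B <= e * 1) by (apply Rmult_le_compat; lra).
assert (A * K <= e * K) by (apply Rmult_le_compat_r; lra).
assert (P * B <= P * e) by (apply Rmult_le_compat_l; lra).
nra.
Qed.

Lemma is_derive_continuous (k : R -> R) (t k' : R) : is_derive k t k' -> continuous k t.
Proof. intros H; apply (ex_derive_continuous (V := R_NormedModule)); now exists k'. Qed.

(** Integrals and mean values are taken on real components, so the chain rule along a curve is
    stated for each component. *)
Lemma cderiv_curve (f : C -> C) (g : R -> C) (t : R) (l g' : C) :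
  cderiv f (g t) l ->
  is_derive (fun s => fst (g s)) t (fst g') ->
  is_derive (fun s => snd (g s)) t (snd g') ->
  is_derive (fun s => fst (f (g s))) t (fst (l * g')%C) /\
  is_derive (fun s => snd (f (g s))) t (snd (l * g')%C).
Proof.
intros (p & Hp & <- & Hlp) H1 H2.
assert (Hg : continuous g t).
{ apply continuous_C; [eapply is_derive_continuous, H1 | eapply is_derive_continuous, H2]. }
assert (Hpg : continuous (fun s => p (g s)) t) by now apply continuous_comp.
pose proof (continuous_Re _ _ Hpg) as HpR.
pose proof (continuous_Im _ _ Hpg) as HpI.
specialize (Hg _ Hlp); unfold filtermap in Hg.
split.
- apply (is_derive_ext_loc (fun s => fst (f (g t)) +
    (fst (p (g s)) * (fst (g s) - fst (g t)) - snd (p (g s)) * (snd (g s) - snd (g t))))).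
  + revert Hg; apply filter_imp; intros s ->; simpl; ring.
  + simpl; rewrite <- (Rplus_0_l (_ - _)).
    apply (is_derive_plus (V := R_NormedModule)); [apply (is_derive_const (V := R_NormedModule))|].
    apply (is_derive_minus (V := R_NormedModule));
    apply (is_derive_slope (fun s => _) (fun s => _)); trivial.
- apply (is_derive_ext_loc (fun s => snd (f (g t)) +
    (fst (p (g s)) * (snd (g s) - snd (g t)) + snd (p (g s)) * (fst (g s) - fst (g t))))).
  + revert Hg; apply filter_imp; intros s ->; simpl; ring.
  + simpl; rewrite <- (Rplus_0_l (_ + _)).
    apply (is_derive_plus (V := R_NormedModule)); [apply (is_derive_const (V := R_NormedModule))|].
    apply (is_derive_plus (V := R_NormedModule));
    apply (is_derive_slope (fun s => _) (fun s => _)); trivial.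
Qed.

(** * Cauchy and Poisson formulas *)

Lemma is_derive_RInt_param_continuous (H H' : R -> R -> R) (a b s : R) :
  locally s (fun u => forall t, is_derive (fun v => H v t) u (H' u t)) ->
  (forall t, continuous (fun p : R * R => H' (fst p) (snd p)) (s, t)) ->
  locally s (fun u => forall t, continuous (H u) t) ->
  is_derive (fun u => RInt (H u) a b) s (RInt (H' s) a b).
Proof.
intros H1 H2 H3.
rewrite (RInt_ext (H' s) (fun t => Derive (fun u => H u t) s)).
2:{ intros t _; symmetry; apply is_derive_unique, (locally_singleton _ _ H1). }
apply is_derive_RInt_param.
- revert H1; apply filter_imp; intros u Hu t _; now exists (H' u t).
- intros t _; apply continuity_2d_pt_filterlim; cbv beta.
  replace (Derive (fun z => H z t) s) with (H' s t)
    by (symmetry; apply is_derive_unique, (locally_singleton _ _ H1)).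
  apply filterlim_ext_loc with (2 := H2 t).
  assert (L : locally (s, t) (fun p : R * R =>
    forall t, is_derive (fun v => H v t) (fst p) (H' (fst p) t)))
    by exact (continuous_fst s t _ H1).
  revert L; apply filter_imp; intros p Hp.
  symmetry; apply is_derive_unique, Hp.
- revert H3; apply filter_imp; intros u Hu.
  apply (ex_RInt_continuous (V := R_CompleteNormedModule)); intros; apply Hu.
Qed.

(** The measure dt is dz / (i z) on a circle about 0, which accounts for the factor [circ r t] in
    the Cauchy kernels below. It is not normalised: the constant 1 has integral 2 PI. *)
Definition CI (g : R -> C) : C :=
  (RInt (fun t => fst (g t)) 0 (2 * PI), RInt (fun t => snd (g t)) 0 (2 * PI)).

Lemma ex_RInt_all_continuous (g : R -> R) a b :
  (forall t, continuous g t) -> ex_RInt g a b.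
Proof. intros H; apply (ex_RInt_continuous (V := R_CompleteNormedModule)); auto. Qed.

Lemma CI_ext (g h : R -> C) : (forall t, g t = h t) -> CI g = CI h.
Proof. intros H; unfold CI; f_equal; apply RInt_ext; intros t _; now rewrite H. Qed.

Lemma CI_plus (g h : R -> C) :
  (forall t, continuous g t) -> (forall t, continuous h t) ->
  CI (fun t => g t + h t)%C = (CI g + CI h)%C.
Proof.
intros Hg Hh; unfold CI, Cplus; simpl; f_equal;
  apply (RInt_plus (V := R_CompleteNormedModule)); apply ex_RInt_all_continuous;
  auto using continuous_Re, continuous_Im.
Qed.

Lemma RInt_lin (f g : R -> R) (a b x y : R) :
  (forall t, continuous f t) -> (forall t, continuous g t) ->
  RInt (fun t => a * f t + b * g t) x y = a * RInt f x y + b * RInt g x y.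
Proof.
intros Hf Hg; apply is_RInt_unique.
apply (is_RInt_plus (V := R_NormedModule) (fun t => a * f t) (fun t => b * g t));
apply (is_RInt_scal (V := R_NormedModule)),
  (RInt_correct (V := R_CompleteNormedModule)), ex_RInt_all_continuous; trivial.
Qed.

Lemma CI_scal (c : C) (g : R -> C) :
  (forall t, continuous g t) -> CI (fun t => c * g t)%C = (c * CI g)%C.
Proof.
intros Hg.
assert (H1 : forall t, continuous (fun t => fst (g t)) t) by (intros; now apply continuous_Re).
assert (H2 : forall t, continuous (fun t => snd (g t)) t) by (intros; now apply continuous_Im).
unfold CI, Cmult; simpl; f_equal.
- rewrite (RInt_ext _ (fun t => fst c * fst (g t) + (- snd c) * snd (g t))).
  + rewrite RInt_lin by trivial; Rring.
  + intros t _; simpl; Rring.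
- now rewrite RInt_lin.
Qed.

(** The two components are bounded separately, which costs a factor 2 over the sharp constant. Only
    local boundedness of Cauchy integrals is drawn from this. *)
Lemma CI_bound (g : R -> C) (M : R) :
  (forall t, continuous g t) -> (forall t, 0 <= t <= 2 * PI -> Cmod (g t) <= M) ->
  Cmod (CI g) <= 4 * PI * M.
Proof.
intros Hc HM.
assert (B : forall h : R -> R, (forall t, continuous h t) -> (forall t, 0 <= t <= 2 * PI -> Rabs (h t) <= M) ->
  Rabs (RInt h 0 (2 * PI)) <= 2 * PI * M).
{ intros h Hh Hb; generalize PI_RGT_0; intros.
  replace (2 * PI * M) with ((2 * PI - 0) * M) by ring.
  apply abs_RInt_le_const; [lra | now apply ex_RInt_all_continuous | auto]. }
unfold CI.
eapply Rle_trans; [apply Cmod_2Rmax|]; simpl.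
apply Rle_trans with (2 * (2 * PI * M)); [|right; ring].
apply Rmult_le_compat.
- apply sqrt_pos.
- eapply Rle_trans; [apply Rabs_pos | apply Rmax_l].
- generalize (sqrt_sqrt 2) (sqrt_pos 2); intros E; specialize (E ltac:(lra)); nra.
- apply Rmax_lub; apply B; intros t; try intros Ht.
  + apply continuous_Re; trivial.
  + eapply Rle_trans; [apply re_le_Cmod | now apply HM].
  + apply continuous_Im; trivial.
  + eapply Rle_trans; [|now apply HM].
    eapply Rle_trans; [apply Rmax_r | apply Rmax_Cmod].
Qed.

Definition circ (r t : R) : C := (r * cos t, r * sin t).

Lemma Cmod_circ r t : 0 <= r -> Cmod (circ r t) = r.
Proof.
intros Hr; transitivity (sqrt (r * r)); [|now apply sqrt_square].
unfold circ, Cmod; simpl; f_equal.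
generalize (sin2_cos2 t); unfold Rsqr; intros E.
transitivity (r * r * (sin t * sin t + cos t * cos t)); [ring | rewrite E; ring].
Qed.

Lemma is_derive_circ_Re r t : is_derive (fun u => fst (circ r u)) t (fst (Ci * circ r t)%C).
Proof. unfold circ, Ci; simpl; auto_derive; trivial; ring. Qed.
Lemma is_derive_circ_Im r t : is_derive (fun u => snd (circ r u)) t (snd (Ci * circ r t)%C).
Proof. unfold circ, Ci; simpl; auto_derive; trivial; ring. Qed.

Lemma continuous_circ r t : continuous (circ r) t.
Proof.
apply continuous_C; eapply is_derive_continuous;
  [apply is_derive_circ_Re | apply is_derive_circ_Im].
Qed.

Lemma circ_2PI r : circ r (2 * PI) = circ r 0.
Proof. unfold circ; now rewrite cos_2PI, sin_2PI, cos_0, sin_0. Qed.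

Lemma CI_derive (f : R -> C) (g : R -> C) :
  (forall t, is_derive (fun u => fst (f u)) t (fst (g t))) ->
  (forall t, is_derive (fun u => snd (f u)) t (snd (g t))) ->
  (forall t, continuous g t) -> f (2 * PI) = f 0 -> CI g = 0%C.
Proof.
intros H1 H2 Hc E; unfold CI.
rewrite (is_RInt_unique _ _ _ _ (is_RInt_derive (V := R_CompleteNormedModule) (fun u => fst (f u)) (fun t => fst (g t)) 0 (2 * PI)
  (fun t _ => H1 t) (fun t _ => continuous_Re _ _ (Hc t)))).
rewrite (is_RInt_unique _ _ _ _ (is_RInt_derive (V := R_CompleteNormedModule) (fun u => snd (f u)) (fun t => snd (g t)) 0 (2 * PI)
  (fun t _ => H2 t) (fun t _ => continuous_Im _ _ (Hc t)))).
rewrite E; unfold minus, plus, opp; simpl.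
now rewrite !Rplus_opp_r.
Qed.

(** Continuity of the derivative is built in, so that Cauchy's formula follows by differentiating
    under the integral sign; slice regularity supplies it. *)
Definition hol (R0 : R) (f f' : C -> C) : Prop :=
  forall z, Cmod z < R0 -> cderiv f z (f' z) /\ continuous f' z.

Definition Hol (R0 : R) (f : C -> C) : Prop := exists f', hol R0 f f'.

Lemma Hol_continuous R0 f z : Hol R0 f -> Cmod z < R0 -> continuous f z.
Proof. intros [f' H] Hz; eapply cderiv_continuous, H, Hz. Qed.

Lemma hol_plus R0 f f' g g' : hol R0 f f' -> hol R0 g g' ->
  hol R0 (fun z => f z + g z)%C (fun z => f' z + g' z)%C.
Proof.
intros Hf Hg z Hz; destruct (Hf z Hz), (Hg z Hz); split.
- now apply cderiv_plus.
- now apply continuous_Cplus.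
Qed.

Lemma hol_mult R0 f f' g g' : hol R0 f f' -> hol R0 g g' ->
  hol R0 (fun z => f z * g z)%C (fun z => f' z * g z + f z * g' z)%C.
Proof.
intros Hf Hg z Hz; destruct (Hf z Hz) as [Hf1 ?], (Hg z Hz) as [Hg1 ?]; split.
- now apply cderiv_mult.
- apply cderiv_continuous in Hf1, Hg1.
  apply continuous_Cplus; now apply continuous_Cmult.
Qed.

Lemma hol_opp R0 f f' : hol R0 f f' -> hol R0 (fun z => - f z)%C (fun z => - f' z)%C.
Proof.
intros Hf z Hz; destruct (Hf z Hz); split.
- now apply cderiv_opp.
- now apply continuous_Copp.
Qed.

Lemma Hol_const R0 c : Hol R0 (fun _ => c).
Proof. exists (fun _ => 0%C); intros z _; split; [apply cderiv_const | apply continuous_const]. Qed.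

Lemma hol_id R0 : hol R0 (fun z => z) (fun _ => 1%C).
Proof. intros z _; split; [apply cderiv_id | apply continuous_const]. Qed.

Lemma Hol_id R0 : Hol R0 (fun z => z).
Proof. eexists; apply hol_id. Qed.

Lemma Hol_plus R0 f g : Hol R0 f -> Hol R0 g -> Hol R0 (fun z => f z + g z)%C.
Proof. intros [f' Hf] [g' Hg]; eexists; eapply hol_plus; eassumption. Qed.

Lemma Hol_mult R0 f g : Hol R0 f -> Hol R0 g -> Hol R0 (fun z => f z * g z)%C.
Proof. intros [f' Hf] [g' Hg]; eexists; eapply hol_mult; eassumption. Qed.

Lemma Hol_opp R0 f : Hol R0 f -> Hol R0 (fun z => - f z)%C.
Proof. intros [f' Hf]; eexists; eapply hol_opp; eassumption. Qed.

Lemma Hol_minus R0 f g : Hol R0 f -> Hol R0 g -> Hol R0 (fun z => f z - g z)%C.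
Proof. intros Hf Hg; apply Hol_plus; trivial; now apply Hol_opp. Qed.

Lemma Hol_inv R0 f : Hol R0 f -> (forall z, Cmod z < R0 -> f z <> 0%C) -> Hol R0 (fun z => / f z)%C.
Proof.
intros [f' Hf] H0; exists (fun z => - f' z / (f z * f z))%C; intros z Hz.
destruct (Hf z Hz) as [Hf1 ?]; split.
- apply cderiv_inv; auto.
- apply cderiv_continuous in Hf1.
  apply continuous_Cmult; [now apply continuous_Copp|].
  apply continuous_Cinv; [now apply continuous_Cmult | apply Cmult_neq_0; auto].
Qed.

Lemma Hol_div R0 f g : Hol R0 f -> Hol R0 g -> (forall z, Cmod z < R0 -> g z <> 0%C) ->
  Hol R0 (fun z => f z / g z)%C.
Proof. intros; apply Hol_mult; trivial; now apply Hol_inv. Qed.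

Lemma circ_sub_neq0 r z t : Cmod z < r -> (circ r t - z)%C <> 0%C.
Proof.
intros Hz E.
assert (Hr : 0 <= r) by (generalize (Cmod_ge_0 z); lra).
assert (circ r t = z) by (replace (circ r t) with (circ r t - z + z)%C by ring; rewrite E; ring).
generalize (Cmod_circ r t Hr); rewrite H; lra.
Qed.

Lemma continuous_hol_circ R0 f r t : 0 < r < R0 -> Hol R0 f -> continuous (fun u => f (circ r u)) t.
Proof.
intros Hr Hf; apply continuous_comp; [apply continuous_circ|].
apply Hol_continuous with R0; trivial; rewrite Cmod_circ; lra.
Qed.

(* Both sides are the values at [s = 1] and [s = 0] of
   [CI (fun t => f (z + s (circ r t - z)) * (circ r t / (circ r t - z)))],
   whose derivative in [s] integrates an exact differential in [t]. *)
Lemma Cauchy_weighted (R0 : R) (f : C -> C) (r : R) (z : C) :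
  Hol R0 f -> 0 < r < R0 -> Cmod z < r ->
  CI (fun t => f (circ r t) * (circ r t / (circ r t - z)))%C =
  (f z * CI (fun t => circ r t / (circ r t - z)))%C.
Proof.
intros Hf Hr Hz; pose proof Hf as [f' Hf'].
set (k := fun t => (circ r t / (circ r t - z))%C).
assert (Hk : forall t, continuous k t).
{ intros t; apply continuous_Cmult; [apply continuous_circ|].
  apply continuous_Cinv; [|now apply circ_sub_neq0].
  apply continuous_Cminus; [apply continuous_circ | apply continuous_const]. }
(* The parameter [s] needs an open interval around [0, 1]. With this [eta], [r * (1 + 2 * eta)] is
   the midpoint of [r] and [R0], so the deformed circles stay in the disc. *)
set (eta := (R0 - r) / (4 * r)).
assert (Heta : 0 < eta) by (apply Rdiv_lt_0_compat; lra).
assert (Hr2 : r * (1 + 2 * eta) < R0).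
{ replace (r * (1 + 2 * eta)) with ((R0 + r) / 2) by (unfold eta; field; lra); lra. }
set (g := fun s t => (z + RtoC s * (circ r t - z))%C).
assert (Hgd : forall s t, - eta < s < 1 + eta -> Cmod (g s t) < R0).
{ intros s t Hs.
  replace (g s t) with (RtoC (1 - s) * z + RtoC s * circ r t)%C
    by (unfold g; rewrite RtoC_minus; ring).
  eapply Rle_lt_trans; [apply Cmod_triangle|].
  rewrite !Cmod_mult, !Cmod_R, Cmod_circ by lra.
  generalize (Cmod_ge_0 z); intros Hz0.
  assert (Rabs (1 - s) + Rabs s <= 1 + 2 * eta).
  { unfold Rabs; destruct (Rcase_abs (1 - s)), (Rcase_abs s); lra. }
  generalize (Rabs_pos (1 - s)) (Rabs_pos s); intros; nra. }
assert (Hgc : forall s t, continuous (fun p : R * R => g (fst p) (snd p)) (s, t)).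
{ intros s t; unfold g; apply continuous_Cplus; [apply continuous_const|].
  apply continuous_Cmult.
  - apply continuous_RtoC, continuous_fst.
  - apply continuous_Cminus; [|apply continuous_const].
    apply (continuous_comp snd (circ r)); [apply continuous_snd | apply continuous_circ]. }
set (H := fun s t => (f (g s t) * k t)%C).
set (H' := fun s t => (f' (g s t) * circ r t)%C).
assert (HD : forall s t, - eta < s < 1 + eta ->
  is_derive (fun u => fst (H u t)) s (fst (H' s t)) /\
  is_derive (fun u => snd (H u t)) s (snd (H' s t))).
{ intros s t Hs.
  replace (H' s t) with ((f' (g s t) * k t + f (g s t) * 0) * (circ r t - z))%C.
  2:{ unfold H', k; field; now apply circ_sub_neq0. }
  apply (cderiv_curve (fun w => f w * k t)%C (fun u => g u t)).
  - apply cderiv_mult; [apply Hf', Hgd, Hs | apply cderiv_const].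
  - unfold g; simpl; auto_derive; trivial; ring.
  - unfold g; simpl; auto_derive; trivial; ring. }
assert (HHc : forall s t, - eta < s < 1 + eta ->
  continuous (fun p : R * R => H' (fst p) (snd p)) (s, t)).
{ intros s t Hs; unfold H'; apply continuous_Cmult.
  - apply (continuous_comp (fun p => g (fst p) (snd p)) f'); [apply Hgc|].
    apply Hf', Hgd, Hs.
  - apply (continuous_comp snd (circ r)); [apply continuous_snd | apply continuous_circ]. }
assert (Hgt : forall s t, continuous (g s) t).
{ intros s t; unfold g; apply continuous_Cplus; [apply continuous_const|].
  apply continuous_Cmult; [apply continuous_const|].
  apply continuous_Cminus; [apply continuous_circ | apply continuous_const]. }
assert (Hc1 : forall s t, - eta < s < 1 + eta -> continuous (H s) t).
{ intros s t Hs; apply continuous_Cmult; trivial.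
  apply (continuous_comp (g s) f); trivial.
  apply Hol_continuous with R0; trivial; now apply Hgd. }
assert (Hc2 : forall s t, - eta < s < 1 + eta -> continuous (H' s) t).
{ intros s t Hs; apply continuous_Cmult; [|apply continuous_circ].
  apply (continuous_comp (g s) f'); trivial; apply Hf', Hgd, Hs. }
assert (Hloc : forall s, - eta < s < 1 + eta ->
  locally s (fun u => - eta < u < 1 + eta)).
{ intros s Hs; apply filter_and; [apply (open_gt _ s) | apply (open_lt _ s)]; apply Hs. }
assert (HI1 : forall s, - eta < s < 1 + eta ->
  is_derive (fun u => fst (CI (H u))) s (fst (CI (H' s)))).
{ intros s Hs; unfold CI; simpl.
  apply (is_derive_RInt_param_continuous (fun u t => fst (H u t)) (fun u t => fst (H' u t))).
  - generalize (Hloc s Hs); apply filter_imp; intros; now apply HD.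
  - intros t; apply continuous_Re with (f := fun p => H' (fst p) (snd p)); auto.
  - generalize (Hloc s Hs); apply filter_imp; intros; now apply continuous_Re, Hc1. }
assert (HI2 : forall s, - eta < s < 1 + eta ->
  is_derive (fun u => snd (CI (H u))) s (snd (CI (H' s)))).
{ intros s Hs; unfold CI; simpl.
  apply (is_derive_RInt_param_continuous (fun u t => snd (H u t)) (fun u t => snd (H' u t))).
  - generalize (Hloc s Hs); apply filter_imp; intros; now apply HD.
  - intros t; apply continuous_Im with (f := fun p => H' (fst p) (snd p)); auto.
  - generalize (Hloc s Hs); apply filter_imp; intros; now apply continuous_Im, Hc1. }
(* Up to the factor [s i], the integrand is the t-derivative of the closed curve [f (g s t)]. The
   factor vanishes at s = 0, but the mean value theorem only looks at interior points. *)
assert (HZ : forall s, 0 < s <= 1 -> CI (H' s) = 0%C).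
{ intros s Hs.
  assert (Hsb : - eta < s < 1 + eta) by lra.
  assert (HE : forall t, (RtoC s * Ci * H' s t)%C = (f' (g s t) * (RtoC s * (Ci * circ r t)))%C)
    by (intros t; unfold H'; ring).
  assert (Hz1 : CI (fun t => RtoC s * Ci * H' s t)%C = 0%C).
  { assert (HDt : forall t, is_derive (fun u => fst (f (g s u))) t (fst (RtoC s * Ci * H' s t)%C) /\
      is_derive (fun u => snd (f (g s u))) t (snd (RtoC s * Ci * H' s t)%C)).
    { intros t; rewrite HE; apply (cderiv_curve f (g s)).
      - apply Hf', Hgd, Hsb.
      - unfold g, circ; simpl; auto_derive; trivial; ring.
      - unfold g, circ; simpl; auto_derive; trivial; ring. }
    apply CI_derive with (f := fun t => f (g s t)); try apply HDt.
    - intros t; apply continuous_Cmult; [apply continuous_const | now apply Hc2].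
    - unfold g; now rewrite circ_2PI. }
  rewrite CI_scal in Hz1 by (intros; now apply Hc2).
  assert (Hn : (RtoC s * Ci)%C <> 0%C).
  { apply Cmult_neq_0; intros E; apply (f_equal Cmod) in E;
    rewrite Cmod_0, ?Cmod_R, ?Cmod_Ci in E; [|lra].
    rewrite Rabs_pos_eq in E; lra. }
  replace (CI (H' s)) with (/ (RtoC s * Ci) * (RtoC s * Ci * CI (H' s)))%C
    by (field; split; intros E; apply Hn; rewrite E; ring).
  rewrite Hz1; ring. }
assert (Hconst : CI (H 1) = CI (H 0)).
{ assert (K : forall (u u' : R -> R),
    (forall s, - eta < s < 1 + eta -> is_derive u s (u' s)) ->
    (forall s, 0 < s <= 1 -> u' s = 0) -> u 1 = u 0).
  { intros u u' Hu Hu'.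
    destruct (MVT_gen u 0 1 (fun _ => 0)) as [c [_ Hc]].
    - rewrite Rmin_left, Rmax_right by lra; intros s Hs.
      rewrite <- (Hu' s) by lra; apply Hu; lra.
    - rewrite Rmin_left, Rmax_right by lra; intros s Hs.
      apply continuity_pt_filterlim; eapply is_derive_continuous, Hu; lra.
    - lra. }
  apply injective_projections.
  - apply (K (fun u => fst (CI (H u))) (fun u => fst (CI (H' u))) HI1).
    intros s Hs; now rewrite HZ.
  - apply (K (fun u => snd (CI (H u))) (fun u => snd (CI (H' u))) HI2).
    intros s Hs; now rewrite HZ. }
transitivity (CI (H 1)).
{ apply CI_ext; intros t; unfold H, g, k; do 2 f_equal; ring. }
rewrite Hconst, <- CI_scal by apply Hk.
apply CI_ext; intros t; unfold H, g; do 2 f_equal; ring.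
Qed.

(** * Poisson kernel, maximum principle and Harnack's inequality *)

Lemma Cmod_sqr (z : C) : Cmod z ^ 2 = fst z ^ 2 + snd z ^ 2.
Proof. exact (Cmod2_alt z). Qed.

Lemma sqr_le_inv (a b : R) : 0 <= b -> a ^ 2 <= b ^ 2 -> a <= b.
Proof. intros; nra. Qed.

Definition poisson (r : R) (z : C) (t : R) : R :=
  (r ^ 2 - Cmod z ^ 2) / Cmod (circ r t - z) ^ 2.

Lemma Cmod_circ_sub_pos r z t : Cmod z < r -> 0 < Cmod (circ r t - z).
Proof. intros Hz; apply Cmod_gt_0; now apply circ_sub_neq0. Qed.

Lemma poisson_pos r z t : Cmod z < r -> 0 < poisson r z t.
Proof.
intros Hz; generalize (Cmod_ge_0 z); intros.
apply Rdiv_lt_0_compat; [nra|].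
apply pow_lt; now apply Cmod_circ_sub_pos.
Qed.

Lemma circ_sqr r t : fst (circ r t) ^ 2 + snd (circ r t) ^ 2 = r ^ 2.
Proof.
unfold circ; simpl; generalize (sin2_cos2 t); unfold Rsqr; intros E.
transitivity (r ^ 2 * (sin t * sin t + cos t * cos t)); [ring | rewrite E; ring].
Qed.

Lemma continuous_poisson r z t : Cmod z < r -> continuous (poisson r z) t.
Proof.
intros Hz; unfold poisson, Rdiv.
apply (continuous_mult (K := R_AbsRing)); [apply continuous_const|].
apply (continuous_Rinv_fun (fun u => Cmod (circ r u - z) ^ 2)).
- apply (continuous_ext (fun u => fst (circ r u - z)%C ^ 2 + snd (circ r u - z)%C ^ 2)).
  + intros u; symmetry; apply Cmod_sqr.
  + apply continuous_normsq.
    apply continuous_Cminus; [apply continuous_circ | apply continuous_const].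
- generalize (Cmod_circ_sub_pos r z t Hz); intros.
  apply Rgt_not_eq, pow_lt; trivial.
Qed.

(* Cauchy's formula for [f w (r^2 - |z|^2) / (r^2 - conj z w)]. *)
Lemma Poisson_weighted R0 f r z : Hol R0 f -> 0 < r < R0 -> Cmod z < r ->
  CI (fun t => RtoC (poisson r z t) * f (circ r t))%C =
  (f z * CI (fun t => circ r t / (circ r t - z)))%C.
Proof.
intros Hf Hr Hz; generalize (Cmod_ge_0 z); intros Hz0.
(* The auxiliary function has its pole at modulus r^2 / |z|. The radius 2 r^2 / (r + |z|) lies
   between [r] and that modulus, and still makes sense at z = 0. *)
set (R1 := Rmin R0 (2 * r ^ 2 / (r + Cmod z))).
assert (HR1 : r < R1).
{ apply Rmin_glb_lt; [lra|].
  apply Rmult_lt_reg_r with (r + Cmod z); [lra|].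
  replace (2 * r ^ 2 / (r + Cmod z) * (r + Cmod z)) with (2 * r ^ 2) by (field; lra).
  nra. }
assert (HR2 : R1 * (r + Cmod z) <= 2 * r ^ 2).
{ apply Rle_trans with (2 * r ^ 2 / (r + Cmod z) * (r + Cmod z)).
  - apply Rmult_le_compat_r; [lra | apply Rmin_r].
  - right; field; lra. }
assert (Hn : forall w, Cmod w < R1 -> (RtoC (r ^ 2) - Cconj z * w)%C <> 0%C).
{ intros w Hw E.
  assert (E' : (Cconj z * w)%C = RtoC (r ^ 2)).
  { replace (Cconj z * w)%C with (RtoC (r ^ 2) - (RtoC (r ^ 2) - Cconj z * w))%C by ring.
    rewrite E; ring. }
  apply (f_equal Cmod) in E'; rewrite Cmod_mult, Cmod_conj, Cmod_R, Rabs_pos_eq in E' by nra.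
  generalize (Cmod_ge_0 w); nra. }
assert (Hf1 : Hol R1 f).
{ destruct Hf as [f' Hf]; exists f'; intros w Hw; apply Hf.
  eapply Rlt_le_trans; [exact Hw | apply Rmin_l]. }
set (c := RtoC (r ^ 2 - Cmod z ^ 2)).
assert (HF : Hol R1 (fun w => f w * (c / (RtoC (r ^ 2) - Cconj z * w)))%C).
{ apply Hol_mult; trivial; apply Hol_div; trivial; [apply Hol_const|].
  apply Hol_minus; [apply Hol_const|]; apply Hol_mult; [apply Hol_const | apply Hol_id]. }
generalize (Cauchy_weighted R1 _ r z HF (conj (proj1 Hr) HR1) Hz); intros E.
replace (f z) with (f z * (c / (RtoC (r ^ 2) - Cconj z * z)))%C.
2:{ replace c with (RtoC (r ^ 2) - Cconj z * z)%C.
    - field; apply Hn; lra.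
    - unfold c; rewrite RtoC_minus, (RtoC_pow (Cmod z)).
      replace (RtoC (Cmod z) ^ 2)%C with (z * Cconj z)%C; [ring|].
      rewrite <- Cmod2_conj, RtoC_pow; trivial. }
rewrite <- E; apply CI_ext; intros t.
assert (Hp : RtoC (r ^ 2) = (circ r t * Cconj (circ r t))%C).
{ rewrite <- (Cmod2_conj (circ r t)), Cmod_circ, RtoC_pow by lra; trivial. }
assert (Hd := circ_sub_neq0 r z t Hz).
assert (Hd' : Cconj (circ r t - z)%C <> 0%C).
{ intros Ez; apply Hd, Cmod_eq_0; rewrite <- Cmod_conj, Ez; apply Cmod_0. }
assert (Hc0 : circ r t <> 0%C).
{ intros Ez; generalize (Cmod_circ r t); rewrite Ez, Cmod_0; lra. }
unfold poisson, Rdiv; rewrite RtoC_mult; fold c.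
rewrite RtoC_inv, RtoC_pow.
replace (RtoC (Cmod (circ r t - z)) ^ 2)%C with ((circ r t - z) * Cconj (circ r t - z))%C
  by (rewrite <- Cmod2_conj, RtoC_pow; trivial).
rewrite Hp.
rewrite Cminus_conj in Hd' |- *.
field; repeat split; trivial.
{ intros Ez; apply (Cmult_neq_0 _ _ Hc0 Hd'); rewrite <- Ez; ring. }
apply Rgt_not_eq, pow_lt; now apply Cmod_circ_sub_pos.
Qed.


(** No integral is computed. [Poisson_weighted] for the constant 1 equates the mass m of the Poisson
    kernel with the integral of the Cauchy kernel, while pointwise the Poisson kernel is twice the
    real part of the Cauchy kernel minus 1. Hence m = 2 m - 2 PI. *)
Lemma RInt_poisson_circ r z : Cmod z < r ->
  CI (fun t => circ r t / (circ r t - z))%C = RtoC (2 * PI) /\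
  RInt (poisson r z) 0 (2 * PI) = 2 * PI.
Proof.
intros Hz; generalize (Cmod_ge_0 z); intros Hz0.
assert (Hr : 0 < r) by lra.
assert (Hc : forall t, continuous (fun t => circ r t / (circ r t - z))%C t).
{ intros t; apply continuous_Cmult; [apply continuous_circ|].
  apply continuous_Cinv; [|now apply circ_sub_neq0].
  apply continuous_Cminus; [apply continuous_circ | apply continuous_const]. }
generalize (Poisson_weighted (r + 1) (fun _ => 1%C) r z (Hol_const _ _)
  (conj Hr (Rlt_plus_1 r)) Hz); rewrite Cmult_1_l; intros E.
assert (E1 : CI (fun t => RtoC (poisson r z t) * 1)%C =
  RtoC (RInt (poisson r z) 0 (2 * PI))).
{ unfold CI; apply injective_projections; simpl.
  - apply RInt_ext; intros t _; simpl; Rring.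
  - rewrite (RInt_ext _ (fun _ => 0)) by (intros t _; simpl; Rring).
    rewrite RInt_const; unfold scal; simpl; unfold mult; simpl; ring. }
rewrite E1 in E; rewrite <- E.
assert (E2 : RInt (poisson r z) 0 (2 * PI) =
  2 * RInt (fun t => fst (circ r t / (circ r t - z))%C) 0 (2 * PI) +
  (-1) * RInt (fun _ => 1) 0 (2 * PI)).
{ rewrite <- RInt_lin.
  - apply RInt_ext; intros t _.
    generalize (circ_sub_neq0 r z t Hz) (circ_sqr r t); intros Hn Hq.
    apply Cnormsq_neq in Hn.
    unfold poisson; rewrite !Cmod_sqr, <- Hq; revert Hn; simpl; intros Hn.
    Req; field; revert Hn; intros Hn Hf; apply Hn; rewrite <- Hf; ring.
  - intros t; now apply continuous_Re.
  - intros t; apply continuous_const. }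
assert (E3 : RInt (fun t => fst (circ r t / (circ r t - z))%C) 0 (2 * PI) =
  RInt (poisson r z) 0 (2 * PI)).
{ change (fst (CI (fun t => circ r t / (circ r t - z))%C) = RInt (poisson r z) 0 (2 * PI)).
  now rewrite <- E. }
rewrite E3, RInt_const in E2; unfold scal in E2; simpl in E2; unfold mult in E2; simpl in E2.
assert (E4 : RInt (poisson r z) 0 (2 * PI) = 2 * PI) by lra.
now rewrite E4.
Qed.

Lemma Poisson_formula R0 f r z : Hol R0 f -> 0 < r < R0 -> Cmod z < r ->
  RInt (fun t => poisson r z t * fst (f (circ r t))) 0 (2 * PI) = 2 * PI * fst (f z).
Proof.
intros Hf Hr Hz.
generalize (Poisson_weighted R0 f r z Hf Hr Hz).
rewrite (proj1 (RInt_poisson_circ r z Hz)); intros E.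
apply (f_equal fst) in E; unfold CI in E; simpl in E.
transitivity (fst (f z) * (2 * PI) - snd (f z) * 0); [|Rring].
rewrite <- E; apply RInt_ext; intros t _; simpl; Rring.
Qed.

Lemma continuous_Re_circ R0 f r t : Hol R0 f -> 0 < r < R0 ->
  continuous (fun u => fst (f (circ r u))) t.
Proof. intros; apply continuous_Re; now apply continuous_hol_circ with R0. Qed.

Lemma max_principle_Re R0 f r z M : Hol R0 f -> 0 < r < R0 -> Cmod z < r ->
  (forall t, 0 <= t <= 2 * PI -> fst (f (circ r t)) <= M) -> fst (f z) <= M.
Proof.
intros Hf Hr Hz HM; generalize PI_RGT_0; intros Hpi.
apply Rmult_le_reg_l with (2 * PI); [lra|].
rewrite <- (Poisson_formula R0 f r z Hf Hr Hz).
apply Rle_trans with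
  (M * RInt (poisson r z) 0 (2 * PI) + 0 * RInt (poisson r z) 0 (2 * PI)).
2: right; rewrite (proj2 (RInt_poisson_circ r z Hz)); ring.
rewrite <- RInt_lin by (intros; now apply continuous_poisson).
apply RInt_le; [lra| | |].
- apply ex_RInt_all_continuous; intros t; apply (continuous_mult (K := R_AbsRing)).
  + now apply continuous_poisson.
  + now apply continuous_Re_circ with R0.
- apply ex_RInt_all_continuous; intros t.
  apply (continuous_plus (V := R_NormedModule));
  apply (continuous_mult (K := R_AbsRing)); try apply continuous_const;
  now apply continuous_poisson.
- intros t Ht; generalize (poisson_pos r z t Hz); assert (fst (f (circ r t)) <= M) by (apply HM; lra); intros; nra.
Qed.

(** Since |c - z| <= r + |z| on the circle, the Poisson kernel at [z] is at least (r - |z|) / (r +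
    |z|), while at the centre it is 1. *)
Lemma Harnack_circle R0 f r z : Hol R0 f -> 0 < r < R0 -> Cmod z < r ->
  (forall t, 0 <= fst (f (circ r t))) ->
  (r - Cmod z) * fst (f 0%C) <= (r + Cmod z) * fst (f z).
Proof.
intros Hf Hr Hz H0; generalize PI_RGT_0 (Cmod_ge_0 z); intros Hpi Hz0.
apply Rmult_le_reg_l with (2 * PI); [lra|].
replace (2 * PI * ((r - Cmod z) * fst (f 0%C)))
  with ((r - Cmod z) * (2 * PI * fst (f 0%C))) by ring.
(* The zero summands here and below bring both sides into the two-term shape of [RInt_lin]. *)
replace (2 * PI * ((r + Cmod z) * fst (f z)))
  with ((r + Cmod z) * (2 * PI * fst (f z)) + 0 * (2 * PI * fst (f z))) by ring.
assert (H00 : Cmod 0 < r) by (rewrite Cmod_0; lra).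
rewrite <- (Poisson_formula R0 f r z Hf Hr Hz), <- (Poisson_formula R0 f r 0%C Hf Hr H00).
replace ((r - Cmod z) * RInt (fun t => poisson r 0 t * fst (f (circ r t))) 0 (2 * PI))
  with ((r - Cmod z) * RInt (fun t => poisson r 0 t * fst (f (circ r t))) 0 (2 * PI) +
     0 * RInt (fun t => poisson r 0 t * fst (f (circ r t))) 0 (2 * PI)) by ring.
assert (Hc : forall w, Cmod w < r ->
  forall t, continuous (fun t => poisson r w t * fst (f (circ r t))) t).
{ intros w Hw t; apply (continuous_mult (K := R_AbsRing)).
  - now apply continuous_poisson.
  - now apply continuous_Re_circ with R0. }
rewrite <- !RInt_lin by auto.
assert (Hc2 : forall w a, Cmod w < r -> ex_RInt (fun t =>
  a * (poisson r w t * fst (f (circ r t))) + 0 * (poisson r w t * fst (f (circ r t))))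
  0 (2 * PI)).
{ intros w a Hw; apply ex_RInt_all_continuous; intros t.
  apply (continuous_plus (V := R_NormedModule));
  apply (continuous_mult (K := R_AbsRing)); try apply continuous_const; now apply Hc. }
apply RInt_le; [lra | auto | auto|].
intros t _; rewrite !Rmult_0_l, !Rplus_0_r, <- !Rmult_assoc.
apply Rmult_le_compat_r; trivial.
assert (E : poisson r 0 t = 1).
{ unfold poisson; replace (circ r t - 0)%C with (circ r t) by ring.
  rewrite Cmod_0, Cmod_circ by lra; field; lra. }
rewrite E, Rmult_1_r; unfold poisson.
generalize (Cmod_circ_sub_pos r z t Hz); intros Hp.
assert (Hb : Cmod (circ r t - z) <= r + Cmod z).
{ eapply Rle_trans; [apply Cmod_triangle|]; rewrite Cmod_opp, Cmod_circ by lra; lra. }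
apply Rmult_le_reg_r with (Cmod (circ r t - z) ^ 2); [now apply pow_lt|].
replace ((r + Cmod z) * ((r ^ 2 - Cmod z ^ 2) / Cmod (circ r t - z) ^ 2) *
  Cmod (circ r t - z) ^ 2) with ((r - Cmod z) * (r + Cmod z) ^ 2) by (field; lra).
apply Rmult_le_compat_l; [lra|]; apply pow_incr; lra.
Qed.

(** The pair is tested against its own value at [z]: the real part of the resulting holomorphic
    pairing obeys 2 Re <a, b> <= |a|^2 + |b|^2 on the circle, which at [z] reads 2 K <= K + M^2.
    This is the maximum principle for the modulus of F + G j. *)
Lemma max_principle2 R0 f g r z M : Hol R0 f -> Hol R0 g -> 0 < r < R0 -> Cmod z < r ->
  0 <= M ->
  (forall t, 0 <= t <= 2 * PI -> Cmod (f (circ r t)) ^ 2 + Cmod (g (circ r t)) ^ 2 <= M ^ 2) ->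
  Cmod (f z) ^ 2 + Cmod (g z) ^ 2 <= M ^ 2.
Proof.
intros Hf Hg Hr Hz HM0 HM.
set (K := Cmod (f z) ^ 2 + Cmod (g z) ^ 2).
assert (HK : 2 * fst (Cconj (f z) * f z + Cconj (g z) * g z)%C <= K + M ^ 2).
{ replace (2 * fst (Cconj (f z) * f z + Cconj (g z) * g z)%C)
    with (fst (2 * (Cconj (f z) * f z + Cconj (g z) * g z))%C) by (simpl; ring).
  apply (max_principle_Re R0
    (fun w => 2 * (Cconj (f z) * f w + Cconj (g z) * g w))%C r z); trivial.
  - apply Hol_mult; [apply Hol_const|].
    apply Hol_plus; apply Hol_mult; trivial; apply Hol_const.
  - intros t Ht; specialize (HM t Ht); unfold K; rewrite !Cmod_sqr in *; revert HM.
    generalize (f (circ r t)) (g (circ r t)) (f z) (g z); simpl.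
    intros [a b] [c d] [a' b'] [c' d']; simpl; intros.
    generalize (pow2_ge_0 (a - a')) (pow2_ge_0 (b - b')) (pow2_ge_0 (c - c'))
      (pow2_ge_0 (d - d')); nra. }
assert (E : fst (Cconj (f z) * f z + Cconj (g z) * g z)%C = K).
{ unfold K; rewrite !Cmod_sqr; simpl; ring. }
rewrite E in HK; lra.
Qed.

(** * Regularity and the identity theorem *)

Lemma cderiv_unique f z l m : cderiv f z l -> cderiv f z m -> l = m.
Proof.
intros (p & Hp & <- & Hlp) (q & Hq & <- & Hlq).
apply Ceq_minus; destruct (Ceq_dec (p z - q z)%C 0%C) as [E|N]; trivial; exfalso.
assert (Hc : continuous (fun w => p w - q w)%C z) by now apply continuous_Cminus.
destruct (locally_Cmod_inv z _ (filter_and _ _ (continuous_neq0 _ _ Hc N)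
  (filter_and _ _ Hlp Hlq))) as [eps [He H]].
set (w := (z + RtoC (eps / 2))%C).
assert (Hw : (w - z)%C = RtoC (eps / 2)) by (unfold w; ring).
destruct (H w) as (H1 & H2 & H3).
{ rewrite Hw, Cmod_R, Rabs_pos_eq; lra. }
rewrite Hw in H2, H3.
apply (Cmult_neq_0 (p w - q w)%C (RtoC (eps / 2))); trivial.
- intros E; apply (f_equal fst) in E; simpl in E; lra.
- transitivity ((f z + p w * RtoC (eps / 2)) - (f z + q w * RtoC (eps / 2)))%C; [ring|].
  rewrite <- H2, <- H3; ring.
Qed.

Lemma bounded_segment (g : R -> C) (a b : R) : a <= b ->
  (forall t, continuous g t) -> exists M, 0 < M /\ forall t, a <= t <= b -> Cmod (g t) <= M.
Proof.
intros Hab Hg.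
destruct (continuity_ab_maj (fun t => fst (g t) ^ 2 + snd (g t) ^ 2) a b Hab) as [x [Hx _]].
{ intros c _; apply continuity_pt_filterlim; now apply (continuous_normsq g). }
exists (1 + Cmod (g x)); split; [generalize (Cmod_ge_0 (g x)); lra|].
intros t Ht; specialize (Hx t Ht); rewrite <- !Cmod_sqr in Hx.
apply Rle_trans with (Cmod (g x)); [|lra].
apply sqr_le_inv; trivial; apply Cmod_ge_0.
Qed.

Lemma circ_sub_lower r z t : Cmod z < r -> r - Cmod z <= Cmod (circ r t - z).
Proof.
intros Hz; generalize (Cmod_ge_0 z); intros.
generalize (Cmod_triangle (circ r t - z) z).
replace (circ r t - z + z)%C with (circ r t) by ring.
rewrite Cmod_circ by lra; lra.
Qed.

(** A Cauchy-type integral of arbitrary continuous data. The data must be free to vary, because the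
    recursion [CK_step] absorbs a kernel factor into it. *)
Definition CK (r : R) (g : R -> C) (n : nat) (z : C) : C :=
  CI (fun t => g t * (/ (circ r t - z)) ^ n)%C.

Lemma continuous_Cpow {U : UniformSpace} (f : U -> C) n x :
  continuous f x -> continuous (fun u => f u ^ n)%C x.
Proof.
intros Hf; induction n as [|n IH]; simpl; [apply continuous_const|].
now apply continuous_Cmult.
Qed.

Lemma continuous_kernel r z t : Cmod z < r -> continuous (fun u => / (circ r u - z))%C t.
Proof.
intros Hz; apply continuous_Cinv; [|now apply circ_sub_neq0].
apply continuous_Cminus; [apply continuous_circ | apply continuous_const].
Qed.

Lemma continuous_kernel_pow r g n z t : Cmod z < r -> continuous g t ->
  continuous (fun u => g u * (/ (circ r u - z)) ^ n)%C t.
Proof.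
intros Hz Hg; apply continuous_Cmult; trivial.
now apply continuous_Cpow, continuous_kernel.
Qed.

(* From 1/(c-w) = 1/(c-z) + (w-z)/((c-w)(c-z)). *)
Lemma CK_step r g n z w : (forall t, continuous g t) -> Cmod z < r -> Cmod w < r ->
  CK r g (S n) w = (CK r (fun t => g t * / (circ r t - z)) n w +
    CK r (fun t => g t * / (circ r t - z)) (S n) w * (w - z))%C.
Proof.
intros Hg Hz Hw; unfold CK.
assert (Hgz : forall t, continuous (fun t => g t * / (circ r t - z))%C t)
  by (intros t; apply continuous_Cmult; trivial; now apply continuous_kernel).
rewrite (Cmult_comm _ (w - z)), <- CI_scal, <- CI_plus.
- apply CI_ext; intros t; simpl.
  generalize (circ_sub_neq0 r z t Hz) (circ_sub_neq0 r w t Hw); intros H1 H2.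
  generalize ((/ (circ r t - w)) ^ n)%C; intros c.
  field; auto.
- intros t; now apply continuous_kernel_pow.
- intros t; apply continuous_Cmult; [apply continuous_const|].
  now apply (continuous_kernel_pow r (fun t => g t * / (circ r t - z))%C (S n)).
- intros t; now apply (continuous_kernel_pow r (fun t => g t * / (circ r t - z))%C (S n)).
Qed.

Lemma CK_bound r g n z : (forall t, continuous g t) -> Cmod z < r ->
  exists B, locally z (fun w => Cmod (CK r g n w) <= B).
Proof.
intros Hg Hz.
destruct (bounded_segment g 0 (2 * PI)) as [M [HM0 HM]]; trivial.
{ generalize PI_RGT_0; lra. }
set (d := (r - Cmod z) / 2); assert (Hd : 0 < d) by (unfold d; lra).
exists (4 * PI * (M * (/ d) ^ n)).
apply locally_Cmod with d; trivial; intros w Hw.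
assert (Hwr : Cmod w < r).
{ replace w with (z + (w - z))%C by ring.
  generalize (Cmod_triangle z (w - z)); unfold d in *; lra. }
apply CI_bound; [intros t; now apply continuous_kernel_pow|].
intros t Ht; rewrite Cmod_mult, Cmod_pow, Cmod_inv by now apply circ_sub_neq0.
apply Rmult_le_compat; [apply Cmod_ge_0 | | auto |].
- apply pow_le, Rlt_le, Rinv_0_lt_compat; now apply Cmod_circ_sub_pos.
- apply pow_incr; split.
  + apply Rlt_le, Rinv_0_lt_compat; now apply Cmod_circ_sub_pos.
  + apply Rinv_le_contravar; trivial.
    generalize (circ_sub_lower r z t Hz) (Cmod_triangle (circ r t - w) (w - z)).
    replace (circ r t - w + (w - z))%C with (circ r t - z)%C by ring.
    unfold d in *; lra.
Qed.

(** The slope in [CK_step] is again a Cauchy integral of the same order, whose continuity is not yet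
    known; boundedness near [z] is enough and breaks the circle. *)
Lemma continuous_bounded_slope (f psi : C -> C) (z : C) (B : R) :
  continuous f z -> locally z (fun w => Cmod (psi w) <= B) ->
  continuous (fun w => f w + psi w * (w - z))%C z.
Proof.
intros Hf HB; apply continuous_Cplus; trivial.
intros P HP.
destruct (locally_Cmod_inv _ _ HP) as [e [He HP']].
destruct (locally_Cmod_inv _ _ HB) as [d [Hd HB']].
assert (HB1 : 0 < Rabs B + 1) by (generalize (Rabs_pos B); lra).
apply locally_Cmod with (Rmin d (e / (Rabs B + 1))).
{ apply Rmin_glb_lt; trivial; now apply Rdiv_lt_0_compat. }
intros w Hw; apply HP'.
replace (psi w * (w - z) - psi z * (z - z))%C with (psi w * (w - z))%C by ring.
rewrite Cmod_mult.
assert (H1 : Cmod (psi w) <= B) by (apply HB'; eapply Rlt_le_trans; [exact Hw | apply Rmin_l]).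
assert (H2 : Cmod (w - z) < e / (Rabs B + 1))
  by (eapply Rlt_le_trans; [exact Hw | apply Rmin_r]).
generalize (Cmod_ge_0 (psi w)) (Cmod_ge_0 (w - z)) (Rle_abs B); intros.
apply Rle_lt_trans with (Rabs B * Cmod (w - z)); [apply Rmult_le_compat_r; lra|].
apply Rmult_lt_compat_l with (r := Rabs B + 1) in H2; trivial.
replace ((Rabs B + 1) * (e / (Rabs B + 1))) with e in H2 by (field; lra).
nra.
Qed.

Lemma continuous_CK r n : forall g z, (forall t, continuous g t) -> Cmod z < r ->
  continuous (CK r g n) z.
Proof.
induction n as [|n IH]; intros g z Hg Hz.
- apply continuous_ext with (fun _ => CI (fun t => g t * 1)%C); [|apply continuous_const].
  intros w; reflexivity.
- assert (Hgz : forall t, continuous (fun t => g t * / (circ r t - z))%C t)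
    by (intros t; apply continuous_Cmult; trivial; now apply continuous_kernel).
  destruct (CK_bound r _ (S n) z Hgz Hz) as [B HB].
  generalize (continuous_bounded_slope _ _ z B (IH _ z Hgz Hz) HB).
  apply continuous_ext_loc.
  generalize (locally_disc r z Hz); apply filter_imp; intros w Hw.
  symmetry; now apply CK_step.
Qed.

(** In [CK_step] the first summand contributes the factor [n] by induction and the slope contributes
    1; at [z] itself the absorbed kernel factor raises the order by one. *)
Lemma cderiv_CK r n : forall g z, (forall t, continuous g t) -> Cmod z < r ->
  cderiv (CK r g n) z (RtoC (INR n) * CK r g (S n) z)%C.
Proof.
induction n as [|n IH]; intros g z Hg Hz.
- simpl INR; replace (RtoC 0 * CK r g 1 z)%C with (RtoC 0) by ring.
  apply cderiv_ext_loc with (fun _ => CI (fun t => g t * 1)%C); [|apply cderiv_const].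
  apply filter_forall; reflexivity.
- assert (Hgz : forall t, continuous (fun t => g t * / (circ r t - z))%C t)
    by (intros t; apply continuous_Cmult; trivial; now apply continuous_kernel).
  set (h := fun t => (g t * / (circ r t - z))%C) in *.
  apply cderiv_ext_loc with (fun w => CK r h n w + CK r h (S n) w * (w - z))%C.
  { generalize (locally_disc r z Hz); apply filter_imp; intros w Hw.
    symmetry; now apply CK_step. }
  assert (E : CK r h (S n) z = CK r g (S (S n)) z).
  { apply CI_ext; intros t; unfold h; simpl; ring. }
  replace (RtoC (INR (S n)) * CK r g (S (S n)) z)%C
    with (RtoC (INR n) * CK r h (S n) z + CK r h (S n) z)%C
    by (rewrite E, S_INR, RtoC_plus; ring).
  apply cderiv_plus; [now apply IH|].
  exists (CK r h (S n)); split; [|split; trivial].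
  + now apply continuous_CK.
  + apply filter_forall; intros w; Cring.
Qed.

Lemma hol_CK r g n : (forall t, continuous g t) ->
  hol r (CK r g n) (fun z => RtoC (INR n) * CK r g (S n) z)%C.
Proof.
intros Hg z Hz; split; [now apply cderiv_CK|].
apply continuous_Cmult; [apply continuous_const | now apply continuous_CK].
Qed.

Lemma hol_scal R0 c f f' : hol R0 f f' -> hol R0 (fun z => c * f z)%C (fun z => c * f' z)%C.
Proof.
intros Hf z Hz; destruct (Hf z Hz); split.
- replace (c * f' z)%C with (0 * f z + c * f' z)%C by ring.
  apply cderiv_mult; trivial; apply cderiv_const.
- apply continuous_Cmult; trivial; apply continuous_const.
Qed.

(** The quotient is the Cauchy integral of [f]: as z / (c - z) = c / (c - z) - 1, multiplying it by
    z gives Cauchy's formula minus the mean of [f], which is f 0 = 0. Two derivatives are recorded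
    because the regular quotient involves the derivative of the quotient, which must be holomorphic
    in turn. *)
Lemma Hol_factor R0 f r : Hol R0 f -> 0 < r < R0 -> f 0%C = 0%C ->
  exists f1 f1' f1'', hol r f1 f1' /\ hol r f1' f1'' /\
    forall z, Cmod z < r -> f z = (z * f1 z)%C.
Proof.
intros Hf Hr H0; generalize PI_RGT_0; intros Hpi.
set (g := fun t => f (circ r t)).
assert (Hg : forall t, continuous g t) by (intros; now apply continuous_hol_circ with R0).
set (c := RtoC (/ (2 * PI))).
exists (fun z => c * CK r g 1 z)%C, (fun z => c * (RtoC (INR 1) * CK r g 2 z))%C,
  (fun z => c * (RtoC (INR 1) * (RtoC (INR 2) * CK r g 3 z)))%C.
split; [|split].
- now apply hol_scal, hol_CK.
- now apply hol_scal, hol_scal, hol_CK.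
- intros z Hz.
  assert (F : forall w, Cmod w < r ->
    CI (fun t => g t * (circ r t / (circ r t - w)))%C = (RtoC (2 * PI) * f w)%C).
  { intros w Hw; unfold g; rewrite (Cauchy_weighted R0 f r w Hf Hr Hw).
    rewrite (proj1 (RInt_poisson_circ r w Hw)); ring. }
  assert (E0 : CI g = 0%C).
  { assert (H00 : Cmod 0 < r) by (rewrite Cmod_0; lra).
    generalize (F 0%C H00); rewrite H0, Cmult_0_r; intros <-.
    apply CI_ext; intros t; generalize (circ_sub_neq0 r 0 t H00); intros Hn.
    replace (circ r t - 0)%C with (circ r t) in * by ring; field; trivial. }
  assert (Hk : forall t, continuous (fun t => g t * (/ (circ r t - z)) ^ 1)%C t)
    by (intros t; now apply continuous_kernel_pow).
  assert (E1 : (RtoC (2 * PI) * f z)%C = (z * CK r g 1 z)%C).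
  { rewrite <- F by trivial; unfold CK; rewrite <- CI_scal by trivial.
    rewrite <- (Cplus_0_l (CI (fun t => z * _)%C)), <- E0, <- CI_plus; trivial.
    - apply CI_ext; intros t; generalize (circ_sub_neq0 r z t Hz); intros Hn.
      simpl; field; trivial.
    - intros t; apply continuous_Cmult; [apply continuous_const | trivial]. }
  replace (z * (c * CK r g 1 z))%C with (c * (z * CK r g 1 z))%C by ring.
  rewrite <- E1; unfold c.
  rewrite Cmult_assoc, <- RtoC_mult, Rinv_l by lra; ring.
Qed.

Lemma real_vanishing_at_0 (R0 : R) (f : C -> C) : 0 < R0 -> continuous f (RtoC 0) ->
  (forall x : R, Rabs x < R0 -> x <> 0 -> f (RtoC x) = 0%C) -> f 0%C = 0%C.
Proof.
intros HR Hc H; destruct (Ceq_dec (f 0%C) 0%C) as [E|N]; trivial; exfalso.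
destruct (locally_Cmod_inv _ _ (continuous_neq0 _ _ Hc N)) as [e [He HP]].
set (x := Rmin (e / 2) (R0 / 2)).
assert (Hx : 0 < x) by (apply Rmin_glb_lt; lra).
assert (Hxe : x <= e / 2) by apply Rmin_l.
assert (HxR : x <= R0 / 2) by apply Rmin_r.
apply (HP (RtoC x)).
- replace (RtoC x - 0)%C with (RtoC x) by ring.
  rewrite Cmod_R, Rabs_pos_eq; lra.
- apply H; [rewrite Rabs_pos_eq; lra | lra].
Qed.

(* Divide by [z] repeatedly and apply the maximum principle to the quotient. *)
Lemma real_vanishing_bound n : forall R0 f r M, Hol R0 f -> 0 < r < R0 -> 0 <= M ->
  (forall x : R, Rabs x < R0 -> f (RtoC x) = 0%C) ->
  (forall t, 0 <= t <= 2 * PI -> Cmod (f (circ r t)) <= M) ->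
  forall z, Cmod z < r -> Cmod (f z) <= M * (Cmod z / r) ^ n.
Proof.
induction n as [|n IH]; intros R0 f r M Hf Hr HM H0 Hb z Hz.
- simpl; rewrite Rmult_1_r.
  generalize (max_principle2 R0 f (fun _ => 0%C) r z M Hf (Hol_const _ _) Hr Hz HM).
  rewrite Cmod_0; intros K.
  assert (K' : Cmod (f z) ^ 2 + 0 ^ 2 <= M ^ 2).
  { apply K; intros t Ht; generalize (Hb t Ht) (Cmod_ge_0 (f (circ r t))); intros; nra. }
  apply sqr_le_inv; trivial; simpl in *; lra.
(* [Hol_factor] loses some radius, so the disc shrinks at each division, always remaining larger
   than [r]. *)
- set (R1 := (r + R0) / 2).
  assert (HR1 : 0 < R1 < R0) by (unfold R1; lra).
  assert (HR1' : 0 < r < R1) by (unfold R1; lra).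
  destruct (Hol_factor R0 f R1 Hf HR1) as (f1 & f1' & _ & Hf1 & _ & E).
  { apply H0; rewrite Rabs_R0; lra. }
  assert (Hf1' : Hol R1 f1) by now exists f1'.
  assert (Hn0 : forall x : R, Rabs x < R1 -> x <> 0 -> f1 (RtoC x) = 0%C).
  { intros x Hx Hx0.
    assert (Hxn : RtoC x <> 0%C) by (intros Ex; apply Hx0; now apply RtoC_inj).
    replace (f1 (RtoC x)) with (/ RtoC x * (RtoC x * f1 (RtoC x)))%C by (field; trivial).
    rewrite <- E by (rewrite Cmod_R; lra); rewrite H0 by lra; ring. }
  rewrite E, Cmod_mult by lra.
  assert (B : Cmod (f1 z) <= M / r * (Cmod z / r) ^ n).
  { apply (IH R1); trivial.
    - apply Rmult_le_pos; trivial; apply Rlt_le, Rinv_0_lt_compat; lra.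
    - intros x Hx; destruct (Req_dec x 0) as [->|Hx0]; [|now apply Hn0].
      apply (real_vanishing_at_0 R1); trivial; [lra|].
      apply Hol_continuous with R1; trivial; rewrite Cmod_0; lra.
    - intros t Ht; apply Rmult_le_reg_l with r; [lra|].
      replace (r * (M / r)) with M by (field; lra).
      rewrite <- (Cmod_circ r t) at 1 by lra.
      rewrite <- Cmod_mult, <- E by (rewrite Cmod_circ; lra); now apply Hb. }
  replace (M * (Cmod z / r) ^ S n) with (Cmod z * (M / r * (Cmod z / r) ^ n))
    by (simpl; field; lra).
  apply Rmult_le_compat_l; trivial; apply Cmod_ge_0.
Qed.

(** The bound M (|z| / r)^n holds for every n with the same M, and |z| < r. *)
Lemma Hol_real_vanishing R0 f : Hol R0 f ->
  (forall x : R, Rabs x < R0 -> f (RtoC x) = 0%C) ->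
  forall z, Cmod z < R0 -> f z = 0%C.
Proof.
intros Hf H0 z Hz; generalize (Cmod_ge_0 z) PI_RGT_0; intros Hz0 Hpi.
set (r := (Cmod z + R0) / 2); assert (Hr : 0 < r < R0) by (unfold r; lra).
assert (Hzr : Cmod z < r) by (unfold r; lra).
destruct (bounded_segment (fun t => f (circ r t)) 0 (2 * PI)) as [M [HM0 HM]]; [lra| |].
{ intros t; now apply continuous_hol_circ with R0. }
apply Cmod_eq_0, Rle_antisym; [|apply Cmod_ge_0].
apply Rnot_lt_le; intros Hlt.
destruct (pow_lt_1_zero (Cmod z / r)) with (y := Cmod (f z) / M) as [N HN].
- rewrite Rabs_pos_eq.
  + apply Rmult_lt_reg_r with r; [lra|]; unfold Rdiv; rewrite Rmult_assoc, Rinv_l; lra.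
  + apply Rmult_le_pos; trivial; apply Rlt_le, Rinv_0_lt_compat; lra.
- now apply Rdiv_lt_0_compat.
- specialize (HN N (Nat.le_refl N)).
  generalize (real_vanishing_bound N R0 f r M Hf Hr (Rlt_le _ _ HM0) H0 HM z Hzr).
  generalize (Rle_lt_trans _ _ _ (Rle_abs _) HN); intros K1 K2.
  apply Rmult_lt_compat_l with (r := M) in K1; trivial.
  replace (M * (Cmod (f z) / M)) with (Cmod (f z)) in K1 by (field; lra).
  lra.
Qed.

(** * Restriction of slice regular functions to [C_i] *)

Lemma cderiv_of_differentiable (f : C -> C) (x y a b : R) :
  differentiable_pt_lim (fun s t => fst (f (s, t))) x y a (- b) ->
  differentiable_pt_lim (fun s t => snd (f (s, t))) x y b a ->
  cderiv f (x, y) (a, b).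
Proof.
intros H1 H2; set (z := (x, y) : C); set (l := (a, b) : C).
exists (fun w => if Ceq_dec w z then l else ((f w - f z) / (w - z))%C).
split; [|split].
- intros P HP.
  destruct (Ceq_dec z z) as [_|N]; [|now elim N].
  destruct (locally_Cmod_inv _ _ HP) as [e [He HP']].
  (* Passing from the components to the modulus costs at most a factor 2, leaving e / 2. *)
  assert (He' : 0 < e / 4) by lra.
  specialize (H1 (mkposreal _ He')); specialize (H2 (mkposreal _ He')); simpl in H1, H2.
  apply locally_2d_locally in H1; apply locally_2d_locally in H2.
  unfold filtermap; generalize (filter_and _ _ H1 H2).
  apply filter_imp; intros w [K1 K2]; apply HP'; change (R * R)%type with C in w.
  destruct (Ceq_dec w z) as [E|N].
  { replace (l - l)%C with (RtoC 0) by ring; rewrite Cmod_0; lra. }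
  assert (Hn : (w - z)%C <> 0%C) by (intros E; apply N; now apply Ceq_minus).
  assert (Hp : 0 < Cmod (w - z)) by now apply Cmod_gt_0.
  replace ((f w - f z) / (w - z) - l)%C with ((f w - f z - l * (w - z)) / (w - z))%C
    by (field; trivial).
  rewrite Cmod_div by trivial.
  apply Rmult_lt_reg_r with (Cmod (w - z)); trivial.
  replace (Cmod (f w - f z - l * (w - z)) / Cmod (w - z) * Cmod (w - z))
    with (Cmod (f w - f z - l * (w - z))) by (field; lra).
  assert (HM : Rmax (Rabs (fst w - x)) (Rabs (snd w - y)) <= Cmod (w - z))
    by exact (Rmax_Cmod (w - z)%C).
  assert (B1 : Rabs (fst (f w - f z - l * (w - z))%C) <= e / 4 * Cmod (w - z)).
  { eapply Rle_trans; [|apply Rmult_le_compat_l; [lra | exact HM]].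
    eapply Rle_trans; [|exact K1]; right; f_equal.
    rewrite <- surjective_pairing; unfold l, z; simpl; ring. }
  assert (B2 : Rabs (snd (f w - f z - l * (w - z))%C) <= e / 4 * Cmod (w - z)).
  { eapply Rle_trans; [|apply Rmult_le_compat_l; [lra | exact HM]].
    eapply Rle_trans; [|exact K2]; right; f_equal.
    rewrite <- surjective_pairing; unfold l, z; simpl; ring. }
  eapply Rle_lt_trans; [apply Cmod_2Rmax|].
  apply Rle_lt_trans with (2 * (e / 4 * Cmod (w - z))); [|nra].
  apply Rmult_le_compat; [apply sqrt_pos | | | now apply Rmax_lub].
  + eapply Rle_trans; [apply Rabs_pos | apply Rmax_l].
  + generalize (sqrt_sqrt 2) (sqrt_pos 2); intros E; specialize (E ltac:(lra)); nra.
- destruct (Ceq_dec z z) as [_|N]; [trivial | now elim N].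
- apply filter_forall; intros w; change C in w.
  destruct (Ceq_dec w z) as [->|N]; [ring|].
  assert (Hn : (w - z)%C <> 0%C) by (intros E; apply N; now apply Ceq_minus).
  field; trivial.
Qed.

Lemma differentiable_of_partials (u ux uy : C -> R) (R0 : R) :
  (forall x y, Cmod (x, y) < R0 -> is_derive (fun t => u (t, y)) x (ux (x, y))) ->
  (forall x y, Cmod (x, y) < R0 -> is_derive (fun t => u (x, t)) y (uy (x, y))) ->
  (forall z, Cmod z < R0 -> continuous ux z) ->
  forall x y, Cmod (x, y) < R0 ->
  differentiable_pt_lim (fun s t => u (s, t)) x y (ux (x, y)) (uy (x, y)).
Proof.
intros Hx Hy Hc x y Hz; apply filterdiff_differentiable_pt_lim.
apply filterdiff_ext_lin with
  (fun p => plus (scal (fst p) (ux (x, y))) (scal (snd p) (uy (x, y)))); [|trivial].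
apply (is_derive_filterdiff (fun s t => u (s, t)) x y (fun s t => ux (s, t)) (uy (x, y))).
- generalize (locally_disc R0 _ Hz); apply filter_imp; intros [s t] Hst; now apply Hx.
- now apply Hy.
- apply continuous_ext with ux; [now intros [s t] | now apply Hc].
Qed.

Lemma hol_of_partials (f fx fy : C -> C) (R0 : R) :
  (forall x y, Cmod (x, y) < R0 ->
    is_derive (fun t => fst (f (t, y))) x (fst (fx (x, y))) /\
    is_derive (fun t => snd (f (t, y))) x (snd (fx (x, y))) /\
    is_derive (fun t => fst (f (x, t))) y (fst (fy (x, y))) /\
    is_derive (fun t => snd (f (x, t))) y (snd (fy (x, y)))) ->
  (forall z, Cmod z < R0 -> continuous fx z) ->
  (forall z, Cmod z < R0 -> (fx z + Ci * fy z)%C = 0%C) ->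
  hol R0 f fx.
Proof.
intros HD Hc HCR [x y] Hz; split; [|now apply Hc].
generalize (HCR _ Hz); intros E; apply (f_equal (fun w : C => w)) in E.
assert (E1 := f_equal fst E); assert (E2 := f_equal snd E); simpl in E1, E2.
rewrite (surjective_pairing (fx (x, y))).
apply cderiv_of_differentiable.
- replace (- snd (fx (x, y))) with (fst (fy (x, y))) by lra.
  apply (differentiable_of_partials (fun z => fst (f z)) (fun z => fst (fx z))
    (fun z => fst (fy z)) R0); trivial; try (intros; now apply HD).
  intros; now apply continuous_Re, Hc.
- replace (fst (fx (x, y))) with (snd (fy (x, y))) by lra.
  apply (differentiable_of_partials (fun z => snd (f z)) (fun z => snd (fx z))
    (fun z => snd (fy z)) R0); trivial; try (intros; now apply HD).
  intros; now apply continuous_Im, Hc.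
Qed.

(* [qC a b] is [a + b j]. *)
Definition qC (a b : C) : quat := (fst a, snd a, fst b, snd b).
Definition q1 (q : quat) : C := fst (fst q).
Definition q2 (q : quat) : C := (snd (fst q), snd q).

Lemma qC_eta (q : quat) : qC (q1 q) (q2 q) = q.
Proof. now destruct q as [[[a b] c] d]. Qed.
Lemma q1_qC a b : q1 (qC a b) = a.
Proof. now destruct a. Qed.
Lemma q2_qC a b : q2 (qC a b) = b.
Proof. now destruct b. Qed.

Lemma slice_point_qi x y : slice_point qi x y = qC (x, y) 0.
Proof. apply quat_eq; quat_simpl; ring. Qed.

Lemma qnorm_qC a b : qnorm (qC a b) ^ 2 = Cmod a ^ 2 + Cmod b ^ 2.
Proof.
unfold qC; rewrite qnorm_sqr, !Cmod_sqr; ring.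
Qed.

Lemma qnorm_ge_0 q : 0 <= qnorm q.
Proof. destruct q as [[[a b] c] d]; apply sqrt_pos. Qed.

Lemma qnorm_qC0 a : qnorm (qC a 0) = Cmod a.
Proof.
unfold qC, qnorm, Cmod; f_equal; simpl; ring.
Qed.

Lemma qball_0 r q : qball 0 r q <-> qnorm q < r.
Proof.
unfold qball; replace (q - 0)%quat with q; [tauto|].
destruct q as [[[a b] c] d]; apply quat_eq; quat_simpl; ring.
Qed.

Lemma imag_sphere_qi : imag_sphere qi.
Proof. apply imag_sphereP; lra. Qed.

Lemma is_derive_qDerive (g : R -> quat) (t : R) :
  ex_derive g t -> is_derive g t (qDerive g t).
Proof. intros [l Hl]; now rewrite (qDerive_correct g t l Hl). Qed.

Lemma qDerive_q1 (g : R -> quat) (t : R) : ex_derive g t ->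
  is_derive (fun s => fst (q1 (g s))) t (fst (q1 (qDerive g t))) /\
  is_derive (fun s => snd (q1 (g s))) t (snd (q1 (qDerive g t))).
Proof.
intros H; apply is_derive_qDerive in H; split.
- exact (is_derive_fst _ _ _ (is_derive_fst _ _ _ (is_derive_fst _ _ _ H))).
- exact (is_derive_snd _ _ _ (is_derive_fst _ _ _ (is_derive_fst _ _ _ H))).
Qed.

Lemma qDerive_q2 (g : R -> quat) (t : R) : ex_derive g t ->
  is_derive (fun s => fst (q2 (g s))) t (fst (q2 (qDerive g t))) /\
  is_derive (fun s => snd (q2 (g s))) t (snd (q2 (qDerive g t))).
Proof.
intros H; apply is_derive_qDerive in H; split.
- exact (is_derive_snd _ _ _ (is_derive_fst _ _ _ H)).
- exact (is_derive_snd _ _ _ H).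
Qed.

Lemma continuous_quat_q1 {U : UniformSpace} (f : U -> quat) x :
  continuous f x -> continuous (fun u => q1 (f u)) x.
Proof.
intros H.
assert (H1 : continuous (fun u => fst (f u)) x).
{ apply (continuous_comp f fst); trivial; destruct (f x); apply continuous_fst. }
apply (continuous_comp (fun u => fst (f u)) fst); trivial.
destruct (fst (f x)); apply continuous_fst.
Qed.

Lemma continuous_quat_q2 {U : UniformSpace} (f : U -> quat) x :
  continuous f x -> continuous (fun u => q2 (f u)) x.
Proof.
intros H.
assert (H1 : continuous (fun u => fst (f u)) x).
{ apply (continuous_comp f fst); trivial; destruct (f x); apply continuous_fst. }
apply continuous_C; unfold q2; simpl.
- apply (continuous_comp (fun u => fst (f u)) snd); trivial.
  destruct (fst (f x)); apply continuous_snd.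
- apply (continuous_comp f snd); trivial; destruct (f x); apply continuous_snd.
Qed.

Definition dxi (f : quat -> quat) (z : C) : quat := slice_dx f qi (fst z) (snd z).

(** Left multiplication by [qi] multiplies both components of a + b j by the complex number i, so
    the slice equation on C_i splits into the Cauchy-Riemann equations of each component. *)
Lemma slice_regular_hol f : slice_regular f ->
  hol 1 (fun z => q1 (f (qC z 0))) (fun z => q1 (dxi f z)) /\
  hol 1 (fun z => q2 (f (qC z 0))) (fun z => q2 (dxi f z)).
Proof.
intros Hf.
assert (K : forall x y, Cmod (x, y) < 1 -> qball 0 1 (slice_point qi x y)).
{ intros x y H; apply qball_0; now rewrite slice_point_qi, qnorm_qC0. }
assert (CR : forall z, Cmod z < 1 ->
  (slice_dx f qi (fst z) (snd z) + qi * slice_dy f qi (fst z) (snd z) = 0)%quat).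
{ intros [x y] H; destruct (Hf qi imag_sphere_qi x y (K x y H)) as (_ & _ & _ & _ & E).
  simpl; revert E; generalize (slice_dx f qi x y + qi * slice_dy f qi x y)%quat.
  intros [[[a b] c] d] E; injection E; quat_simpl; intros E4 E3 E2 E1.
  apply quat_eq; quat_simpl; lra. }
split.
- apply (hol_of_partials _ _ (fun z => q1 (slice_dy f qi (fst z) (snd z)))).
  + intros x y H; destruct (Hf qi imag_sphere_qi x y (K x y H)) as (Hx & Hy & _).
    apply qDerive_q1 in Hx; apply qDerive_q1 in Hy.
    destruct Hx as [Hx1 Hx2], Hy as [Hy1 Hy2].
    refine (conj _ (conj _ (conj _ _)));
    [revert Hx1 | revert Hx2 | revert Hy1 | revert Hy2];
    apply is_derive_ext; intros t; now rewrite slice_point_qi.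
  + intros [x y] H; apply continuous_quat_q1 with (f := dxi f).
    now destruct (Hf qi imag_sphere_qi x y (K x y H)) as (_ & _ & Hc & _).
  + intros z H; generalize (CR z H); unfold dxi.
    destruct (slice_dx f qi (fst z) (snd z)) as [[[a b] c] d],
      (slice_dy f qi (fst z) (snd z)) as [[[a' b'] c'] d'].
    intros E; injection E; quat_simpl; intros E4 E3 E2 E1.
    apply injective_projections; simpl; lra.
- apply (hol_of_partials _ _ (fun z => q2 (slice_dy f qi (fst z) (snd z)))).
  + intros x y H; destruct (Hf qi imag_sphere_qi x y (K x y H)) as (Hx & Hy & _).
    apply qDerive_q2 in Hx; apply qDerive_q2 in Hy.
    destruct Hx as [Hx1 Hx2], Hy as [Hy1 Hy2].
    refine (conj _ (conj _ (conj _ _)));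
    [revert Hx1 | revert Hx2 | revert Hy1 | revert Hy2];
    apply is_derive_ext; intros t; now rewrite slice_point_qi.
  + intros [x y] H; apply continuous_quat_q2 with (f := dxi f).
    now destruct (Hf qi imag_sphere_qi x y (K x y H)) as (_ & _ & Hc & _).
  + intros z H; generalize (CR z H); unfold dxi.
    destruct (slice_dx f qi (fst z) (snd z)) as [[[a b] c] d],
      (slice_dy f qi (fst z) (snd z)) as [[[a' b'] c'] d'].
    intros E; injection E; quat_simpl; intros E4 E3 E2 E1.
    apply injective_projections; simpl; lra.
Qed.

Lemma slice_derive_dx f I x y : slice_regular f -> imag_sphere I ->
  qball 0 1 (slice_point I x y) -> slice_derive f (slice_point I x y) = slice_dx f I x y.
Proof.
intros Hf HI Hq; rewrite slice_derive_correct by trivial.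
destruct (Hf I HI x y Hq) as (_ & _ & _ & _ & E); revert E.
generalize (slice_dx f I x y) (I * slice_dy f I x y)%quat.
intros [[[a b] c] d] [[[a' b'] c'] d'] E.
injection E; quat_simpl; intros E4 E3 E2 E1.
apply quat_eq; quat_simpl; lra.
Qed.

(** * Change of slice by rotation *)

Lemma qassoc (p q r : quat) : (p * (q * r) = p * q * r)%quat.
Proof. exact (qmult_assoc p q r). Qed.
Lemma qmult_1_l (p : quat) : (1 * p = p)%quat.
Proof. exact (qmult_one_l p). Qed.
Lemma qmult_1_r (p : quat) : (p * 1 = p)%quat.
Proof. exact (qmult_one_r p). Qed.

Lemma qnorm_mult (p q : quat) : qnorm (p * q)%quat = qnorm p * qnorm q.
Proof.
destruct p as [[[a b] c] d], q as [[[a' b'] c'] d'].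
unfold qnorm; rewrite <- sqrt_mult_alt by nra.
unfold mult; simpl; f_equal; ring.
Qed.

Lemma qnorm_eq_0 q : qnorm q = 0 -> q = 0%quat.
Proof.
destruct q as [[[a b] c] d]; intros E.
assert (E' := qnorm_sqr a b c d); rewrite E in E'.
apply (quat_eq a b c d 0 0 0 0); nra.
Qed.

Lemma qnorm_0 : qnorm 0%quat = 0.
Proof. transitivity (sqrt 0); [unfold qnorm; quat_simpl; f_equal; ring | apply sqrt_0]. Qed.

Lemma qnorm_1 : qnorm 1%quat = 1.
Proof. transitivity (sqrt 1); [unfold qnorm; quat_simpl; f_equal; ring | apply sqrt_1]. Qed.

Lemma qnorm_pos q : q <> 0%quat -> 0 < qnorm q.
Proof.
intros H; destruct (qnorm_ge_0 q) as [|E]; trivial.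
now elim H; apply qnorm_eq_0.
Qed.

Lemma one_neq_0 : 1%quat <> 0%quat.
Proof. intros E; apply (f_equal qRe) in E; change (1 = 0) in E; lra. Qed.

Lemma qinv_unique (p r : quat) : (p * r = 1)%quat -> r = (/ p)%quat.
Proof.
intros E.
assert (Hp : p <> 0%quat).
{ intros ->; apply (f_equal qnorm) in E; rewrite qnorm_mult, qnorm_0, qnorm_1 in E; lra. }
now rewrite <- (qmult_1_l r), <- (qmult_inv_l p Hp), <- qassoc, E, qmult_1_r.
Qed.

Lemma qmult_0_r (p : quat) : (p * 0 = 0)%quat.
Proof. quat_ring. Qed.

Lemma qinv_unique_l (p r : quat) : (r * p = 1)%quat -> r = (/ p)%quat.
Proof.
intros E.
assert (Hp : p <> 0%quat).
{ intros ->; apply (f_equal qnorm) in E; rewrite qnorm_mult, qnorm_0, qnorm_1 in E; lra. }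
now rewrite <- (qmult_1_r r), <- (qmult_inv_r p Hp), qassoc, E, qmult_1_l.
Qed.

Lemma qinv_neq_0 p : p <> 0%quat -> (/ p)%quat <> 0%quat.
Proof.
intros Hp E; apply one_neq_0; rewrite <- (qmult_inv_r p Hp), E; apply qmult_0_r.
Qed.

Lemma qRe_comm p q : qRe (p * q)%quat = qRe (q * p)%quat.
Proof.
destruct p as [[[a b] c] d], q as [[[a' b'] c'] d']; unfold mult; simpl; ring.
Qed.

Lemma qreal_comm x p : (qreal x * p = p * qreal x)%quat.
Proof. destruct p as [[[a b] c] d]; apply quat_eq; quat_simpl; ring. Qed.

Lemma qscal_real x p : (x *: p = qreal x * p)%quat.
Proof. destruct p as [[[a b] c] d]; apply quat_eq; quat_simpl; ring. Qed.

Lemma qdistr_l (p q r : quat) : ((p + q) * r = p * r + q * r)%quat.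
Proof. exact (qmult_plus_l p q r). Qed.
Lemma qdistr_r (p q r : quat) : (p * (q + r) = p * q + p * r)%quat.
Proof. exact (qmult_plus_r p q r). Qed.

Lemma qnorm_slice_point I x y : imag_sphere I -> qnorm (slice_point I x y) = Cmod (x, y).
Proof.
destruct I as [[[a b] c] d]; intros H; apply imag_sphereP in H; destruct H as [-> H].
unfold qnorm, Cmod, slice_point; quat_simpl; f_equal.
transitivity (x * x + y * y * (b ^ 2 + c ^ 2 + d ^ 2)); [|rewrite H]; ring.
Qed.

Lemma qball_slice_point I x y : imag_sphere I ->
  (qball 0 1 (slice_point I x y) <-> Cmod (x, y) < 1).
Proof. intros HI; now rewrite qball_0, qnorm_slice_point. Qed.

Lemma slice_point_exists q : exists I x y,
  imag_sphere I /\ 0 <= y /\ q = slice_point I x y.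
Proof.
destruct q as [[[a b] c] d].
set (y := sqrt (b ^ 2 + c ^ 2 + d ^ 2)).
assert (Hy2 : y ^ 2 = b ^ 2 + c ^ 2 + d ^ 2) by (unfold y; rewrite pow2_sqrt; nra).
assert (Hy : 0 <= y) by apply sqrt_pos.
destruct (Req_dec y 0) as [E|N].
- exists qi, a, 0; split; [apply imag_sphere_qi|split; [lra|]].
  rewrite E in Hy2; unfold qi; apply quat_eq; quat_simpl; nra.
- exists (0, b / y, c / y, d / y), a, y; split; [|split; trivial].
  + apply imag_sphereP; split; trivial.
    transitivity ((b ^ 2 + c ^ 2 + d ^ 2) / y ^ 2); [field; trivial|].
    rewrite <- Hy2; field; trivial.
  + apply quat_eq; quat_simpl; field; trivial.
Qed.

Definition rot (a q : quat) : quat := (/ a * q * a)%quat.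
Definition unrot (a q : quat) : quat := (a * q * / a)%quat.

Section Rotation.
Variable a : quat.
Hypothesis Ha : a <> 0%quat.

Lemma rot_unrot q : rot a (unrot a q) = q.
Proof.
unfold rot, unrot; rewrite !qassoc, qmult_inv_l, qmult_1_l by trivial.
now rewrite <- qassoc, qmult_inv_l, qmult_1_r.
Qed.

Lemma unrot_rot q : unrot a (rot a q) = q.
Proof.
unfold rot, unrot; rewrite !qassoc, qmult_inv_r, qmult_1_l by trivial.
now rewrite <- qassoc, qmult_inv_r, qmult_1_r.
Qed.

Lemma rot_mult p q : (rot a p * rot a q = rot a (p * q))%quat.
Proof.
unfold rot; rewrite !qassoc.
now rewrite <- (qassoc _ a (/ a)%quat), qmult_inv_r, qmult_1_r.
Qed.

Lemma unrot_mult p q : (unrot a p * unrot a q = unrot a (p * q))%quat.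
Proof.
unfold unrot; rewrite !qassoc.
now rewrite <- (qassoc _ (/ a)%quat a), qmult_inv_l, qmult_1_r.
Qed.

Lemma rot_plus p q : rot a (p + q)%quat = (rot a p + rot a q)%quat.
Proof. unfold rot; now rewrite qdistr_r, qdistr_l. Qed.

Lemma rot_real x : rot a (qreal x) = qreal x.
Proof. unfold rot; now rewrite <- qassoc, qreal_comm, qassoc, qmult_inv_l, qmult_1_l. Qed.

Lemma unrot_real x : unrot a (qreal x) = qreal x.
Proof. unfold unrot; now rewrite <- qreal_comm, <- qassoc, qmult_inv_r, qmult_1_r. Qed.

Lemma rot_scal x p : rot a (x *: p)%quat = (x *: rot a p)%quat.
Proof. now rewrite !qscal_real, <- rot_mult, rot_real. Qed.

Lemma unrot_plus p q : unrot a (p + q)%quat = (unrot a p + unrot a q)%quat.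
Proof. unfold unrot; now rewrite qdistr_r, qdistr_l. Qed.

Lemma unrot_scal x p : unrot a (x *: p)%quat = (x *: unrot a p)%quat.
Proof. now rewrite !qscal_real, <- unrot_mult, unrot_real. Qed.

Lemma qnorm_rot q : qnorm (rot a q) = qnorm q.
Proof.
unfold rot; rewrite !qnorm_mult.
replace (qnorm (/ a)%quat * qnorm q * qnorm a)
  with (qnorm (/ a)%quat * qnorm a * qnorm q) by ring.
rewrite <- qnorm_mult, qmult_inv_l, qnorm_1 by trivial; ring.
Qed.

Lemma qnorm_unrot q : qnorm (unrot a q) = qnorm q.
Proof. now rewrite <- (qnorm_rot (unrot a q)), rot_unrot. Qed.

Lemma rot_inv q : q <> 0%quat -> (/ rot a q)%quat = rot a (/ q)%quat.
Proof.
intros H; symmetry; apply qinv_unique.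
rewrite rot_mult, qmult_inv_r by trivial; exact (rot_real 1).
Qed.

Lemma qRe_rot q : qRe (rot a q) = qRe q.
Proof. unfold rot; now rewrite qRe_comm, qassoc, qmult_inv_r, qmult_1_l. Qed.

Lemma imag_sphere_unrot I : imag_sphere I -> imag_sphere (unrot a I).
Proof.
unfold imag_sphere; intros E; rewrite unrot_mult, E.
assert (E1 : (- (1))%quat = qreal (-1)) by (apply quat_eq; quat_simpl; ring).
now rewrite E1, unrot_real.
Qed.

Lemma unrot_slice_point I x y : unrot a (slice_point I x y) = slice_point (unrot a I) x y.
Proof. unfold slice_point; now rewrite unrot_plus, unrot_scal, unrot_real. Qed.

Lemma is_linear_rot : is_linear (U := quat_NormedModule) (V := quat_NormedModule) (rot a).
Proof.
split.
- exact rot_plus.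
- exact rot_scal.
- exists 1; split; [lra|]; intros q.
  rewrite Rmult_1_l; right.
  transitivity (qnorm (rot a q)); [symmetry; apply qnorm_norm|].
  rewrite qnorm_rot; apply qnorm_norm.
Qed.

Lemma is_derive_rot (g : R -> quat) t l :
  is_derive g t l -> is_derive (fun s => rot a (g s)) t (rot a l).
Proof.
intros H.
apply filterdiff_ext_lin with (fun y : R => rot a (scal y l)).
- apply (filterdiff_comp (U := R_NormedModule) (V := quat_NormedModule)
    (W := quat_NormedModule) g (rot a) (fun y => scal y l) (rot a) H).
  apply filterdiff_linear, is_linear_rot.
- intros y; apply rot_scal.
Qed.

Lemma continuous_rot {U : UniformSpace} (g : U -> quat) x :
  continuous g x -> continuous (fun u => rot a (g u)) x.
Proof.
intros H; apply (continuous_comp g (rot a)); trivial.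
apply (filterdiff_continuous (U := quat_NormedModule) (V := quat_NormedModule)).
exists (rot a); apply filterdiff_linear, is_linear_rot.
Qed.

(** Conjugating source and target by the same [a] preserves the slice equation and carries the slice
    of [unrot a I] to that of [I]. Facts proved on C_i thereby serve every slice. *)
Definition frot (f : quat -> quat) (q : quat) : quat := rot a (f (unrot a q)).

Lemma frot_slice f I x y :
  frot f (slice_point I x y) = rot a (f (slice_point (unrot a I) x y)).
Proof. unfold frot; now rewrite unrot_slice_point. Qed.

Lemma slice_dx_frot f I x y : slice_regular f -> imag_sphere I -> Cmod (x, y) < 1 ->
  ex_derive (fun t => frot f (slice_point I t y)) x /\
  slice_dx (frot f) I x y = rot a (slice_dx f (unrot a I) x y).
Proof.
intros Hf HI H; assert (HI' := imag_sphere_unrot I HI).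
apply (qball_slice_point _ _ _ HI') in H.
destruct (Hf _ HI' x y H) as (Hx & _).
apply is_derive_qDerive, is_derive_rot in Hx.
assert (Hx' : is_derive (fun t => frot f (slice_point I t y)) x
  (rot a (slice_dx f (unrot a I) x y))).
{ revert Hx; apply is_derive_ext; intros t; now rewrite frot_slice. }
split; [eexists; exact Hx' | now apply qDerive_correct].
Qed.

Lemma slice_dy_frot f I x y : slice_regular f -> imag_sphere I -> Cmod (x, y) < 1 ->
  ex_derive (fun t => frot f (slice_point I x t)) y /\
  slice_dy (frot f) I x y = rot a (slice_dy f (unrot a I) x y).
Proof.
intros Hf HI H; assert (HI' := imag_sphere_unrot I HI).
apply (qball_slice_point _ _ _ HI') in H.
destruct (Hf _ HI' x y H) as (_ & Hx & _).
apply is_derive_qDerive, is_derive_rot in Hx.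
assert (Hx' : is_derive (fun t => frot f (slice_point I x t)) y
  (rot a (slice_dy f (unrot a I) x y))).
{ revert Hx; apply is_derive_ext; intros t; now rewrite frot_slice. }
split; [eexists; exact Hx' | now apply qDerive_correct].
Qed.

Lemma slice_regular_frot f : slice_regular f -> slice_regular (frot f).
Proof.
intros Hf I HI x y H; apply (qball_slice_point _ _ _ HI) in H.
assert (HI' := imag_sphere_unrot I HI).
destruct (Hf _ HI' x y (proj2 (qball_slice_point _ _ _ HI') H)) as (_ & _ & Hcx & Hcy & CR).
destruct (slice_dx_frot f I x y Hf HI H) as [Hx Ex].
destruct (slice_dy_frot f I x y Hf HI H) as [Hy Ey].
assert (Hl : locally (x, y) (fun z : C => Cmod z < 1)) by now apply locally_disc.
repeat (split; trivial).
- apply continuous_rot in Hcx; revert Hcx; apply continuous_ext_loc.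
  revert Hl; apply filter_imp; intros z Hz; symmetry; apply slice_dx_frot; trivial.
- apply continuous_rot in Hcy; revert Hcy; apply continuous_ext_loc.
  revert Hl; apply filter_imp; intros z Hz; symmetry; apply slice_dy_frot; trivial.
- rewrite Ex, Ey.
  transitivity (rot a ((1 / 2) *:
    (slice_dx f (unrot a I) x y + unrot a I * slice_dy f (unrot a I) x y))%quat).
  + now rewrite rot_scal, rot_plus, <- rot_mult, rot_unrot.
  + rewrite CR; exact (rot_real 0).
Qed.

Lemma slice_derive_frot f q : slice_regular f -> qball 0 1 q ->
  slice_derive (frot f) q = rot a (slice_derive f (unrot a q)).
Proof.
intros Hf Hq; destruct (slice_point_exists q) as (I & x & y & HI & _ & ->).
assert (HI' := imag_sphere_unrot I HI).
assert (Hz := proj1 (qball_slice_point _ _ _ HI) Hq).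
rewrite slice_derive_dx, unrot_slice_point, slice_derive_dx; trivial.
- now apply slice_dx_frot.
- now apply qball_slice_point.
- now apply slice_regular_frot.
Qed.

Lemma qball_unrot q : qball 0 1 q -> qball 0 1 (unrot a q).
Proof. now rewrite !qball_0, qnorm_unrot. Qed.

(** Every factor of the starlikeness quantity is conjugated by the same [a], and conjugation leaves
    the real part unchanged. *)
Lemma slice_starlike_frot f : slice_starlike f -> slice_starlike (frot f).
Proof.
intros [(Hr & Hz & Hd) Hs].
assert (E0 : unrot a 0%quat = 0%quat) by exact (unrot_real 0).
assert (H00 : qball 0 1 0%quat) by (apply qball_0; rewrite qnorm_0; lra).
assert (Hu0 : forall q, q <> 0%quat -> unrot a q <> 0%quat).
{ intros q H E; apply H; rewrite <- (rot_unrot q), E; exact (rot_real 0). }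
split; [split; [|split]|].
- now apply slice_regular_frot.
- intros q Hq; unfold frot; split; intros E.
  + apply (f_equal (unrot a)) in E; rewrite unrot_rot, E0 in E.
    apply (proj1 (Hz _ (qball_unrot q Hq))) in E.
    rewrite <- (rot_unrot q), E; exact (rot_real 0).
  + rewrite E, E0, (proj2 (Hz 0%quat H00) (eq_refl _)); exact (rot_real 0).
- rewrite slice_derive_frot, E0, Hd; trivial; exact (rot_real 1).
- intros q Hq Hq0; rewrite slice_derive_frot by trivial; unfold frot.
  rewrite rot_inv.
  + replace (rot a (/ f (unrot a q)) * q)%quat with (rot a (/ f (unrot a q) * unrot a q)%quat)
      by now rewrite <- rot_mult, rot_unrot.
    rewrite rot_mult, qRe_rot; apply Hs; [now apply qball_unrot | now apply Hu0].
  + intros E; apply (proj1 (Hz _ (qball_unrot q Hq))) in E; now apply (Hu0 q).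
Qed.

End Rotation.

(* [I + i] intertwines [i] and [I], unless it vanishes. *)
Lemma sphere_rotation I : imag_sphere I -> exists a, a <> 0%quat /\ (a * qi = I * a)%quat.
Proof.
destruct I as [[[t b] c] d]; intros H; apply imag_sphereP in H; destruct H as [-> H].
destruct (Req_dec b (-1)) as [->|Hb].
(* Here I = - i, so I + i vanishes; j does the job, as j i = - i j. *)
- assert (c = 0) by nra; assert (d = 0) by nra; subst.
  exists (0, 0, 1, 0); split.
  + intros E; apply (f_equal (fun q : quat => snd (fst q))) in E; change (1 = 0) in E; lra.
  + apply quat_eq; quat_simpl; ring.
- exists (0, 1 + b, c, d); split.
  + intros E; apply (f_equal (fun q : quat => snd (fst (fst q)))) in E.
    change (1 + b = 0) in E; lra.
  + apply quat_eq; quat_simpl; nra.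
Qed.

(** * Spheres *)

Lemma qC_mult a b c d :
  (qC a b * qC c d)%quat = qC (a * c - b * Cconj d)%C (a * d + b * Cconj c)%C.
Proof.
destruct a, b, c, d; apply quat_eq; simpl; ring.
Qed.

Lemma qC_plus a b c d : (qC a b + qC c d)%quat = qC (a + c)%C (b + d)%C.
Proof. destruct a, b, c, d; apply quat_eq; quat_simpl; ring. Qed.

Definition hat (f : C -> C) (z : C) : C := Cconj (f (Cconj z)).

Lemma locally_Cconj (z : C) (P : C -> Prop) :
  locally (Cconj z) P -> locally z (fun w => P (Cconj w)).
Proof. exact (continuous_Cconj (fun w => w) z (continuous_id z) P). Qed.

Lemma hol_hat R0 f f' : hol R0 f f' -> hol R0 (hat f) (hat f').
Proof.
intros Hf z Hz.
assert (Hz' : Cmod (Cconj z) < R0) by now rewrite Cmod_conj.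
assert (Hcc : forall h : C -> C, continuous h (Cconj z) -> continuous (hat h) z).
{ intros h Hh; apply continuous_Cconj, (continuous_comp Cconj h); trivial.
  exact (continuous_Cconj (fun w => w) z (continuous_id z)). }
destruct (Hf _ Hz') as [(p & Hp & E & Hl) Hc]; split; [|now apply Hcc].
exists (hat p); split; [now apply Hcc|split].
- unfold hat; now rewrite E.
- apply locally_Cconj in Hl; revert Hl; apply filter_imp; intros w Hw.
  unfold hat; rewrite Hw, Cplus_conj, Cmult_conj, Cminus_conj, !Cconj_conj; trivial.
Qed.

Lemma Hol_hat R0 f : Hol R0 f -> Hol R0 (hat f).
Proof. intros [f' Hf]; exists (hat f'); now apply hol_hat. Qed.

(** [pl K] and [pr K] are the left coefficients that the representation formula gives to the values
    at z and at conj z. *)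
Definition pl (K : quat) : quat := ((1 / 2) *: (1 - K * qi))%quat.
Definition pr (K : quat) : quat := ((1 / 2) *: (1 + K * qi))%quat.

(* If [n K = i n] then [n pl K] and [n pr K] are the two complex components of [n]. *)
Lemma intertwine_pl n K : (n * K = qi * n)%quat -> (n * pl K)%quat = qC (q1 n) 0.
Proof.
intros E.
transitivity ((1 / 2) *: (n - n * K * qi))%quat.
- clear E; destruct n as [[[? ?] ?] ?], K as [[[? ?] ?] ?]; apply quat_eq; quat_simpl; ring.
- rewrite E; clear E; destruct n as [[[? ?] ?] ?]; apply quat_eq; quat_simpl; field.
Qed.

Lemma intertwine_pr n K : (n * K = qi * n)%quat -> (n * pr K)%quat = qC (RtoC 0) (q2 n).
Proof.
intros E.
transitivity ((1 / 2) *: (n + n * K * qi))%quat.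
- clear E; destruct n as [[[? ?] ?] ?], K as [[[? ?] ?] ?]; apply quat_eq; quat_simpl; ring.
- rewrite E; clear E; destruct n as [[[? ?] ?] ?]; apply quat_eq; quat_simpl; field.
Qed.

Lemma Cmod_eta_conj (x y : R) : Cmod (x, - y) = Cmod (x, y).
Proof. exact (Cmod_conj (x, y)). Qed.

(** A rotation carries the slice of [K] to C_i. There both sides, multiplied by [/ a] on the left
    and by [a] on the right, have holomorphic components; they agree on the real axis, which lies in
    every slice, and so everywhere by the identity theorem. *)
Lemma representation f K z : slice_regular f -> imag_sphere K -> Cmod z < 1 ->
  f (slice_point K (fst z) (snd z)) =
  (pl K * f (qC z (RtoC 0)) + pr K * f (qC (Cconj z) (RtoC 0)))%quat.
Proof.
intros Hf HK Hz; destruct (sphere_rotation K HK) as (a & Ha & E).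
assert (EK : unrot a qi = K).
{ unfold unrot; now rewrite E, <- qassoc, qmult_inv_r, qmult_1_r. }
assert (En : (/ a * K = qi * / a)%quat).
{ rewrite <- EK; unfold unrot; now rewrite !qassoc, qmult_inv_l, qmult_1_l. }
set (F := fun w => q1 (f (qC w (RtoC 0)))); set (G := fun w => q2 (f (qC w (RtoC 0)))).
set (al := q1 (/ a)%quat); set (be := q2 (/ a)%quat).
(* X + Y j extends [/ a * f] holomorphically from the real axis: moving j past F x turns it into
   conj (F x), whose extension is [hat F]. *)
set (X := fun w => (al * F w - be * hat G w)%C).
set (Y := fun w => (al * G w + be * hat F w)%C).
assert (HF : Hol 1 F) by (eexists; now apply slice_regular_hol).
assert (HG : Hol 1 G) by (eexists; now apply slice_regular_hol).
assert (HX : Hol 1 X) by (apply Hol_minus; apply Hol_mult; trivial;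
  try apply Hol_hat; trivial; apply Hol_const).
assert (HY : Hol 1 Y) by (apply Hol_plus; apply Hol_mult; trivial;
  try apply Hol_hat; trivial; apply Hol_const).
destruct (slice_regular_hol _ (slice_regular_frot a Ha f Hf)) as [H1 H2].
assert (HXY : forall w, qC (X w) (Y w) =
  (qC al (RtoC 0) * f (qC w (RtoC 0)) + qC (RtoC 0) be * f (qC (Cconj w) (RtoC 0)))%quat).
{ intros w; rewrite <- (qC_eta (f (qC w (RtoC 0)))), <- (qC_eta (f (qC (Cconj w) (RtoC 0)))).
  rewrite !qC_mult, qC_plus; unfold X, Y, hat, F, G; f_equal; ring. }
assert (Hreal : forall x : R,
  frot a f (qC (RtoC x) (RtoC 0)) = (qC (X (RtoC x)) (Y (RtoC x)) * a)%quat).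
{ intros x; rewrite HXY.
  replace (Cconj (RtoC x)) with (RtoC x)
    by (apply injective_projections; simpl; ring).
  rewrite <- qdistr_l, qC_plus, Cplus_0_r, Cplus_0_l; unfold al, be; rewrite qC_eta.
  unfold frot, rot; change (qC (RtoC x) (RtoC 0)) with (qreal x); now rewrite unrot_real. }
assert (Hall : forall w, Cmod w < 1 -> frot a f (qC w (RtoC 0)) = (qC (X w) (Y w) * a)%quat).
{ intros w Hw; rewrite <- (qC_eta a) in Hreal |- *; rewrite qC_mult.
  rewrite <- (qC_eta (frot (qC (q1 a) (q2 a)) f (qC w (RtoC 0)))).
  rewrite (qC_eta a) in *.
  f_equal; apply Ceq_minus.
  - apply (Hol_real_vanishing 1 (fun w => q1 (frot a f (qC w (RtoC 0))) -
      (X w * q1 a - Y w * Cconj (q2 a)))%C); trivial.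
    + apply Hol_minus; [eexists; exact H1|].
      apply Hol_minus; apply Hol_mult; trivial; apply Hol_const.
    + intros x _; rewrite Hreal, <- (qC_eta a) at 1; rewrite qC_mult, q1_qC; ring.
  - apply (Hol_real_vanishing 1 (fun w => q2 (frot a f (qC w (RtoC 0))) -
      (X w * q2 a + Y w * Cconj (q1 a)))%C); trivial.
    + apply Hol_minus; [eexists; exact H2|].
      apply Hol_plus; apply Hol_mult; trivial; apply Hol_const.
    + intros x _; rewrite Hreal, <- (qC_eta a) at 1; rewrite qC_mult, q2_qC; ring. }
specialize (Hall z Hz); unfold frot in Hall.
replace (unrot a (qC z (RtoC 0))) with (slice_point K (fst z) (snd z)) in Hall.
2:{ rewrite <- EK, <- unrot_slice_point, slice_point_qi; trivial; now destruct z. }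
apply (f_equal (unrot a)) in Hall; rewrite unrot_rot in Hall by trivial.
rewrite Hall, HXY; unfold unrot, al, be.
rewrite <- (intertwine_pl _ _ En), <- (intertwine_pr _ _ En).
rewrite <- !qassoc, qmult_inv_r, qmult_1_r, qdistr_r by trivial.
now rewrite !qassoc, qmult_inv_r, !qmult_1_l by trivial.
Qed.

Lemma is_linear_lmult p :
  is_linear (U := quat_NormedModule) (V := quat_NormedModule) (fun q : quat => (p * q)%quat).
Proof.
split.
- intros q r; apply qdistr_r.
- intros x q; change (p * (x *: q) = x *: (p * q))%quat.
  now rewrite !qscal_real, !qassoc, qreal_comm.
- exists (1 + qnorm p); split; [generalize (qnorm_ge_0 p); lra|]; intros q.
  replace (norm (p * q)%quat) with (qnorm (p * q)%quat) by apply qnorm_norm.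
  replace (norm q) with (qnorm q) by apply qnorm_norm.
  rewrite qnorm_mult; generalize (qnorm_ge_0 q); nra.
Qed.

Lemma is_derive_lmult p (g : R -> quat) t l :
  is_derive g t l -> is_derive (fun s => (p * g s)%quat) t (p * l)%quat.
Proof.
intros H.
apply filterdiff_ext_lin with (fun y : R => mult p (scal y l)).
- apply (filterdiff_comp (U := R_NormedModule) (V := quat_NormedModule)
    (W := quat_NormedModule) g (fun q : quat => (p * q)%quat) (fun y => scal y l)
    (fun q : quat => (p * q)%quat) H).
  apply filterdiff_linear, is_linear_lmult.
- intros y; change (p * (y *: l) = y *: (p * l))%quat.
  now rewrite !qscal_real, !qassoc, qreal_comm.
Qed.

(** The slice derivative is the derivative in the real direction, along which the coefficients of
    the representation formula are constant. *)
Lemma representation_derive f K z : slice_regular f -> imag_sphere K -> Cmod z < 1 ->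
  slice_derive f (slice_point K (fst z) (snd z)) =
  (pl K * slice_derive f (qC z (RtoC 0)) + pr K * slice_derive f (qC (Cconj z) (RtoC 0)))%quat.
Proof.
intros Hf HK Hz; destruct z as [x y]; simpl fst; simpl snd.
assert (Hz' : Cmod (x, - y) < 1) by now rewrite Cmod_eta_conj.
change (Cconj (x, y)) with ((x, - y) : C).
rewrite <- !slice_point_qi, !slice_derive_dx; trivial;
  try apply imag_sphere_qi; try (apply qball_slice_point; trivial; apply imag_sphere_qi).
apply qDerive_correct.
assert (D : forall y, Cmod (x, y) < 1 ->
  is_derive (fun t => f (slice_point qi t y)) x (slice_dx f qi x y)).
{ intros y' H; apply is_derive_qDerive.
  apply (Hf qi imag_sphere_qi x y'), qball_slice_point; trivial; apply imag_sphere_qi. }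
generalize (is_derive_plus (V := quat_NormedModule) _ _ _ _ _
  (is_derive_lmult (pl K) _ _ _ (D y Hz)) (is_derive_lmult (pr K) _ _ _ (D (- y) Hz'))).
apply is_derive_ext_loc.
assert (L : locally x (fun t => Cmod (t, y) < 1)).
{ assert (Hc : continuous (fun t : R => (t, y) : C) x).
  { apply continuous_C; [apply continuous_id | apply continuous_const]. }
  exact (Hc _ (locally_disc 1 _ Hz)). }
revert L; apply filter_imp; intros t Ht.
rewrite !slice_point_qi.
exact (eq_sym (representation f K (t, y) Hf HK Ht)).
Qed.

(** * Symmetrization, regular conjugate and extrema on a sphere *)

Definition Fc (f : quat -> quat) (z : C) : C := q1 (f (qC z 0)).
Definition Gc (f : quat -> quat) (z : C) : C := q2 (f (qC z 0)).
Definition on_slice (f : quat -> quat) (K : quat) (z : C) : quat :=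
  f (slice_point K (fst z) (snd z)).

(* The restriction to [C_i] of the symmetrization of [f]. *)
Definition symm (f : quat -> quat) (z : C) : C :=
  (Fc f z * hat (Fc f) z + Gc f z * hat (Gc f) z)%C.

(* The restriction to [C_i] of the regular conjugate of [f]. *)
Definition rconj (f : quat -> quat) (z : C) : quat := qC (hat (Fc f) z) (- Gc f z)%C.

Lemma f_qC f z : f (qC z 0) = qC (Fc f z) (Gc f z).
Proof. symmetry; apply qC_eta. Qed.

Lemma hat_conj f z : f (Cconj z) = Cconj (hat f z).
Proof. unfold hat; now rewrite Cconj_conj. Qed.

(** This is the evaluation rule of the regular product: with n = [rconj f z], the second factor is
    taken at n^{-1} z n, which lies on the slice of the [K] with n K = i n. *)
Lemma rconj_on_slice f K z : slice_regular f -> imag_sphere K -> Cmod z < 1 ->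
  (rconj f z * K = qi * rconj f z)%quat ->
  (rconj f z * on_slice f K z)%quat = qC (symm f z) 0.
Proof.
intros Hf HK Hz E; unfold on_slice; rewrite (representation f K z) by trivial.
rewrite qdistr_r, !qassoc, (intertwine_pl _ _ E), (intertwine_pr _ _ E).
rewrite !f_qC; unfold rconj; rewrite q1_qC, q2_qC, !qC_mult, qC_plus.
rewrite (hat_conj (Fc f)), (hat_conj (Gc f)), !Cconj_conj.
unfold symm; f_equal; ring.
Qed.

Definition nsq (q : quat) : R := let '(a, b, c, d) := q in a ^ 2 + b ^ 2 + c ^ 2 + d ^ 2.

Lemma qnorm_nsq q : qnorm q ^ 2 = nsq q.
Proof. destruct q as [[[a b] c] d]; apply qnorm_sqr. Qed.

(* On a sphere [|f|^2] is an affine function of the imaginary unit; its extreme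
   values are taken at opposite points and multiply to [|symm f|^2]. *)
Lemma sphere_extrema f z : slice_regular f -> Cmod z < 1 ->
  exists K1 K2, imag_sphere K1 /\ imag_sphere K2 /\
    (forall K, imag_sphere K ->
      qnorm (on_slice f K2 z) <= qnorm (on_slice f K z) <= qnorm (on_slice f K1 z)) /\
    qnorm (on_slice f K1 z) * qnorm (on_slice f K2 z) = Cmod (symm f z).
Proof.
intros Hf Hz.
assert (Hn : exists s w1 w2 w3, (forall k1 k2 k3, imag_sphere (0, k1, k2, k3) ->
    qnorm (on_slice f (0, k1, k2, k3) z) ^ 2 = s + (k1 * w1 + k2 * w2 + k3 * w3)) /\
  s ^ 2 - (w1 ^ 2 + w2 ^ 2 + w3 ^ 2) = Cmod (symm f z) ^ 2).
{ assert (Hrep := fun K HK => representation f K z Hf HK Hz).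
  unfold on_slice, symm; rewrite Cmod_sqr.
  rewrite !f_qC in Hrep; rewrite (hat_conj (Fc f)), (hat_conj (Gc f)) in Hrep.
  destruct (Fc f z) as [a b], (Gc f z) as [c d], (hat (Fc f) z) as [a' b'],
    (hat (Gc f) z) as [c' d'].
  set (U := a ^ 2 + b ^ 2 + c ^ 2 + d ^ 2).
  set (V := a' ^ 2 + b' ^ 2 + c' ^ 2 + d' ^ 2).
  (* [U] and [V] are the squared norms at z and conj z, that is at K = i and K = - i; this forces
     the constant term and the first coefficient. The other two are cross terms. *)
  exists ((U + V) / 2), ((U - V) / 2), (- a' * d + b' * c + c' * b - d' * a),
    (a' * c + b' * d - c' * a - d' * b); split.
  - intros k1 k2 k3 HK; rewrite Hrep by trivial.
    apply imag_sphereP in HK; destruct HK as [_ HK].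
    rewrite qnorm_nsq; unfold qC, pl, pr, qi; quat_simpl.
    set (B := ((a + a') ^ 2 + (b - b') ^ 2 + (c + c') ^ 2 + (d - d') ^ 2) / 4).
    set (D := ((a - a') ^ 2 + (b + b') ^ 2 + (c - c') ^ 2 + (d + d') ^ 2) / 4).
    replace ((U + V) / 2) with (B + D * (k1 ^ 2 + k2 ^ 2 + k3 ^ 2))
      by (rewrite HK; unfold B, D, U, V; field).
    unfold U, V, B, D; field.
  - unfold U, V; simpl; field. }
destruct Hn as (s & w1 & w2 & w3 & Hn & Hs).
assert (K : exists k1 k2 k3 m, k1 ^ 2 + k2 ^ 2 + k3 ^ 2 = 1 /\ 0 <= m /\
  w1 = m * k1 /\ w2 = m * k2 /\ w3 = m * k3).
{ set (m := sqrt (w1 ^ 2 + w2 ^ 2 + w3 ^ 2)).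
  assert (Hm2 : m ^ 2 = w1 ^ 2 + w2 ^ 2 + w3 ^ 2) by (unfold m; rewrite pow2_sqrt; nra).
  assert (Hm : 0 <= m) by apply sqrt_pos.
  destruct (Req_dec m 0) as [E|E].
  (* The norm is constant on this sphere, so any unit vector will do. *)
  - rewrite E in Hm2; exists 1, 0, 0, 0; repeat split; nra.
  - exists (w1 / m), (w2 / m), (w3 / m), m; repeat split; trivial; try (field; trivial).
    transitivity ((w1 ^ 2 + w2 ^ 2 + w3 ^ 2) / m ^ 2); [field; trivial|].
    rewrite <- Hm2; field; trivial. }
destruct K as (k1 & k2 & k3 & m & Hk & Hm & -> & -> & ->).
assert (HK1 : imag_sphere (0, k1, k2, k3)) by (apply imag_sphereP; lra).
assert (HK2 : imag_sphere (0, - k1, - k2, - k3)) by (apply imag_sphereP; split; nra).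
assert (E1 : qnorm (on_slice f (0, k1, k2, k3) z) ^ 2 = s + m).
{ rewrite Hn by trivial; rewrite <- (Rmult_1_r m) at 4; rewrite <- Hk; ring. }
assert (E2 : qnorm (on_slice f (0, - k1, - k2, - k3) z) ^ 2 = s - m).
{ rewrite Hn by trivial; rewrite <- (Rmult_1_r m) at 4; rewrite <- Hk; ring. }
exists (0, k1, k2, k3), (0, - k1, - k2, - k3); repeat split; trivial.
- destruct K as [[[t l1] l2] l3]; assert (HK := proj1 (imag_sphereP _ _ _ _) H).
  destruct HK as [-> Hl].
  apply sqr_le_inv; [apply qnorm_ge_0|]; rewrite E2, Hn by trivial.
  assert (-1 <= k1 * l1 + k2 * l2 + k3 * l3).
  { generalize (pow2_ge_0 (k1 + l1)) (pow2_ge_0 (k2 + l2)) (pow2_ge_0 (k3 + l3)); nra. }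
  nra.
- destruct K as [[[t l1] l2] l3]; assert (HK := proj1 (imag_sphereP _ _ _ _) H).
  destruct HK as [-> Hl].
  apply sqr_le_inv; [apply qnorm_ge_0|]; rewrite E1, Hn by trivial.
  assert (k1 * l1 + k2 * l2 + k3 * l3 <= 1).
  { generalize (pow2_ge_0 (k1 - l1)) (pow2_ge_0 (k2 - l2)) (pow2_ge_0 (k3 - l3)); nra. }
  nra.
- assert (E : (qnorm (on_slice f (0, k1, k2, k3) z) *
    qnorm (on_slice f (0, - k1, - k2, - k3) z)) ^ 2 = Cmod (symm f z) ^ 2).
  { rewrite Rpow_mult_distr, E1, E2, <- Hs.
    transitivity (s ^ 2 - m ^ 2 * 1); [ring | rewrite <- Hk; ring]. }
  apply Rle_antisym; apply sqr_le_inv; rewrite ?E; try lra; try apply Cmod_ge_0.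
  apply Rmult_le_pos; apply qnorm_ge_0.
Qed.

(** * Minimum principle and regular quotient *)

Lemma qnorm_f_qC f z : qnorm (f (qC z 0)) ^ 2 = Cmod (Fc f z) ^ 2 + Cmod (Gc f z) ^ 2.
Proof. now rewrite f_qC, qnorm_qC. Qed.

Lemma on_slice_qi f z : on_slice f qi z = f (qC z 0).
Proof. unfold on_slice; rewrite slice_point_qi; now destruct z. Qed.

Lemma on_slice_frot a f K z : a <> 0%quat ->
  on_slice (frot a f) K z = rot a (on_slice f (unrot a K) z).
Proof. intros Ha; unfold on_slice; now rewrite frot_slice. Qed.

Lemma imag_sphere_rot a K : a <> 0%quat -> imag_sphere K -> imag_sphere (rot a K).
Proof.
intros Ha E; unfold imag_sphere; rewrite rot_mult, E by trivial.
assert (E1 : (- (1))%quat = qreal (-1)) by (apply quat_eq; quat_simpl; ring).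
now rewrite E1, rot_real.
Qed.

Lemma Hol_Fc f : slice_regular f -> Hol 1 (Fc f).
Proof. intros Hf; eexists; now apply slice_regular_hol. Qed.
Lemma Hol_Gc f : slice_regular f -> Hol 1 (Gc f).
Proof. intros Hf; eexists; now apply slice_regular_hol. Qed.

Lemma Hol_symm f : slice_regular f -> Hol 1 (symm f).
Proof.
intros Hf; apply Hol_plus; apply Hol_mult; try apply Hol_hat;
  now (apply Hol_Fc || apply Hol_Gc).
Qed.

Lemma symm_neq_0 f z : slice_regular f -> Cmod z < 1 ->
  (forall K, imag_sphere K -> on_slice f K z <> 0%quat) -> symm f z <> 0%C.
Proof.
intros Hf Hz H0 E.
destruct (sphere_extrema f z Hf Hz) as (K1 & K2 & HK1 & HK2 & _ & EN).
rewrite E, Cmod_0 in EN.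
generalize (qnorm_pos _ (H0 K1 HK1)) (qnorm_pos _ (H0 K2 HK2)); nra.
Qed.

Lemma qnorm_on_slice K z : imag_sphere K -> qnorm (slice_point K (fst z) (snd z)) = Cmod z.
Proof. intros HK; rewrite qnorm_slice_point by trivial; now destruct z. Qed.

(* On the slice where [|g|] is maximal on the sphere of [q], the function
   [g / symm g] is [1 / min |g|] at [q]; on the bounding sphere it is at most [1 / c]. *)
Lemma min_modulus g r c : slice_regular g ->
  (forall q, qball 0 1 q -> g q <> 0%quat) -> 0 < r < 1 -> 0 < c ->
  (forall q, qnorm q = r -> c <= qnorm (g q)) ->
  forall q, qnorm q < r -> c <= qnorm (g q).
Proof.
intros Hg H0 Hr Hc Hb q Hq.
destruct (slice_point_exists q) as (I & x & y & HI & _ & ->).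
rewrite qnorm_slice_point in Hq by trivial.
set (z := (x, y) : C) in *; change (g (slice_point I x y)) with (on_slice g I z).
assert (Hz : Cmod z < 1) by lra.
destruct (sphere_extrema g z Hg Hz) as (K1 & K2 & HK1 & HK2 & Hext & _).
destruct (sphere_rotation K1 HK1) as (a & Ha & Ea).
assert (Ea' : unrot a qi = K1).
{ unfold unrot; now rewrite Ea, <- qassoc, qmult_inv_r, qmult_1_r. }
set (h := frot a g).
assert (Hh : slice_regular h) by now apply slice_regular_frot.
assert (Hhn : forall K w, qnorm (on_slice h K w) = qnorm (on_slice g (unrot a K) w)).
{ intros K w; unfold h; now rewrite on_slice_frot, qnorm_rot. }
assert (Hs : forall w, Cmod w < 1 -> symm h w <> 0%C).
{ intros w Hw; apply symm_neq_0; trivial; intros K HK E.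
  apply (f_equal qnorm) in E; rewrite Hhn, qnorm_0 in E; apply qnorm_eq_0 in E.
  revert E; apply H0, qball_0; rewrite qnorm_on_slice; trivial.
  now apply imag_sphere_unrot. }
assert (HF : Hol 1 (fun w => Fc h w / symm h w)%C)
  by (apply Hol_div; trivial; [now apply Hol_Fc | now apply Hol_symm]).
assert (HG : Hol 1 (fun w => Gc h w / symm h w)%C)
  by (apply Hol_div; trivial; [now apply Hol_Gc | now apply Hol_symm]).
assert (Hnorm : forall w, Cmod w < 1 -> Cmod (Fc h w / symm h w) ^ 2 +
  Cmod (Gc h w / symm h w) ^ 2 = (qnorm (on_slice h qi w) / Cmod (symm h w)) ^ 2).
{ intros w Hw; rewrite !Cmod_div by now apply Hs.
  rewrite on_slice_qi; unfold Rdiv; rewrite !Rpow_mult_distr, qnorm_f_qC; ring. }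
assert (HM : (qnorm (on_slice h qi z) / Cmod (symm h z)) ^ 2 <= (/ c) ^ 2).
{ rewrite <- Hnorm by trivial.
  apply (max_principle2 1 _ _ r z (/ c) HF HG Hr Hq).
  - apply Rlt_le; now apply Rinv_0_lt_compat.
  - intros t _; assert (Hw : Cmod (circ r t) < 1) by (rewrite Cmod_circ; lra).
    rewrite Hnorm by trivial; apply pow_incr.
    assert (HS := proj1 (Cmod_gt_0 _) (Hs _ Hw)).
    split; [apply Rmult_le_pos; [apply qnorm_ge_0 | now apply Rlt_le, Rinv_0_lt_compat]|].
    (* On the circle, |symm h| is the product of the maximum and the minimum of |h| over the sphere:
       the maximum absorbs the value on C_i, and the minimum is at least [c]. *)
    destruct (sphere_extrema h _ Hh Hw) as (L1 & L2 & HL1 & HL2 & HL & E).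
    apply Rmult_le_reg_r with (Cmod (symm h (circ r t))); trivial.
    apply Rmult_le_reg_l with c; trivial.
    replace (c * (qnorm (on_slice h qi (circ r t)) / Cmod (symm h (circ r t)) *
      Cmod (symm h (circ r t)))) with (c * qnorm (on_slice h qi (circ r t))) by (field; lra).
    replace (c * (/ c * Cmod (symm h (circ r t)))) with (Cmod (symm h (circ r t)))
      by (field; lra).
    rewrite <- E, Rmult_comm; apply Rmult_le_compat; try lra; try apply qnorm_ge_0.
    + apply HL, imag_sphere_qi.
    + rewrite Hhn; apply Hb.
      rewrite qnorm_on_slice by now apply imag_sphere_unrot.
      apply Cmod_circ; lra. }
destruct (sphere_extrema h z Hh Hz) as (L1 & L2 & HL1 & HL2 & HL & E).
assert (HA : qnorm (on_slice h L1 z) = qnorm (on_slice h qi z)).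
{ apply Rle_antisym; [|now apply HL; apply imag_sphere_qi].
  rewrite !Hhn, Ea'; apply Hext; now apply imag_sphere_unrot. }
assert (HB : c <= qnorm (on_slice h L2 z)).
{ assert (HS := proj1 (Cmod_gt_0 _) (Hs _ Hz)).
  apply sqr_le_inv in HM; [|now apply Rlt_le, Rinv_0_lt_compat].
  rewrite <- E, HA in HM, HS.
  generalize (qnorm_ge_0 (on_slice h qi z)) (qnorm_ge_0 (on_slice h L2 z)); intros N1 N2.
  assert (0 < qnorm (on_slice h qi z)) by nra.
  assert (0 < qnorm (on_slice h L2 z)) by nra.
  replace (qnorm (on_slice h qi z) / (qnorm (on_slice h qi z) * qnorm (on_slice h L2 z)))
    with (/ qnorm (on_slice h L2 z)) in HM by (field; lra).
  apply Rinv_le_contravar in HM; [|now apply Rinv_0_lt_compat].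
  now rewrite !Rinv_inv in HM. }
apply Rle_trans with (1 := HB).
rewrite <- (unrot_rot a Ha I), <- Hhn.
apply HL; now apply imag_sphere_rot.
Qed.

(** Dividing by z removes the only zero of [f], so that quotients become meaningful at 0; the
    normalisation f'(0) = 1 fixes the values there. *)
Lemma class_S_factor f r : class_S f -> 0 < r < 1 ->
  exists F1 F1' F1'' G1 G1' G1'',
    hol r F1 F1' /\ hol r F1' F1'' /\ hol r G1 G1' /\ hol r G1' G1'' /\
    F1 0%C = 1%C /\ G1 0%C = 0%C /\
    forall z, Cmod z < r ->
      Fc f z = (z * F1 z)%C /\ Gc f z = (z * G1 z)%C /\
      q1 (dxi f z) = (F1 z + z * F1' z)%C /\ q2 (dxi f z) = (G1 z + z * G1' z)%C.
Proof.
intros (Hf & Hz & Hd) Hr.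
assert (H00 : qball 0 1 0%quat) by (apply qball_0; rewrite qnorm_0; lra).
assert (f0 : f (qC 0 0) = 0%quat) by exact (proj2 (Hz _ H00) eq_refl).
destruct (slice_regular_hol f Hf) as [HF HG].
destruct (Hol_factor 1 (Fc f) r) as (F1 & F1' & F1'' & HF1 & HF1' & EF); trivial.
{ now apply Hol_Fc. }
{ unfold Fc; now rewrite f0. }
destruct (Hol_factor 1 (Gc f) r) as (G1 & G1' & G1'' & HG1 & HG1' & EG); trivial.
{ now apply Hol_Gc. }
{ unfold Gc; now rewrite f0. }
assert (D : forall h h' h1 h1', hol 1 h h' -> hol r h1 h1' ->
  (forall z, Cmod z < r -> h z = (z * h1 z)%C) ->
  forall z, Cmod z < r -> h' z = (h1 z + z * h1' z)%C).
{ intros h h' h1 h1' Hh Hh1 E z Hzr.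
  apply (cderiv_unique h z); [apply Hh; lra|].
  apply cderiv_ext_loc with (fun w => w * h1 w)%C.
  - generalize (locally_disc r z Hzr); apply filter_imp; intros w Hw; now rewrite E.
  - replace (h1 z + z * h1' z)%C with (1 * h1 z + z * h1' z)%C by ring.
    apply cderiv_mult; [apply cderiv_id | now apply Hh1]. }
assert (H0r : Cmod 0 < r) by (rewrite Cmod_0; lra).
assert (d0 : dxi f 0%C = 1%quat).
{ rewrite <- Hd; unfold dxi; simpl.
  rewrite <- slice_derive_dx; trivial; [|apply imag_sphere_qi|].
  - rewrite slice_point_qi; reflexivity.
  - now rewrite slice_point_qi. }
assert (EF' := D _ _ _ _ HF HF1 EF); assert (EG' := D _ _ _ _ HG HG1 EG).
exists F1, F1', F1'', G1, G1', G1''; repeat (split; trivial).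
- generalize (EF' 0%C H0r); rewrite d0, Cmult_0_l, Cplus_0_r; intros <-; reflexivity.
- generalize (EG' 0%C H0r); rewrite d0, Cmult_0_l, Cplus_0_r; intros <-; reflexivity.
- now apply EF.
- now apply EG.
- now apply EF'.
- now apply EG'.
Qed.

(* The restriction to [C_i] of the complex part of the regular quotient of [q f'] by [f]. *)
Definition rquot (f : quat -> quat) (z : C) : C :=
  (z * (q1 (dxi f z) * hat (Fc f) z + Gc f z * hat (fun w => q2 (dxi f w)) z) / symm f z)%C.

Lemma slice_derive_qC f z : slice_regular f -> Cmod z < 1 ->
  slice_derive f (qC z 0) = dxi f z.
Proof.
intros Hf Hz; unfold dxi; rewrite <- slice_derive_dx; trivial; [|apply imag_sphere_qi|].
- rewrite slice_point_qi; now destruct z.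
- apply qball_slice_point; [apply imag_sphere_qi | now destruct z].
Qed.

(** The real part of the pointwise quotient, as it occurs in the starlikeness condition; [rquot]
    belongs to the regular quotient. *)
Definition lquot (f : quat -> quat) (q : quat) : R := qRe (/ f q * q * slice_derive f q)%quat.

(** With n = [rconj f z] one has n f(q) = symm and n q = z n, so f(q)^{-1} q f'(q) = symm^{-1} n q
    f'(q) = symm^{-1} z n f'(q). The left factors are complex, so only the complex component of n
    f'(q) enters the real part. *)
Lemma lquot_rquot f K z : slice_regular f -> imag_sphere K -> Cmod z < 1 ->
  (rconj f z * K = qi * rconj f z)%quat -> symm f z <> 0%C ->
  lquot f (slice_point K (fst z) (snd z)) = fst (rquot f z).
Proof.
intros Hf HK Hz E H0; set (q := slice_point K (fst z) (snd z)).
set (n := rconj f z) in *.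
assert (Ev : (n * f q)%quat = qC (symm f z) 0) by now apply rconj_on_slice.
assert (Eq : (n * q = qC z (RtoC 0) * n)%quat).
{ unfold q, slice_point.
  rewrite qdistr_r, qscal_real, qassoc, <- !qreal_comm, <- qassoc, E.
  rewrite qassoc, <- qdistr_l; f_equal; apply quat_eq; quat_simpl; ring. }
assert (Ed : (n * slice_derive f q)%quat =
  qC (q1 (dxi f z) * hat (Fc f) z + Gc f z * hat (fun w => q2 (dxi f w)) z)%C
     (hat (Fc f) z * q2 (dxi f z) - Gc f z * hat (fun w => q1 (dxi f w)) z)%C).
{ unfold q; rewrite representation_derive by trivial.
  rewrite qdistr_r, !qassoc, (intertwine_pl _ _ E), (intertwine_pr _ _ E).
  rewrite !slice_derive_qC by (trivial; now rewrite Cmod_conj).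
  rewrite <- (qC_eta (dxi f z)), <- (qC_eta (dxi f (Cconj z))).
  unfold n, rconj; rewrite !q1_qC, !q2_qC, !qC_mult, qC_plus.
  unfold hat; f_equal; ring. }
assert (Hinv : (/ f q)%quat = (qC (/ symm f z) (RtoC 0) * n)%quat).
{ symmetry; apply qinv_unique_l.
  rewrite <- qassoc, Ev, qC_mult.
  replace (/ symm f z * symm f z - RtoC 0 * Cconj (RtoC 0))%C with (RtoC 1) by (field; trivial).
  replace (/ symm f z * RtoC 0 + RtoC 0 * Cconj (symm f z))%C with (RtoC 0) by ring.
  reflexivity. }
unfold lquot; rewrite Hinv, <- !qassoc, (qassoc n q), Eq, <- qassoc, Ed, !qC_mult.
unfold qC, qRe, rquot; f_equal; field; trivial.
Qed.

Lemma rconj_neq_0 f z : symm f z <> 0%C -> rconj f z <> 0%quat.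
Proof.
intros H E; apply H.
assert (E1 : hat (Fc f) z = 0%C).
{ transitivity (q1 (rconj f z)); [symmetry; apply q1_qC | now rewrite E]. }
assert (E2 : (- Gc f z)%C = 0%C).
{ transitivity (q2 (rconj f z)); [symmetry; apply q2_qC | now rewrite E]. }
unfold symm; rewrite E1; replace (Gc f z) with (- - Gc f z)%C by ring; rewrite E2; ring.
Qed.

Lemma starlike_symm_neq_0 f z : class_S f -> Cmod z < 1 -> z <> 0%C -> symm f z <> 0%C.
Proof.
intros (Hf & Hz0 & _) Hz Hn; apply symm_neq_0; trivial; intros K HK E.
unfold on_slice in E; apply (proj1 (Hz0 _ (proj2 (qball_0 1 _)
  (eq_ind_r (fun u => u < 1) Hz (qnorm_on_slice K z HK))))) in E.
apply Hn, Cmod_eq_0; now rewrite <- (qnorm_on_slice K z HK), E, qnorm_0.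
Qed.

Lemma qball_on_slice K z : imag_sphere K -> Cmod z < 1 ->
  qball 0 1 (slice_point K (fst z) (snd z)).
Proof. intros HK Hz; apply qball_0; now rewrite qnorm_on_slice. Qed.

Lemma on_slice_neq_0 K (z : C) : imag_sphere K -> z <> 0%C ->
  slice_point K (fst z) (snd z) <> 0%quat.
Proof.
intros HK Hz E; apply Hz, Cmod_eq_0; now rewrite <- (qnorm_on_slice K z HK), E, qnorm_0.
Qed.

Lemma rquot_pos f z : slice_starlike f -> Cmod z < 1 -> z <> 0%C -> 0 < fst (rquot f z).
Proof.
intros [HS Hs] Hz Hn; assert (H0 := starlike_symm_neq_0 f z HS Hz Hn).
assert (Hr := rconj_neq_0 f z H0).
assert (HK : imag_sphere (rot (rconj f z) qi))
  by (apply imag_sphere_rot; trivial; apply imag_sphere_qi).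
rewrite <- (lquot_rquot f (rot (rconj f z) qi) z); trivial.
- apply Hs; [now apply qball_on_slice | now apply on_slice_neq_0].
- apply HS.
- unfold rot; now rewrite !qassoc, qmult_inv_r, qmult_1_l.
Qed.

Lemma rquot_Harnack_circle f (z : C) s : slice_starlike f -> z <> 0%C -> Cmod z < s < 1 ->
  s - Cmod z <= (s + Cmod z) * fst (rquot f z).
Proof.
intros Hf Hn Hs; generalize (Cmod_ge_0 z); intros Hz0.
set (r := (1 + s) / 2); assert (Hr : 0 < r < 1) by (unfold r; lra).
assert (Hsr : 0 < s < r) by (unfold r; lra).
destruct (class_S_factor f r (proj1 Hf) Hr)
  as (F1 & F1' & F1'' & G1 & G1' & G1'' & HF & HF' & HG & HG' & EF & EG & HE).
(* [M] and [P] are [symm f] and [rquot f] with the common factor w^2 cancelled; this removes the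
   singularity at 0, where [P] takes the value 1. *)
set (M := fun w => (F1 w * hat F1 w + G1 w * hat G1 w)%C).
set (P := fun w => (((F1 w + w * F1' w) * hat F1 w +
  G1 w * hat (fun w => G1 w + w * G1' w) w) / M w)%C).
assert (Ehat : forall w, Cmod w < r -> hat (Fc f) w = (w * hat F1 w)%C /\
   hat (Gc f) w = (w * hat G1 w)%C /\
   hat (fun w => q2 (dxi f w)) w = hat (fun w => G1 w + w * G1' w)%C w).
{ intros w Hw; assert (Hw' : Cmod (Cconj w) < r) by now rewrite Cmod_conj.
  destruct (HE _ Hw') as (E1 & E2 & _ & E3).
  unfold hat; now rewrite E1, E2, E3, !Cmult_conj, Cconj_conj. }
assert (EM : forall w, Cmod w < r -> symm f w = (w * w * M w)%C).
{ intros w Hw; destruct (HE _ Hw) as (E1 & E2 & _), (Ehat w Hw) as (E3 & E4 & _).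
  unfold symm, M; rewrite E1, E2, E3, E4; ring. }
assert (HM : forall w, Cmod w < r -> M w <> 0%C).
{ intros w Hw; destruct (Ceq_dec w 0) as [->|Hw0].
  - unfold M, hat; replace (Cconj 0) with (RtoC 0) by (apply injective_projections; simpl; ring).
    rewrite EF, EG; intros E; apply (f_equal fst) in E; simpl in E; lra.
  - intros E; apply (starlike_symm_neq_0 f w (proj1 Hf)); trivial; [lra|].
    rewrite EM, E by trivial; ring. }
assert (HP : Hol r P).
{ assert (K1 : Hol r F1) by (eexists; eassumption).
  assert (K2 : Hol r G1) by (eexists; eassumption).
  assert (K3 : Hol r F1') by (eexists; eassumption).
  assert (K4 : Hol r G1') by (eexists; eassumption).
  assert (KM : Hol r M)
    by (apply Hol_plus; apply Hol_mult; trivial; now apply Hol_hat).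
  apply Hol_div; trivial; apply Hol_plus; apply Hol_mult; trivial.
  - apply Hol_plus; trivial; apply Hol_mult; trivial; apply Hol_id.
  - now apply Hol_hat.
  - apply Hol_hat, Hol_plus; trivial; apply Hol_mult; trivial; apply Hol_id. }
assert (EP : forall w, Cmod w < r -> w <> 0%C -> P w = rquot f w).
{ intros w Hw Hw0; destruct (HE _ Hw) as (E1 & E2 & E3 & _), (Ehat w Hw) as (E4 & _ & E5).
  unfold rquot, P; rewrite EM, E2, E3, E4, E5 by trivial.
  field; split; trivial; now apply HM. }
assert (EP0 : P 0%C = 1%C).
{ unfold P, M, hat.
  replace (Cconj (RtoC 0)) with (RtoC 0) by (apply injective_projections; simpl; ring).
  rewrite EF, EG.
  replace (Cconj (RtoC 1)) with (RtoC 1) by (apply injective_projections; simpl; ring).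
  field; intros E; apply (f_equal fst) in E; simpl in E; lra. }
rewrite <- EP by (trivial; lra).
replace (s - Cmod z) with ((s - Cmod z) * fst (P 0%C)) by (rewrite EP0; simpl; ring).
apply (Harnack_circle r); trivial; [lra|].
intros t; assert (Hc : Cmod (circ s t) = s) by (apply Cmod_circ; lra).
assert (Hc0 : circ s t <> 0%C) by (intros E; rewrite E, Cmod_0 in Hc; lra).
rewrite EP by (trivial; lra); apply Rlt_le, rquot_pos; trivial; lra.
Qed.

Lemma rquot_Harnack f (z : C) : slice_starlike f -> z <> 0%C -> Cmod z < 1 ->
  1 - Cmod z <= (1 + Cmod z) * fst (rquot f z).
Proof.
intros Hf Hn Hz; set (p := fst (rquot f z)); set (r := Cmod z) in *.
apply Rnot_lt_le; intros H.
assert (Hr0 : 0 <= r) by apply Cmod_ge_0.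
assert (Hp : 0 < p) by now apply rquot_pos.
(* In the limit s -> 1 taken by contradiction, 1 - s is at most half of the supposed deficit, which
   refutes the bound at radius [s], and at most (1 - r) / 2, which keeps [s] above [r]. *)
set (s := 1 - Rmin ((1 - r) / 2) ((1 - r - (1 + r) * p) / 2)).
assert (D1 := Rmin_l ((1 - r) / 2) ((1 - r - (1 + r) * p) / 2)).
assert (D2 := Rmin_r ((1 - r) / 2) ((1 - r - (1 + r) * p) / 2)).
assert (D3 : 0 < Rmin ((1 - r) / 2) ((1 - r - (1 + r) * p) / 2))
  by (apply Rmin_glb_lt; lra).
assert (K := rquot_Harnack_circle f z s Hf Hn); fold r p in K.
assert (Hs : r < s < 1) by (unfold s; lra).
specialize (K Hs); assert (s + r < 1 + r) by lra.
unfold s in *; nra.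
Qed.

(** * Growth and covering *)

(** Write the value as v = b + K c, so that n = conj b + i conj c. From K v = v i one gets v n =
    |b|^2 - |c|^2 + 2 K Re (b conj c), which commutes with K. Hence v n K = K v n = v i n, and v
    cancels. *)
Lemma rconj_intertwines g K z : slice_regular g -> imag_sphere K -> Cmod z < 1 ->
  on_slice g K z <> 0%quat -> (K * on_slice g K z = on_slice g K z * qi)%quat ->
  (rconj g z * K = qi * rconj g z)%quat.
Proof.
intros Hg HK Hz Hv0.
set (u := g (qC z 0)); set (w := g (qC (Cconj z) 0)).
set (b := ((1 / 2) *: (u + w))%quat); set (c := ((1 / 2) *: (qi * (w - u)))%quat).
assert (Ev : on_slice g K z = (b + K * c)%quat).
{ unfold on_slice; rewrite representation by trivial; fold u w.
  unfold b, c, pl, pr, qi; clear Hv0 HK Hz; destruct u as [[[? ?] ?] ?], w as [[[? ?] ?] ?],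
    K as [[[? ?] ?] ?]; apply quat_eq; quat_simpl; field. }
assert (En : rconj g z = (qconj b + qi * qconj c)%quat).
{ unfold b, c, u, w; rewrite !f_qC, (hat_conj (Fc g)), (hat_conj (Gc g)).
  unfold rconj; destruct (Fc g z), (Gc g z), (hat (Fc g) z), (hat (Gc g) z).
  unfold qC, qi; apply quat_eq; quat_simpl; field. }
set (v := on_slice g K z) in *; set (n := rconj g z) in *; intros EK.
assert (Evn : (v * n = qreal (nsq b - nsq c) +
  K * qreal (2 * qRe (b * qconj c)))%quat).
{ rewrite En, qdistr_r, qassoc, <- EK, Ev.
  transitivity (b * qconj b + K * (c * qconj b + b * qconj c) +
    K * K * (c * qconj c))%quat.
  - clear; destruct K as [[[? ?] ?] ?], b as [[[? ?] ?] ?], c as [[[? ?] ?] ?].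
    apply quat_eq; quat_simpl; ring.
  - rewrite HK; clear; destruct K as [[[? ?] ?] ?], b as [[[? ?] ?] ?], c as [[[? ?] ?] ?].
    apply quat_eq; quat_simpl; ring. }
assert (Ec : (K * (v * n) = v * n * K)%quat).
{ rewrite Evn; now rewrite qdistr_l, qdistr_r, qreal_comm, <- (qassoc K _ K), (qreal_comm _ K). }
rewrite qassoc, EK, <- !qassoc in Ec.
apply (f_equal (fun p => / v * p)%quat) in Ec.
now rewrite !(qassoc (/ v)%quat), qmult_inv_l, !qmult_1_l in Ec by trivial.
Qed.

Lemma lquot_frot a f q : a <> 0%quat -> slice_regular f -> qball 0 1 q ->
  f (unrot a q) <> 0%quat -> lquot (frot a f) q = lquot f (unrot a q).
Proof.
intros Ha Hf Hq H; unfold lquot; rewrite slice_derive_frot by trivial.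
unfold frot; rewrite rot_inv by trivial.
replace (rot a (/ f (unrot a q)) * q)%quat with (rot a (/ f (unrot a q) * unrot a q)%quat)
  by now rewrite <- rot_mult, rot_unrot.
now rewrite rot_mult, qRe_rot.
Qed.

Lemma rot_slice_point a I x y : a <> 0%quat ->
  rot a (slice_point I x y) = slice_point (rot a I) x y.
Proof.
intros Ha; rewrite <- (unrot_rot a Ha I) at 1.
now rewrite <- unrot_slice_point, rot_unrot.
Qed.

(* Rotating by [1 / f z] makes the slice [C_i] the one on which the regular
   quotient takes the real part of the value of [lquot] at [z]. *)
Lemma lquot_Harnack f (z : C) : slice_starlike f -> z <> 0%C -> Cmod z < 1 ->
  1 - Cmod z <= (1 + Cmod z) * lquot f (qC z 0).
Proof.
intros Hf Hz0 Hz.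
assert (Hq : qball 0 1 (qC z 0)) by (apply qball_0; now rewrite qnorm_qC0).
set (v := f (qC z 0)).
assert (Hv : v <> 0%quat).
{ intros E; apply (proj1 (proj1 (proj2 (proj1 Hf)) _ Hq)) in E.
  apply Hz0, Cmod_eq_0; now rewrite <- qnorm_qC0, E, qnorm_0. }
set (a := (/ v)%quat).
assert (Ha : a <> 0%quat) by now apply qinv_neq_0.
assert (Ea : (/ a)%quat = v) by (symmetry; apply qinv_unique, qmult_inv_l, Hv).
set (K := rot a qi).
assert (HK : imag_sphere K) by (apply imag_sphere_rot; trivial; apply imag_sphere_qi).
assert (Hg := slice_starlike_frot a Ha f Hf).
assert (Eq : slice_point K (fst z) (snd z) = rot a (qC z 0)).
{ unfold K; rewrite <- rot_slice_point, slice_point_qi by trivial; now destruct z. }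
(* Conjugation by a = 1 / v fixes v, and K = v i v^{-1} satisfies K v = v i, as [rconj_intertwines]
   requires. *)
assert (Eg : on_slice (frot a f) K z = v).
{ unfold on_slice; rewrite Eq; unfold frot; rewrite unrot_rot by trivial.
  unfold rot; rewrite Ea; fold v; unfold a.
  now rewrite <- qassoc, qmult_inv_r, qmult_1_r. }
replace (lquot f (qC z 0)) with (fst (rquot (frot a f) z)); [now apply rquot_Harnack|].
rewrite <- (lquot_rquot _ K); trivial.
- rewrite lquot_frot; trivial.
  + now rewrite Eq, unrot_rot.
  + apply Hf.
  + now apply qball_on_slice.
  + now rewrite Eq, unrot_rot.
- apply Hg.
- apply rconj_intertwines; trivial; [apply Hg | now rewrite Eg |].
  rewrite Eg; unfold K, rot; rewrite Ea; unfold a.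
  now rewrite <- qassoc, qmult_inv_l, qmult_1_r.
- apply starlike_symm_neq_0; trivial; apply Hg.
Qed.

(** As f^{-1} = conj f / |f|^2, both sides are half the radial derivative r d/dr of |f|^2. *)
Lemma lquot_qC f z : slice_regular f -> Cmod z < 1 -> f (qC z 0) <> 0%quat ->
  lquot f (qC z 0) * qnorm (f (qC z 0)) ^ 2 =
  fst (Cconj (Fc f z) * (z * q1 (dxi f z)) + Cconj (Gc f z) * (z * q2 (dxi f z)))%C.
Proof.
intros Hf Hz H; apply qnorm_pos in H; unfold lquot; rewrite slice_derive_qC by trivial.
rewrite <- (qC_eta (dxi f z)); unfold qinv.
set (N := qnorm (f (qC z 0))) in *.
rewrite (f_qC f z); destruct (Fc f z), (Gc f z), (q1 (dxi f z)), (q2 (dxi f z)), z.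
unfold qC; quat_simpl; field; lra.
Qed.

(** To be used with a, b, c, d the real components of f / z along a ray; the derivative is factored
    so that its sign is that of the last bracket. *)
Lemma is_derive_weighted (a b c d : R -> R) t a' b' c' d' :
  is_derive a t a' -> is_derive b t b' -> is_derive c t c' -> is_derive d t d' ->
  is_derive (fun s => (a s ^ 2 + b s ^ 2 + (c s ^ 2 + d s ^ 2)) * (1 + s) ^ 4) t
    (2 * (1 + t) ^ 3 * ((1 + t) * (a t * a' + b t * b' + (c t * c' + d t * d')) +
       2 * (a t ^ 2 + b t ^ 2 + (c t ^ 2 + d t ^ 2)))).
Proof.
intros Ha Hb Hc Hd; auto_derive.
- repeat split; eexists; eassumption.
- replace (Derive (fun x => a x) t) with a' by (symmetry; now apply is_derive_unique).
  replace (Derive (fun x => b x) t) with b' by (symmetry; now apply is_derive_unique).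
  replace (Derive (fun x => c x) t) with c' by (symmetry; now apply is_derive_unique).
  replace (Derive (fun x => d x) t) with d' by (symmetry; now apply is_derive_unique).
  ring.
Qed.

(** Integration without logarithms: along the ray through [z], the function |f|^2 (1 + t)^4 / t^2
    has nonnegative derivative by Harnack's bound. Written with f divided by z, it is differentiable
    at 0 too and has value 1 there. *)
Lemma growth_slice f (z : C) : slice_starlike f -> z <> 0%C -> Cmod z < 1 ->
  Cmod z <= (1 + Cmod z) ^ 2 * qnorm (f (qC z 0)).
Proof.
intros Hf Hz0 Hz; assert (Hp := proj1 (Cmod_gt_0 z) Hz0).
set (r0 := Cmod z) in *; set (r := (1 + r0) / 2).
assert (Hr : 0 < r < 1) by (unfold r; lra).
assert (Hr0 : r0 < r) by (unfold r; lra).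
destruct (class_S_factor f r (proj1 Hf) Hr)
  as (F1 & F1' & F1'' & G1 & G1' & G1'' & HF & _ & HG & _ & EF & EG & HE).
set (u := (z / RtoC r0)%C).
assert (Hr0c : RtoC r0 <> 0%C) by (intros E; apply RtoC_inj in E; lra).
assert (Hu : Cmod u = 1).
{ unfold u; rewrite Cmod_div, Cmod_R, Rabs_pos_eq by (trivial; lra); fold r0; field; lra. }
assert (Ez : (RtoC r0 * u)%C = z) by (unfold u; field; trivial).
set (g := fun t : R => (RtoC t * u)%C).
assert (Hgm : forall t, 0 <= t -> Cmod (g t) = t).
{ intros t Ht; unfold g; rewrite Cmod_mult, Hu, Cmod_R, Rabs_pos_eq; lra. }
set (psi := fun t => (fst (F1 (g t)) ^ 2 + snd (F1 (g t)) ^ 2 +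
  (fst (G1 (g t)) ^ 2 + snd (G1 (g t)) ^ 2)) * (1 + t) ^ 4).
set (psi' := fun t => 2 * (1 + t) ^ 3 * ((1 + t) *
  (fst (F1 (g t)) * fst (F1' (g t) * u)%C + snd (F1 (g t)) * snd (F1' (g t) * u)%C +
   (fst (G1 (g t)) * fst (G1' (g t) * u)%C + snd (G1 (g t)) * snd (G1' (g t) * u)%C)) +
  2 * (fst (F1 (g t)) ^ 2 + snd (F1 (g t)) ^ 2 +
      (fst (G1 (g t)) ^ 2 + snd (G1 (g t)) ^ 2)))).
assert (Hpsi : forall t, 0 <= t <= r0 -> derivable_pt_lim psi t (psi' t)).
{ intros t Ht; apply is_derive_Reals.
  assert (Hgt : Cmod (g t) < r) by (rewrite Hgm; lra).
  assert (Dg1 : is_derive (fun s => fst (g s)) t (fst u)).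
  { unfold g; simpl; auto_derive; trivial; ring. }
  assert (Dg2 : is_derive (fun s => snd (g s)) t (snd u)).
  { unfold g; simpl; auto_derive; trivial; ring. }
  destruct (cderiv_curve F1 g t _ u (proj1 (HF _ Hgt)) Dg1 Dg2) as [D1 D2].
  destruct (cderiv_curve G1 g t _ u (proj1 (HG _ Hgt)) Dg1 Dg2) as [D3 D4].
  exact (is_derive_weighted _ _ _ _ t _ _ _ _ D1 D2 D3 D4). }
destruct (MVT_cor2 psi psi' 0 r0 Hp Hpsi) as (t & E & Ht).
assert (Hnorm : forall s, 0 <= s < r -> qnorm (f (qC (g s) 0)) ^ 2 =
  s ^ 2 * (fst (F1 (g s)) ^ 2 + snd (F1 (g s)) ^ 2 +
    (fst (G1 (g s)) ^ 2 + snd (G1 (g s)) ^ 2))).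
{ intros s Hs; destruct (HE (g s)) as (E1 & E2 & _); [rewrite Hgm; lra|].
  rewrite qnorm_f_qC, E1, E2, !Cmod_mult, Hgm, !Rpow_mult_distr, !Cmod_sqr by lra; ring. }
assert (Hpos : 0 <= psi' t).
{ set (w := g t); assert (Hw : Cmod w = t) by (apply Hgm; lra).
  assert (Hw0 : w <> 0%C) by (apply Cmod_gt_0; lra).
  assert (Hwr : Cmod w < r) by lra.
  destruct (HE w Hwr) as (E1 & E2 & E3 & E4).
  assert (Hq : qball 0 1 (qC w 0)) by (apply qball_0; rewrite qnorm_qC0; lra).
  assert (Hfw : f (qC w 0) <> 0%quat).
  { intros E0; apply (proj1 (proj1 (proj2 (proj1 Hf)) _ Hq)) in E0.
    apply Hw0, Cmod_eq_0; now rewrite <- qnorm_qC0, E0, qnorm_0. }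
  assert (HH := lquot_Harnack f w Hf Hw0 ltac:(lra)).
  assert (HL := lquot_qC f w (proj1 (proj1 Hf)) ltac:(lra) Hfw).
  assert (HN := Hnorm t ltac:(lra)); fold w in HN.
  apply (Rmult_le_compat_r (qnorm (f (qC w 0)) ^ 2)) in HH; [|apply pow2_ge_0].
  rewrite (Rmult_assoc (1 + Cmod w)), HL, HN, E1, E2, E3, E4, Hw in HH.
  unfold psi'; fold w.
  assert (Hu2 : fst u ^ 2 + snd u ^ 2 = 1) by (rewrite <- Cmod_sqr, Hu; ring).
  set (m := fst (F1 w) ^ 2 + snd (F1 w) ^ 2 + (fst (G1 w) ^ 2 + snd (G1 w) ^ 2)) in *.
  set (T := fst (F1 w) * fst (F1' w * u)%C + snd (F1 w) * snd (F1' w * u)%C +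
   (fst (G1 w) * fst (G1' w * u)%C + snd (G1 w) * snd (G1' w * u)%C)).
  assert (EE : fst (Cconj (w * F1 w) * (w * (F1 w + w * F1' w)) +
     Cconj (w * G1 w) * (w * (G1 w + w * G1' w)))%C = t ^ 2 * (m + t * T)).
  { replace (t ^ 2 * (m + t * T)) with (t ^ 2 * (fst u ^ 2 + snd u ^ 2) * (m + t * T))
      by (rewrite Hu2; ring).
    unfold m, T, w, g; simpl; ring. }
  rewrite EE in HH.
  (* The difference of the two sides of [HH] is t^3 times this bracket. *)
  assert (K : 0 <= (1 + t) * T + 2 * m).
  { apply Rmult_le_reg_l with (t ^ 3); [apply pow_lt; lra|]; nra. }
  apply Rmult_le_pos; trivial.
  apply Rmult_le_pos; [lra | apply pow_le; lra]. }
assert (E0 : psi 0 = 1).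
{ unfold psi; replace (g 0) with (RtoC 0) by (unfold g; ring).
  rewrite EF, EG; simpl; ring. }
assert (E1 : 1 <= psi r0) by nra.
apply sqr_le_inv.
{ apply Rmult_le_pos; [apply pow2_ge_0 | apply qnorm_ge_0]. }
rewrite Rpow_mult_distr, <- Ez at 1; fold (g r0).
replace (qnorm (f (qC z 0))) with (qnorm (f (qC (g r0) 0))) by (unfold g; now rewrite Ez).
rewrite Hnorm by lra; unfold psi in E1.
apply Rle_trans with (r0 ^ 2 * 1); [right; ring|].
eapply Rle_trans; [apply Rmult_le_compat_l; [apply pow2_ge_0 | exact E1]|].
right; ring.
Qed.

Lemma growth f q : slice_starlike f -> qball 0 1 q ->
  qnorm q <= (1 + qnorm q) ^ 2 * qnorm (f q).
Proof.
intros Hf Hq; destruct (Req_dec (qnorm q) 0) as [E|N].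
{ rewrite E; apply Rmult_le_pos; [apply pow2_ge_0 | apply qnorm_ge_0]. }
destruct (slice_point_exists q) as (I & x & y & HI & _ & Eq).
destruct (sphere_rotation I HI) as (a & Ha & Ea).
assert (Ea' : unrot a qi = I).
{ unfold unrot; now rewrite Ea, <- qassoc, qmult_inv_r, qmult_1_r. }
assert (En : qnorm q = Cmod (x, y)) by (rewrite Eq; now apply qnorm_slice_point).
rewrite qball_0 in Hq; rewrite En in N, Hq |- *.
replace (qnorm (f q)) with (qnorm (frot a f (qC (x, y) 0))).
- apply growth_slice; [now apply slice_starlike_frot | | exact Hq].
  intros E; apply N; rewrite E; apply Cmod_0.
- unfold frot; rewrite qnorm_rot by trivial.
  now rewrite <- slice_point_qi, unrot_slice_point, Ea', Eq.
Qed.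

(** * Covering of the ball of radius 1/4 *)

Lemma slice_regular_minus_const f c : slice_regular f ->
  slice_regular (fun q => f q - c)%quat.
Proof.
intros Hf.
assert (D : forall (g : R -> quat) t, ex_derive g t ->
  is_derive (fun s => (g s - c)%quat) t (qDerive g t)).
{ intros g t Hg; apply is_derive_qDerive in Hg.
  replace (qDerive g t) with (minus (qDerive g t) (@zero quat_AbelianGroup))
    by apply (minus_zero_r (G := quat_AbelianGroup)).
  apply (is_derive_minus (V := quat_NormedModule)); trivial.
  apply (is_derive_const (V := quat_NormedModule)). }
assert (Dx : forall I x y, imag_sphere I -> Cmod (x, y) < 1 ->
  slice_dx (fun q => f q - c)%quat I x y = slice_dx f I x y /\
  slice_dy (fun q => f q - c)%quat I x y = slice_dy f I x y).
{ intros I x y HI H; apply (qball_slice_point I) in H; trivial.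
  destruct (Hf I HI x y H) as (Hx & Hy & _).
  split; apply qDerive_correct; now apply D. }
intros I HI x y H; assert (Hz := proj1 (qball_slice_point I x y HI) H).
destruct (Hf I HI x y H) as (Hx & Hy & Hcx & Hcy & CR).
assert (Hl : locally (x, y) (fun z : C => Cmod z < 1)) by now apply locally_disc.
repeat split.
- eexists; now apply D.
- eexists; now apply D.
- revert Hcx; apply continuous_ext_loc; revert Hl; apply filter_imp.
  intros z Hzz; symmetry; exact (proj1 (Dx I (fst z) (snd z) HI Hzz)).
- revert Hcy; apply continuous_ext_loc; revert Hl; apply filter_imp.
  intros z Hzz; symmetry; exact (proj2 (Dx I (fst z) (snd z) HI Hzz)).
- destruct (Dx I x y HI Hz) as [-> ->]; exact CR.
Qed.

Lemma qnorm_scal x q : qnorm (x *: q)%quat = Rabs x * qnorm q.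
Proof.
rewrite qscal_real, qnorm_mult; f_equal.
change (qreal x) with (qC (RtoC x) 0); now rewrite qnorm_qC0, Cmod_R.
Qed.

Lemma qnorm_minus_ge p q : qnorm p - qnorm q <= qnorm (p - q)%quat.
Proof.
replace (qnorm p) with (norm p) by (symmetry; apply qnorm_norm).
replace (qnorm q) with (norm q) by (symmetry; apply qnorm_norm).
replace (qnorm (p - q)%quat) with (norm (minus p q)) by (symmetry; apply qnorm_norm).
generalize (norm_triangle_inv (V := quat_NormedModule) p q).
generalize (Rle_abs (norm p - norm q)); intros H1 H2; eapply Rle_trans; [exact H1 | exact H2].
Qed.

(* The values [(k / n) w] are attained one after the other: near a point where
   the first one is attained, [f - ((k + 1) / n) w] is smaller than near the boundary. *)
Lemma starlike_covers f w : slice_starlike f -> qball 0 (1 / 4) w -> ball_image f w.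
Proof.
intros Hf Hw; rewrite qball_0 in Hw.
(* [m] lies strictly between |w| and 1/4 and will bound |f| from below near the boundary. The radius
   [r], which tends to 1 as [m] tends to 1/4, is large enough for rho / (1 + rho)^2 >= m whenever r
   <= rho < 1. *)
set (m := (qnorm w + 1 / 4) / 2); set (r := 1 / 2 + 2 * m).
generalize (qnorm_ge_0 w); intros Hw0.
assert (Hm : qnorm w < m < 1 / 4) by (unfold m; lra).
assert (Hr : 0 < r < 1) by (unfold r; lra).
assert (Hbig : forall q, r <= qnorm q -> qball 0 1 q -> m <= qnorm (f q)).
{ intros q H1 H2; generalize (growth f q Hf H2); rewrite qball_0 in H2.
  set (rho := qnorm q) in *; intros H3.
  assert (m * (1 + rho) ^ 2 <= rho) by (unfold r in *; nra).
  apply Rmult_le_reg_l with ((1 + rho) ^ 2); [apply pow_lt|]; lra. }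
(* The number of steps is chosen so that one step, |w| / N, is shorter than the gap m - |w| between
   the boundary values and the targets. *)
destruct (nfloor_ex (qnorm w / (m - qnorm w))) as [n [_ Hn]].
{ apply Rmult_le_pos; trivial; apply Rlt_le, Rinv_0_lt_compat; lra. }
set (N := INR n + 1) in *.
assert (HN : 0 < N) by (unfold N; generalize (pos_INR n); lra).
assert (HNw : qnorm w / N < m - qnorm w).
{ apply Rmult_lt_reg_r with N; trivial.
  replace (qnorm w / N * N) with (qnorm w) by (field; lra).
  apply Rmult_lt_compat_l with (r := m - qnorm w) in Hn; [|lra].
  replace ((m - qnorm w) * (qnorm w / (m - qnorm w))) with (qnorm w) in Hn by (field; lra).
  lra. }
assert (H : forall k : nat, (k <= S n)%nat -> ball_image f ((INR k / N) *: w)%quat).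
{ induction k as [|k IH]; intros Hk.
  - exists 0%quat; assert (H0 : qball 0 1 0%quat) by (apply qball_0; rewrite qnorm_0; lra).
    split; trivial; rewrite (proj2 (proj1 (proj2 (proj1 Hf)) _ H0) eq_refl).
    simpl INR; unfold Rdiv; rewrite Rmult_0_l.
    clear; destruct w as [[[? ?] ?] ?]; apply quat_eq; quat_simpl; ring.
  - destruct IH as (q0 & Hq0 & E0); [lia|].
    apply NNPP; intros Hnot.
    set (c := ((INR (S k) / N) *: w)%quat) in *.
    assert (Hkb : forall j, (j <= S n)%nat -> 0 <= INR j / N <= 1).
    { intros j Hj; apply le_INR in Hj; rewrite S_INR in Hj; fold N in Hj.
      split; [apply Rmult_le_pos; [apply pos_INR | now apply Rlt_le, Rinv_0_lt_compat]|].
      apply Rmult_le_reg_r with N; trivial.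
      replace (INR j / N * N) with (INR j) by (field; lra); lra. }
    assert (Hsc : forall j, (j <= S n)%nat -> qnorm ((INR j / N) *: w)%quat <= qnorm w).
    { intros j Hj; rewrite qnorm_scal, Rabs_pos_eq by now apply Hkb.
      generalize (Hkb j Hj); intros; nra. }
    (* If [c] were omitted, |f - c| would be at least m - |w| at [q0] as it is on the sphere of
       radius [r], whereas at [q0] it is only |w| / N. *)
    assert (K := min_modulus (fun q => f q - c)%quat r (m - qnorm w)).
    assert (Hq0r : qnorm q0 < r).
    { apply Rnot_le_lt; intros Hle; generalize (Hbig q0 Hle Hq0); rewrite E0.
      generalize (Hsc k ltac:(lia)); lra. }
    assert (K' : m - qnorm w <= qnorm (f q0 - c)%quat).
    { apply K; trivial; try lra.
      - apply slice_regular_minus_const, Hf.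
      - intros q Hq E; apply Hnot; exists q; split; trivial.
        replace (f q) with (f q - c + c)%quat.
        + rewrite E; apply (plus_zero_l (G := quat_AbelianGroup)).
        + clear; destruct (f q) as [[[? ?] ?] ?], c as [[[? ?] ?] ?];
          apply quat_eq; quat_simpl; ring.
      - intros q Hq; eapply Rle_trans; [|apply qnorm_minus_ge].
        assert (m <= qnorm (f q)) by (apply Hbig; [lra | apply qball_0; lra]).
        generalize (Hsc (S k) Hk); fold c; lra. }
    revert K'; rewrite E0.
    replace ((INR k / N) *: w - c)%quat with ((- (1 / N)) *: w)%quat.
    + rewrite qnorm_scal, Rabs_Ropp, Rabs_pos_eq.
      * replace (1 / N * qnorm w) with (qnorm w / N) by (field; lra); lra.
      * apply Rmult_le_pos; [lra | now apply Rlt_le, Rinv_0_lt_compat].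
    + unfold c; rewrite S_INR; clear - HN; destruct w as [[[? ?] ?] ?].
      apply quat_eq; quat_simpl; field; lra. }
specialize (H (S n) (Nat.le_refl _)); rewrite S_INR in H; fold N in H.
replace (N / N) with 1 in H by (field; lra).
replace ((1 *: w)%quat) with w in H; trivial.
clear; destruct w as [[[? ?] ?] ?]; apply quat_eq; quat_simpl; ring.
Qed.

(** * The Koebe function *)

(** The embedding of C onto the slice C_I; being multiplicative, it reduces the computations for
    [koebe] to complex ones. *)
Definition iota (I : quat) (z : C) : quat := slice_point I (fst z) (snd z).

Lemma iota_plus I z w : (iota I z + iota I w)%quat = iota I (z + w)%C.
Proof.
unfold iota, slice_point; destruct z, w, I as [[[? ?] ?] ?].
apply quat_eq; quat_simpl; ring.
Qed.

Lemma iota_minus I z w : (iota I z - iota I w)%quat = iota I (z - w)%C.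
Proof.
unfold iota, slice_point; destruct z, w, I as [[[? ?] ?] ?].
apply quat_eq; quat_simpl; ring.
Qed.

Lemma iota_1 I : iota I (RtoC 1) = 1%quat.
Proof.
unfold iota, slice_point; destruct I as [[[? ?] ?] ?]; apply quat_eq; quat_simpl; ring.
Qed.

Lemma iota_Ci I : iota I Ci = I.
Proof.
unfold iota, slice_point; destruct I as [[[? ?] ?] ?]; apply quat_eq; quat_simpl; ring.
Qed.

Lemma iota_mult I z w : imag_sphere I -> (iota I z * iota I w)%quat = iota I (z * w)%C.
Proof.
intros HI; unfold iota, slice_point; destruct z as [x y], w as [x' y']; simpl.
transitivity (qreal (x * x') + (x * y' + y * x') *: I + (y * y') *: (I * I))%quat.
- clear HI; destruct I as [[[? ?] ?] ?]; apply quat_eq; quat_simpl; ring.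
- rewrite HI; clear HI; destruct I as [[[? ?] ?] ?]; apply quat_eq; quat_simpl; ring.
Qed.

Lemma iota_inv I z : imag_sphere I -> z <> RtoC 0 -> (/ iota I z)%quat = iota I (/ z)%C.
Proof.
intros HI Hz; symmetry; apply qinv_unique.
now rewrite iota_mult, Cinv_r, iota_1.
Qed.

Lemma qnorm_iota I z : imag_sphere I -> qnorm (iota I z) = Cmod z.
Proof. apply qnorm_on_slice. Qed.

Lemma iota_inj I z w : imag_sphere I -> iota I z = iota I w -> z = w.
Proof.
intros HI E; apply Ceq_minus, Cmod_eq_0.
rewrite <- (qnorm_iota I), <- iota_minus, E by trivial.
rewrite <- qnorm_0; f_equal; apply (minus_eq_zero (G := quat_AbelianGroup)).
Qed.

Lemma qRe_iota I z : imag_sphere I -> qRe (iota I z) = fst z.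
Proof.
destruct I as [[[t b] c] d]; intros H; apply imag_sphereP in H; destruct H as [-> _].
unfold iota, slice_point; quat_simpl; ring.
Qed.

Lemma slice_point_scal I x y : slice_point I x y = (x *: 1 + y *: I)%quat.
Proof.
unfold slice_point; destruct I as [[[? ?] ?] ?]; apply quat_eq; quat_simpl; ring.
Qed.

Lemma is_derive_iota I (g : R -> C) t l :
  is_derive (fun s => fst (g s)) t (fst l) -> is_derive (fun s => snd (g s)) t (snd l) ->
  is_derive (fun s => iota I (g s)) t (iota I l).
Proof.
intros H1 H2; unfold iota; rewrite slice_point_scal.
apply (is_derive_ext (fun s => plus (scal (fst (g s)) (1%quat : quat_NormedModule))
  (scal (snd (g s)) (I : quat_NormedModule)))).
{ intros s; symmetry; apply slice_point_scal. }
apply (is_derive_plus (V := quat_NormedModule));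
  now apply (is_derive_scal_l (V := quat_NormedModule)).
Qed.

Lemma continuous_iota {U : UniformSpace} I (g : U -> C) x :
  continuous g x -> continuous (fun u => iota I (g u)) x.
Proof.
intros H; unfold iota.
apply (continuous_ext (fun s => plus (scal (fst (g s)) (1%quat : quat_NormedModule))
  (scal (snd (g s)) (I : quat_NormedModule)))).
{ intros s; symmetry; apply slice_point_scal. }
apply (continuous_plus (V := quat_NormedModule));
  apply (continuous_scal_l (V := quat_NormedModule)); [now apply continuous_Re | now apply continuous_Im].
Qed.

Definition koebe (q : quat) : quat := (q * / ((1 - q) * (1 - q)))%quat.
Definition koebeC (z : C) : C := (z * / ((1 - z) * (1 - z)))%C.
Definition koebeC' (z : C) : C := ((1 + z) * / ((1 - z) * (1 - z) * (1 - z)))%C.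

Lemma one_minus_neq_0 (z : C) : Cmod z < 1 -> (1 - z)%C <> RtoC 0.
Proof.
intros Hz E; assert (z = RtoC 1) by (replace z with (1 - (1 - z))%C by ring; rewrite E; ring).
rewrite H, Cmod_1 in Hz; lra.
Qed.

(** The factors q and 1 - q lie in the same commutative slice, so the function maps each slice into
    itself by the classical formula. *)
Lemma koebe_iota I z : imag_sphere I -> Cmod z < 1 -> koebe (iota I z) = iota I (koebeC z).
Proof.
intros HI Hz; assert (Hn := one_minus_neq_0 z Hz); unfold koebe, koebeC.
rewrite <- (iota_1 I), iota_minus, iota_mult, iota_inv, iota_mult; trivial.
now apply Cmult_neq_0.
Qed.

Lemma hol_koebeC : hol 1 koebeC koebeC'.
Proof.
intros z Hz; assert (Hn := one_minus_neq_0 z Hz); split.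
- assert (D : cderiv (fun w => 1 - w)%C z (0 + - (1))%C).
  { apply cderiv_plus; [apply cderiv_const | apply cderiv_opp, cderiv_id]. }
  assert (D2 := cderiv_inv _ _ _ (cderiv_mult _ _ _ _ _ D D) (Cmult_neq_0 _ _ Hn Hn)).
  assert (D3 := cderiv_mult _ _ _ _ _ (cderiv_id z) D2).
  replace (koebeC' z) with
    (1 * / ((1 - z) * (1 - z)) + z * (- ((0 + - (1)) * (1 - z) + (1 - z) * (0 + - (1))) /
      ((1 - z) * (1 - z) * ((1 - z) * (1 - z)))))%C; [exact D3|].
  unfold koebeC'; field; trivial.
- apply (Hol_continuous 1 koebeC'); trivial.
  assert (H1 : Hol 1 (fun w => 1 - w)%C)
    by (apply Hol_minus; [apply Hol_const | apply Hol_id]).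
  apply Hol_mult; [apply Hol_plus; [apply Hol_const | apply Hol_id]|].
  apply Hol_inv.
  + apply Hol_mult; trivial; now apply Hol_mult.
  + intros w Hw; assert (Hnw := one_minus_neq_0 w Hw).
    apply Cmult_neq_0; trivial; now apply Cmult_neq_0.
Qed.

Lemma koebe_partials I x y : imag_sphere I -> Cmod (x, y) < 1 ->
  is_derive (fun t => koebe (slice_point I t y)) x (iota I (koebeC' (x, y))) /\
  is_derive (fun t => koebe (slice_point I x t)) y (iota I (koebeC' (x, y) * Ci)%C).
Proof.
intros HI Hz; destruct (hol_koebeC _ Hz) as [Hd _].
assert (L1 : locally x (fun t => Cmod (t, y) < 1)).
{ assert (Hc : continuous (fun t : R => (t, y) : C) x).
  { apply continuous_C; [apply continuous_id | apply continuous_const]. }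
  exact (Hc _ (locally_disc 1 _ Hz)). }
assert (L2 : locally y (fun t => Cmod (x, t) < 1)).
{ assert (Hc : continuous (fun t : R => (x, t) : C) y).
  { apply continuous_C; [apply continuous_const | apply continuous_id]. }
  exact (Hc _ (locally_disc 1 _ Hz)). }
split.
- apply (is_derive_ext_loc (fun t => iota I (koebeC (t, y)))).
  { revert L1; apply filter_imp; intros t Ht; symmetry; exact (koebe_iota I (t, y) HI Ht). }
  replace (koebeC' (x, y)) with (koebeC' (x, y) * 1)%C by ring.
  destruct (cderiv_curve koebeC (fun t => (t, y)) x _ (RtoC 1) Hd) as [D1 D2].
  + simpl; auto_derive; trivial.
  + simpl; auto_derive; trivial.
  + now apply is_derive_iota.
- apply (is_derive_ext_loc (fun t => iota I (koebeC (x, t)))).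
  { revert L2; apply filter_imp; intros t Ht; symmetry; exact (koebe_iota I (x, t) HI Ht). }
  destruct (cderiv_curve koebeC (fun t => (x, t)) y _ Ci Hd) as [D1 D2].
  + simpl; auto_derive; trivial.
  + simpl; auto_derive; trivial.
  + now apply is_derive_iota.
Qed.

Lemma slice_regular_koebe : slice_regular koebe.
Proof.
assert (E : forall I x y, imag_sphere I -> Cmod (x, y) < 1 ->
  slice_dx koebe I x y = iota I (koebeC' (x, y)) /\
  slice_dy koebe I x y = iota I (koebeC' (x, y) * Ci)%C).
{ intros I x y HI Hz; destruct (koebe_partials I x y HI Hz); split; now apply qDerive_correct. }
intros I HI x y Hq; assert (Hz := proj1 (qball_slice_point I x y HI) Hq).
destruct (koebe_partials I x y HI Hz) as [Dx Dy].
assert (Hl : locally (x, y) (fun z : C => Cmod z < 1)) by now apply locally_disc.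
assert (Hc := proj2 (hol_koebeC _ Hz)).
repeat split.
- eexists; exact Dx.
- eexists; exact Dy.
- apply (continuous_ext_loc _ (fun z : C => iota I (koebeC' z))); [|now apply continuous_iota].
  revert Hl; apply filter_imp; intros [s t] Hst; symmetry; exact (proj1 (E I s t HI Hst)).
- apply (continuous_ext_loc _ (fun z : C => iota I (koebeC' z * Ci)%C)).
  + revert Hl; apply filter_imp; intros [s t] Hst; symmetry; exact (proj2 (E I s t HI Hst)).
  + apply continuous_iota, continuous_Cmult; trivial; apply continuous_const.
- destruct (E I x y HI Hz) as [-> ->].
  rewrite <- (iota_Ci I) at 2; rewrite iota_mult, iota_plus by trivial.
  replace (koebeC' (x, y) + Ci * (koebeC' (x, y) * Ci))%C with (RtoC 0).
  + clear; destruct I as [[[? ?] ?] ?]; apply quat_eq; unfold iota; quat_simpl; ring.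
  + apply injective_projections; simpl; ring.
Qed.

Lemma slice_derive_koebe I z : imag_sphere I -> Cmod z < 1 ->
  slice_derive koebe (iota I z) = iota I (koebeC' z).
Proof.
intros HI Hz; unfold iota at 1; rewrite slice_derive_dx; trivial.
- destruct z as [x y]; apply qDerive_correct; exact (proj1 (koebe_partials I x y HI Hz)).
- apply slice_regular_koebe.
- now apply qball_on_slice.
Qed.

Lemma iota_exists q : qball 0 1 q -> exists I z, imag_sphere I /\ Cmod z < 1 /\ q = iota I z.
Proof.
intros Hq; destruct (slice_point_exists q) as (I & x & y & HI & _ & E).
exists I, (x, y); repeat split; trivial.
rewrite E in Hq; now apply qball_slice_point in Hq.
Qed.

Lemma iota_0 I : iota I (RtoC 0) = 0%quat.
Proof. destruct I as [[[? ?] ?] ?]; apply quat_eq; quat_simpl; ring. Qed.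

Lemma slice_starlike_koebe : slice_starlike koebe.
Proof.
split; [split; [apply slice_regular_koebe | split]|].
- intros q Hq; destruct (iota_exists q Hq) as (I & z & HI & Hz & ->).
  assert (Hn := one_minus_neq_0 z Hz).
  rewrite koebe_iota by trivial; rewrite <- (iota_0 I); split; intros E;
    apply iota_inj in E; trivial; f_equal.
  + replace z with (koebeC z * ((1 - z) * (1 - z)))%C by (unfold koebeC; field; trivial).
    rewrite E; ring.
  + rewrite E; unfold koebeC; ring.
- rewrite <- (iota_0 qi), slice_derive_koebe, <- (iota_1 qi).
  + f_equal; unfold koebeC'; field.
  + apply imag_sphere_qi.
  + rewrite Cmod_0; lra.
- intros q Hq Hq0; destruct (iota_exists q Hq) as (I & z & HI & Hz & ->).
  assert (Hn := one_minus_neq_0 z Hz).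
  assert (Hz0 : z <> RtoC 0) by (intros E; apply Hq0; rewrite E; apply iota_0).
  assert (Hk : koebeC z <> RtoC 0).
  { intros E; apply Hz0.
    replace z with (koebeC z * ((1 - z) * (1 - z)))%C by (unfold koebeC; field; trivial).
    rewrite E; ring. }
  rewrite slice_derive_koebe, koebe_iota, iota_inv, !iota_mult, qRe_iota by trivial.
  (* The real part of (1 + z) / (1 - z) is (1 - |z|^2) / |1 - z|^2. *)
  replace (/ koebeC z * z * koebeC' z)%C with ((1 + z) / (1 - z))%C
    by (unfold koebeC, koebeC'; field; repeat split; trivial).
  apply Cnormsq_neq in Hn; assert (Hz2 : Cmod z ^ 2 < 1) by (generalize (Cmod_ge_0 z); nra).
  rewrite Cmod_sqr in Hz2; destruct z as [x y]; simpl in Hn, Hz2 |- *.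
  assert (HD : 0 < (1 - x) ^ 2 + y ^ 2) by nra.
  match goal with |- 0 < ?e => replace e with
    ((1 - x ^ 2 - y ^ 2) / ((1 - x) ^ 2 + y ^ 2)) by (field; nra) end.
  apply Rdiv_lt_0_compat; nra.
Qed.

(** On a slice, z / (1 - z)^2 + 1/4 = (1 + z)^2 / (4 (1 - z)^2), which vanishes only at the boundary
    point z = -1. *)
Lemma koebe_misses : ~ ball_image koebe (qreal (- (1 / 4))).
Proof.
intros (q & Hq & E); destruct (iota_exists q Hq) as (I & z & HI & Hz & ->).
assert (Hn := one_minus_neq_0 z Hz).
rewrite koebe_iota in E by trivial.
replace (qreal (- (1 / 4))) with (iota I (RtoC (- (1 / 4)))) in E.
2:{ destruct I as [[[? ?] ?] ?]; apply quat_eq; quat_simpl; ring. }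
apply iota_inj in E; trivial.
assert (E2 : ((1 + z) * (1 + z))%C = RtoC 0).
{ replace ((1 + z) * (1 + z))%C with (4 * ((1 - z) * (1 - z)) * (koebeC z + RtoC (1 / 4)))%C.
  - rewrite E, <- RtoC_plus; replace (- (1 / 4) + 1 / 4) with 0 by lra; ring.
  - unfold koebeC; rewrite RtoC_div by lra; field; trivial. }
assert (E3 : (1 + z)%C = RtoC 0).
{ destruct (Ceq_dec (1 + z)%C (RtoC 0)) as [|N]; trivial; now elim (Cmult_neq_0 _ _ N N). }
apply (one_minus_neq_0 (- z)%C); [now rewrite Cmod_opp|].
rewrite <- E3; ring.
Qed.

Theorem theorem6p4 :
  (forall f : quat -> quat, slice_starlike f ->
     forall w : quat, qball 0 (1 / 4) w -> ball_image f w) /\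
  (forall r : R, 1 / 4 < r ->
     ~ (forall f : quat -> quat, slice_starlike f ->
          forall w : quat, qball 0 r w -> ball_image f w)).
Proof.
split.
- intros f Hf w Hw; now apply starlike_covers.
- intros r Hr H; apply koebe_misses, H; [apply slice_starlike_koebe|].
  rewrite qball_0; change (qreal (- (1 / 4))) with (qC (RtoC (- (1 / 4))) 0).
  rewrite qnorm_qC0, Cmod_R, Rabs_Ropp, Rabs_pos_eq; lra.
Qed.
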